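(* Let $\lambda\in\operatorname{Bip}_1(n)$ satisfy $n>a_\lambda$ and $n\not\equiv a_\lambda \pmod l$. The set $$\mathcal{Y}_n(\lambda)=\{Y_1^{\alpha_1}\cdots Y_{q_\lambda+1}^{\alpha_{q_\lambda+1}} : \alpha_i\in\{0,1\}\text{ for all }1\le i\le q_\lambda+1\}$$ is a basis of $Y_n(\lambda)$. In particular, $\dim_{\mathbb{C}}Y_n(\lambda)=2^{q_\lambda+1}$. Consequently, the algebra homomorphism $\Phi:DL_{q_\lambda+1}\to Y_n(\lambda)$ determined by $\Phi(X_j)=Y_j$ is an isomorphism.
   Context: **Standing assumptions.** $n$ is a positive integer, $l$ is odd, $q\in\mathbb{C}$ is a primitive $l$-th root of unity, $m$ is an integer with $1\le m<l$ and $m\not\equiv 0,1,-1\pmod l$. $I=\mathbb{Z}/l\mathbb{Z}$ and $k\in I$ is determined by $2k\equiv m\pmod l$. **Blob algebra.** $b_n(q,m)$ is the unital associative $\mathbb{C}$-algebra generated by $\psi_1,\dots,\psi_{n-1}$, $y_1,\dots,y_n$ and $e(\mathbf{i})$, $\mathbf{i}=(i_1,\dots,i_n)\in I^n$, with relations (all admissible indices): $y_1e(\mathbf{i})=0$ if $i_1=\pm k$; $e(\mathbf{i})=0$ if $i_1\ne\pm k$; $e(\mathbf{i})=0$ if ($i_1=k$, $i_2=k-1$) or ($i_1=-k$, $i_2=-k-1$); $e(\mathbf{i})e(\mathbf{j})=\delta_{\mathbf{i},\mathbf{j}}e(\mathbf{i})$; $\sum_{\mathbf{i}}e(\mathbf{i})=1$;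 $y_re(\mathbf{i})=e(\mathbf{i})y_r$; $\psi_re(\mathbf{i})=e(s_r\mathbf{i})\psi_r$, where $s_r=(r,r+1)$ permutes coordinates; $y_ry_s=y_sy_r$; $\psi_ry_s=y_s\psi_r$ if $s\ne r,r+1$; $\psi_r\psi_s=\psi_s\psi_r$ if $|r-s|>1$; $\psi_ry_{r+1}e(\mathbf{i})=(y_r\psi_r+\delta_{i_r,i_{r+1}})e(\mathbf{i})$; $y_{r+1}\psi_re(\mathbf{i})=(\psi_ry_r+\delta_{i_r,i_{r+1}})e(\mathbf{i})$; $\psi_r^2e(\mathbf{i})$ equals $0$ if $i_r=i_{r+1}$, $(y_{r+1}-y_r)e(\mathbf{i})$ if $i_{r+1}=i_r+1$, $(y_r-y_{r+1})e(\mathbf{i})$ if $i_{r+1}=i_r-1$, and $e(\mathbf{i})$ otherwise; $\psi_r\psi_{r+1}\psi_re(\mathbf{i})=(\psi_{r+1}\psi_r\psi_{r+1}+\epsilon)e(\mathbf{i})$ with $\epsilon=1$ if $i_{r+2}=i_r=i_{r+1}-1$, $\epsilon=-1$ if $i_{r+2}=i_r=i_{r+1}+1$, $\epsilon=0$ otherwise. **Combinatorics.** $\operatorname{Bip}_1(n)$ is the set of one-line bipartitions $\lambda=(\lambda_1,\lambda_2)$, $\lambda_1,\lambda_2\in\mathbb{Z}_{\ge0}$, $\lambda_1+\lambda_2=n$; its boxes are $(1,c,d)$ with $d\in\{1,2\}$ (component) and $1\le c\le\lambda_d$. A standard $\lambda$-bitableau is a bijection from boxes to $\{1,\dots,n\}$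 whose entries increase from left to right in each component. With $\mu=\min\{\lambda_1,\lambda_2\}$, $\mathfrak{t}^\lambda$ is the standard $\lambda$-bitableau in which odd numbers less than $2\mu$ lie in the second component, even numbers at most $2\mu$ lie in the first component, and numbers greater than $2\mu$ fill the remaining boxes. The residue of $(1,c,d)$ is $k+(c-1)$ if $d=1$ and $-k+(c-1)$ if $d=2$ (in $I$). $\mathbf{i}^\lambda\in I^n$ is the sequence whose $j$-th entry is the residue of the box of $\mathfrak{t}^\lambda$ containing $j$. **Notation.** $a_\lambda=2\mu+m$ if $\mu=\lambda_1$, and $a_\lambda=2\mu+l-m$ if $\mu=\lambda_2$. When $n>a_\lambda$ and $n\not\equiv a_\lambda\pmod l$, $q_\lambda,r_\lambda\in\mathbb{Z}_{\ge0}$ are determined by $n-a_\lambda=q_\lambda l+r_\lambda$, $0<r_\lambda<l$. For $1\le j\le q_\lambda+1$: $\underline{j}=a_\lambda+(j-1)l$ and $Y_j=(y_{\underline{j}+1}-y_{\underline{j}})e(\mathbf{i}^\lambda)$. $Y_n(\lambda)$ is the subalgebra of $b_n(q,m)$ generated by $e(\mathbf{i}^\lambda),y_1e(\mathbf{i}^\lambda),\dots,y_ne(\mathbf{i}^\lambda)$; its identity is $e(\mathbf{i}^\lambda)$. Being a basis means the $2^{q_\lambda+1}$ monomials, indexed by $(\alpha_i)$, form a basis; the empty monomial is $e(\mathbf{i}^\lambda)$. **Dot--Line algebra.** $DL_N$ ($N\ge1$) is the associative unital $\mathbb{C}$-algebra generated by $X_1,\dots,X_N$ with relations $X_iX_j=X_jX_i$,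 $X_i^2=-2X_i\sum_{j<i}X_j$ for $2\le i\le N$, and $X_1^2=0$. *)

(* Defs.v *)
From HB Require Import structures.
From mathcomp Require Import all_boot all_order all_algebra.
From mathcomp Require Import fingroup perm zify.
From mathcomp Require Import generic_quotient ring_quotient.
From mathcomp Require Import boolp classical_sets reals.
From mathcomp Require Import complex.
From mathcomp Require Import finmap.
From mathcomp.multinomials Require Import monalg.

Set Implicit Arguments.
Unset Strict Implicit.
Unset Printing Implicit Defensive.

Import GRing.Theory.
Local Open Scope ring_scope.
Local Open Scope quotient_scope.

(* Two-sided ideals of a (noncommutative) algebra, and the quotient by them.
   The quotient may a priori be the zero ring, so it is only a pzRingType and
   an lmodType, with the compatibility stated by alg_quotAl and alg_quotAr. *)

Inductive ideal_gen (A : nzRingType) (S : set A) : A -> Prop :=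
| ideal_gen_in x : S x -> ideal_gen S x
| ideal_gen0 : ideal_gen S 0
| ideal_genB x y : ideal_gen S x -> ideal_gen S y -> ideal_gen S (x - y)
| ideal_genMl a x : ideal_gen S x -> ideal_gen S (a * x)
| ideal_genMr a x : ideal_gen S x -> ideal_gen S (x * a).

Section AlgQuot.
Variables (K : comNzRingType) (A : lalgType K) (S : set A).

Definition ideal_pred : {pred A} := [pred x | `[< ideal_gen S x >]].

Lemma ideal_predP x : reflect (ideal_gen S x) (x \in ideal_pred).
Proof. exact: asboolP. Qed.

Fact ideal_pred_zmod : zmod_closed ideal_pred.
Proof.
split; first by apply/ideal_predP; exact: ideal_gen0.
by move=> x y /ideal_predP hx /ideal_predP hy; apply/ideal_predP/ideal_genB.
Qed.
HB.instance Definition _ := GRing.isZmodClosed.Build A ideal_pred ideal_pred_zmod.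

Definition alg_quot : Type := Quotient.quot ideal_pred.
HB.instance Definition _ := GRing.Zmodule.on alg_quot.
HB.instance Definition _ := EqQuotient.on alg_quot.

Definition alg_pi (x : A) : alg_quot := \pi_(alg_quot) x.

Lemma alg_piP x y : reflect (alg_pi x = alg_pi y) (x - y \in ideal_pred).
Proof. by rewrite Quotient.idealrBE; exact: eqP. Qed.

Lemma alg_piK (u : alg_quot) : alg_pi (repr u) = u.
Proof. exact: reprK. Qed.

Lemma alg_piD x y : alg_pi (x + y) = alg_pi x + alg_pi y.
Proof. by rewrite /alg_pi; exact: (Quotient.pi_add ideal_pred). Qed.

Definition alg_quot1 : alg_quot := alg_pi 1.
Definition alg_quot_mul (u v : alg_quot) : alg_quot := alg_pi (repr u * repr v).
Definition alg_quot_scale (a : K) (u : alg_quot) : alg_quot :=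
  alg_pi (a *: repr u).

Lemma repr_alg_pi x : x - repr (alg_pi x) \in ideal_pred.
Proof. by apply/alg_piP; rewrite alg_piK. Qed.

Lemma alg_quot_mulE x y : alg_quot_mul (alg_pi x) (alg_pi y) = alg_pi (x * y).
Proof.
apply/esym/alg_piP/ideal_predP; set x' := repr _; set y' := repr _.
have -> : x * y - x' * y' = (x - x') * y - (- x') * (y - y').
  by rewrite mulNr opprK mulrBl mulrBr addrA subrK.
apply: ideal_genB; [apply: ideal_genMr | apply: ideal_genMl];
  exact/ideal_predP/repr_alg_pi.
Qed.

Lemma alg_quot_scaleE a x : alg_quot_scale a (alg_pi x) = alg_pi (a *: x).
Proof.
apply/esym/alg_piP/ideal_predP.
rewrite -scalerBr -[_ - _]mul1r scalerAl.
exact/ideal_genMl/ideal_predP/repr_alg_pi.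
Qed.

Fact alg_quot_mulA : associative alg_quot_mul.
Proof.
move=> u v w; rewrite -[u]alg_piK -[v]alg_piK -[w]alg_piK.
by rewrite !alg_quot_mulE mulrA.
Qed.
Fact alg_quot_mul1r : left_id alg_quot1 alg_quot_mul.
Proof. by move=> u; rewrite -[u]alg_piK alg_quot_mulE mul1r. Qed.
Fact alg_quot_mulr1 : right_id alg_quot1 alg_quot_mul.
Proof. by move=> u; rewrite -[u]alg_piK alg_quot_mulE mulr1. Qed.
Fact alg_quot_mulDl : left_distributive alg_quot_mul +%R.
Proof.
move=> u v w; rewrite -[u]alg_piK -[v]alg_piK -[w]alg_piK.
by rewrite -alg_piD !alg_quot_mulE -alg_piD mulrDl.
Qed.
Fact alg_quot_mulDr : right_distributive alg_quot_mul +%R.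
Proof.
move=> u v w; rewrite -[u]alg_piK -[v]alg_piK -[w]alg_piK.
by rewrite -alg_piD !alg_quot_mulE -alg_piD mulrDr.
Qed.
HB.instance Definition _ := GRing.Zmodule_isPzRing.Build alg_quot
  alg_quot_mulA alg_quot_mul1r alg_quot_mulr1 alg_quot_mulDl alg_quot_mulDr.

Fact alg_quot_scaleA a b u :
  alg_quot_scale a (alg_quot_scale b u) = alg_quot_scale (a * b) u.
Proof. by rewrite -[u]alg_piK !alg_quot_scaleE scalerA. Qed.
Fact alg_quot_scale1 : left_id 1 alg_quot_scale.
Proof. by move=> u; rewrite -[u]alg_piK alg_quot_scaleE scale1r. Qed.
Fact alg_quot_scaleDr : right_distributive alg_quot_scale +%R.
Proof.
move=> a u v; rewrite -[u]alg_piK -[v]alg_piK.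
by rewrite -alg_piD !alg_quot_scaleE -alg_piD scalerDr.
Qed.
Fact alg_quot_scaleDl u : {morph alg_quot_scale^~ u : a b / a + b}.
Proof.
by move=> a b; rewrite -[u]alg_piK !alg_quot_scaleE -alg_piD scalerDl.
Qed.
HB.instance Definition _ := GRing.Zmodule_isLmodule.Build K alg_quot
  alg_quot_scaleA alg_quot_scale1 alg_quot_scaleDr alg_quot_scaleDl.

Lemma alg_piM x y : alg_pi (x * y) = alg_pi x * alg_pi y.
Proof. exact/esym/alg_quot_mulE. Qed.

Lemma alg_pi1 : alg_pi 1 = 1.
Proof. by []. Qed.

Lemma alg_piZ a x : alg_pi (a *: x) = a *: alg_pi x.
Proof. exact/esym/alg_quot_scaleE. Qed.

Lemma alg_quotAl (a : K) (u v : alg_quot) : a *: (u * v) = (a *: u) * v.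
Proof.
by rewrite -[u]alg_piK -[v]alg_piK -alg_piM -!alg_piZ -alg_piM scalerAl.
Qed.

Lemma alg_quotAr (hA : forall (a : K) (x y : A), a *: (x * y) = x * (a *: y))
  (a : K) (u v : alg_quot) : a *: (u * v) = u * (a *: v).
Proof.
by rewrite -[u]alg_piK -[v]alg_piK -alg_piM -!alg_piZ -alg_piM hA.
Qed.

End AlgQuot.

(* The free algebra is the monoid algebra of the free monoid (words in G). *)
Definition free_alg (K : comNzRingType) (G : choiceType) : lalgType K :=
  {malg K[{fmonom G}]}.

Definition free_gen (K : comNzRingType) (G : choiceType) (g : G) :
  free_alg K G := << fmu g >>.

Lemma free_algAr (K : comNzRingType) (G : choiceType) (a : K)
  (x y : free_alg K G) : a *: (x * y) = x * (a *: y).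
Proof.
apply/malgP => w.
rewrite mcoeffZ mcoeffMl (mcoeffMlw w (fsubset_refl _) (msuppZ_le _ _)).
rewrite mulr_sumr; apply: eq_bigr => w1 _; rewrite mulr_sumr.
by apply: eq_bigr => w2 _; rewrite mcoeffZ mulrnAr mulrCA.
Qed.

Definition presented (K : comNzRingType) (G : choiceType)
    (rel : free_alg K G -> free_alg K G -> Prop) : Type :=
  alg_quot (fun z => exists x y, rel x y /\ z = x - y).

Section Presented.
Variables (K : comNzRingType) (G : choiceType).
Variable rel : free_alg K G -> free_alg K G -> Prop.
Local Notation P := (presented rel).

HB.instance Definition _ := GRing.PzRing.on P.
HB.instance Definition _ := GRing.Lmodule.on P.

Definition pgen (g : G) : P := alg_pi _ (free_gen K g).

Lemma presentedAl (a : K) (u v : P) : a *: (u * v) = (a *: u) * v.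
Proof. exact: alg_quotAl. Qed.

Lemma presentedAr (a : K) (u v : P) : a *: (u * v) = u * (a *: v).
Proof. apply: alg_quotAr; exact: free_algAr. Qed.

End Presented.

(* The index set I = Z/lZ is 'Z_l, which is Z/lZ only for 1 < l. *)

Inductive blob_gen (n l : nat) : Type :=
| Gpsi of 'I_n.-1
| Gy of 'I_n
| Ge of {ffun 'I_n -> 'Z_l}.

HB.instance Definition _ n l := gen_eqMixin (blob_gen n l).
HB.instance Definition _ n l := gen_choiceMixin (blob_gen n l).

(* Indices are 0-based: r : 'I_n.-1 stands for psi_(r+1), whose two positions
   are lo r and hi r (r and r+1 in 0-based numbering). *)
Definition lo n (r : 'I_n.-1) : 'I_n := widen_ord (leq_pred n) r.

Fact hi_subproof n (r : 'I_n.-1) : (r.+1 < n)%N.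
Proof. by rewrite -ltn_predRL. Qed.
Definition hi n (r : 'I_n.-1) : 'I_n := Ordinal (hi_subproof r).

Definition swap n l (r : 'I_n.-1) (i : {ffun 'I_n -> 'Z_l}) :
  {ffun 'I_n -> 'Z_l} := [ffun j => i (tperm (lo r) (hi r) j)].

Section BlobAlgebra.
Variables (K : comNzRingType) (n l : nat) (k : 'Z_l).
Local Notation In := {ffun 'I_n -> 'Z_l}.
Local Notation F := (free_alg K (blob_gen n l)).
Local Notation psi r := (free_gen K (Gpsi l r) : F).
Local Notation y s := (free_gen K (Gy l s) : F).
Local Notation e i := (free_gen K (Ge i) : F).

Inductive blob_rel : F -> F -> Prop :=
| blob_y1 (s : 'I_n) (i : In) : s = 0%N :> nat -> (i s == k) || (i s == - k) ->
    blob_rel (y s * e i) 0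
| blob_e1 (s : 'I_n) (i : In) : s = 0%N :> nat -> i s != k -> i s != - k ->
    blob_rel (e i) 0
| blob_e2 (s t : 'I_n) (i : In) : s = 0%N :> nat -> t = 1%N :> nat ->
    (i s == k) && (i t == k - 1) || (i s == - k) && (i t == - k - 1) ->
    blob_rel (e i) 0
| blob_ee (i j : In) : blob_rel (e i * e j) (if i == j then e i else 0)
| blob_sum_e : blob_rel (\sum_(i : In) e i) 1
| blob_ye s (i : In) : blob_rel (y s * e i) (e i * y s)
| blob_psie r (i : In) : blob_rel (psi r * e i) (e (swap r i) * psi r)
| blob_yy s t : blob_rel (y s * y t) (y t * y s)
| blob_psiy r s : s != lo r -> s != hi r ->
    blob_rel (psi r * y s) (y s * psi r)
| blob_psipsi (r s : 'I_n.-1) : (r.+1 < s)%N || (s.+1 < r)%N ->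
    blob_rel (psi r * psi s) (psi s * psi r)
| blob_psiyhi r (i : In) :
    blob_rel (psi r * y (hi r) * e i)
             ((y (lo r) * psi r + (i (lo r) == i (hi r))%:R) * e i)
| blob_yhipsi r (i : In) :
    blob_rel (y (hi r) * psi r * e i)
             ((psi r * y (lo r) + (i (lo r) == i (hi r))%:R) * e i)
| blob_psi2_eq r (i : In) : i (lo r) = i (hi r) -> blob_rel (psi r ^+ 2 * e i) 0
| blob_psi2_succ r (i : In) : i (hi r) = i (lo r) + 1 ->
    blob_rel (psi r ^+ 2 * e i) ((y (hi r) - y (lo r)) * e i)
| blob_psi2_pred r (i : In) : i (hi r) = i (lo r) - 1 ->
    blob_rel (psi r ^+ 2 * e i) ((y (lo r) - y (hi r)) * e i)
| blob_psi2_far r (i : In) :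
    i (hi r) \notin [:: i (lo r); i (lo r) + 1; i (lo r) - 1] ->
    blob_rel (psi r ^+ 2 * e i) (e i)
| blob_braid (r s : 'I_n.-1) (i : In) : s = r.+1 :> nat ->
    blob_rel (psi r * psi s * psi r * e i)
      ((psi s * psi r * psi s
        + (if (i (hi s) == i (lo r)) && (i (lo r) == i (hi r) - 1) then 1
           else if (i (hi s) == i (lo r)) && (i (lo r) == i (hi r) + 1) then -1
           else 0)) * e i).

(* The relations of b_n(q,m) depend on q only through its order l, and on m
   only through the element k of 'Z_l with 2k = m. *)
Definition blob : Type := presented blob_rel.
HB.instance Definition _ := GRing.PzRing.on blob.
HB.instance Definition _ := GRing.Lmodule.on blob.

(* 1-based: [blob_y r] is the generator y_r for 1 <= r <= n. *)
Definition blob_y (r : nat) : blob :=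
  oapp (fun s : 'I_n => pgen blob_rel (Gy l s)) 0 (insub r.-1).

Definition blob_e (i : {ffun 'I_n -> 'Z_l}) : blob := pgen blob_rel (Ge i).

End BlobAlgebra.

(* A one-line bipartition of n is a pair lam with lam.1 + lam.2 = n. The box
   (1,c,d) is encoded as (c, b) with c 1-based and b = true iff d = 2. *)
Definition Bip1 (n : nat) : {pred nat * nat} :=
  [pred lam | lam.1 + lam.2 == n]%N.

Definition boxes (lam : nat * nat) : seq (nat * bool) :=
  [seq (c, false) | c <- iota 1 lam.1] ++ [seq (c, true) | c <- iota 1 lam.2].

Definition standard (lam : nat * nat) (t : nat * bool -> nat) : Prop :=
  perm_eq [seq t b | b <- boxes lam] (iota 1 (lam.1 + lam.2)) /\
  forall c c' d, (c, d) \in boxes lam -> (c', d) \in boxes lam ->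
    (c < c')%N -> (t (c, d) < t (c', d))%N.

Definition box_mu (lam : nat * nat) : nat := minn lam.1 lam.2.

Definition tlam (lam : nat * nat) (b : nat * bool) : nat :=
  if (b.1 <= box_mu lam)%N then (if b.2 then b.1.*2.-1 else b.1.*2)
  else (box_mu lam + b.1)%N.

(* The entries larger than 2 mu then necessarily fill the remaining boxes. *)
Definition is_tlam (lam : nat * nat) (t : nat * bool -> nat) : Prop :=
  [/\ standard lam t,
      forall b, b \in boxes lam -> odd (t b) -> (t b < (box_mu lam).*2)%N ->
        b.2 = true
    & forall b, b \in boxes lam -> ~~ odd (t b) ->
        (t b <= (box_mu lam).*2)%N -> b.2 = false].

Lemma mem_boxes lam c d :
  ((c, d) \in boxes lam) = (1 <= c <= if d then lam.2 else lam.1)%N.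
Proof.
rewrite mem_cat; apply/idP/idP => [/orP[]/mapP[x]|].
- by rewrite mem_iota => h [-> ->]; lia.
- by rewrite mem_iota => h [-> ->]; lia.
case: d => h; apply/orP; [right | left]; apply/mapP; exists c => //;
  by rewrite mem_iota; lia.
Qed.

Lemma size_boxes lam : size (boxes lam) = (lam.1 + lam.2)%N.
Proof. by rewrite size_cat !size_map !size_iota. Qed.

Lemma uniq_boxes lam : uniq (boxes lam).
Proof.
rewrite cat_uniq !map_inj_uniq ?iota_uniq ?andbT /=; try by move=> x y [].
by apply/hasPn => b /mapP[x _ ->]; apply/mapP => -[y _ []].
Qed.

Lemma tlam_standard lam : standard lam (tlam lam).
Proof.
have inj : {in boxes lam &, injective (tlam lam)}.
  move=> [c d] [c' d']; rewrite !mem_boxes /tlam /box_mu /=.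
  case: d; case: d'; do 2!case: ifP => ?; move=> *;
    solve [by congr (_, _); lia | lia].
split; last first.
  move=> c c' d; rewrite !mem_boxes /tlam /box_mu /=.
  by case: d; do 2!case: ifP; lia.
have uq : uniq [seq tlam lam b | b <- boxes lam].
  by rewrite map_inj_in_uniq ?uniq_boxes.
apply: (uniq_perm uq (iota_uniq _ _)).
apply: (uniq_min_size uq _ _).2 => [j /mapP[[c d]]|].
  rewrite mem_boxes mem_iota /tlam /box_mu /=.
  by case: d; case: ifP; lia.
by rewrite size_iota size_map size_boxes.
Qed.

Lemma tlamP lam : is_tlam lam (tlam lam).
Proof.
split; first exact: tlam_standard.
  by move=> [c [|]] //; rewrite mem_boxes /tlam /box_mu /=; case: ifP; lia.
by move=> [c [|]] //; rewrite mem_boxes /tlam /box_mu /=; case: ifP; lia.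
Qed.

Lemma tlam_unique lam t : is_tlam lam t -> {in boxes lam, t =1 tlam lam}.
Proof.
case: (tlamP lam) => -[pm1 inc1] odd1 even1 [[pm2 inc2] odd2 even2].
have surj u j : perm_eq [seq u b | b <- boxes lam] (iota 1 (lam.1 + lam.2)) ->
    (1 <= j <= lam.1 + lam.2)%N -> exists2 b, b \in boxes lam & j = u b.
  by move=> /perm_mem/(_ j) h hj; apply/mapP; rewrite h mem_iota; lia.
have rng u b : perm_eq [seq u b | b <- boxes lam] (iota 1 (lam.1 + lam.2)) ->
    b \in boxes lam -> (1 <= u b <= lam.1 + lam.2)%N.
  move=> /perm_mem/(_ (u b)) h hb; move: h.
  by rewrite map_f // mem_iota; lia.
have inj1 : {in boxes lam &, injective (tlam lam)}.
  move=> [c d] [c' d']; rewrite !mem_boxes /tlam /box_mu /=.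
  case: d; case: d'; do 2!case: ifP => ?; move=> *;
    solve [by congr (_, _); lia | lia].
suff main j b : b \in boxes lam -> t b = j -> tlam lam b = j.
  by move=> b hb; rewrite (main (t b) b).
elim/ltn_ind: j b => j IH [c d] hb tb.
have jr : (1 <= j <= lam.1 + lam.2)%N by rewrite -tb rng.
have [[c' d'] hb' tb'] := surj _ _ pm1 jr.
have IH' b : b \in boxes lam -> (tlam lam b < j)%N -> t b = tlam lam b.
  move=> hb1 lt1.
  have [b2 hb2 e2] := surj _ _ pm2 (rng _ _ pm1 hb1).
  have := IH _ lt1 b2 hb2 (esym e2) => /(inj1 _ _ hb2 hb1) <-.
  by rewrite (IH (t b2)) // -e2.
case: (d =P d') => [ed | nd].
  subst d'; case: (ltngtP c c') => cc; last by rewrite cc tb'.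
    have lt := inc1 _ _ _ hb hb' cc; rewrite -tb' in lt.
    by move: (lt); rewrite -(IH' _ hb lt) tb ltnn.
  have lt := inc2 _ _ _ hb' hb cc; rewrite tb in lt.
  by move: (lt); rewrite -(IH _ lt _ hb' erefl) -tb' ltnn.
exfalso.
have [le|gt] := leqP j (box_mu lam).*2.
  have [oj|ej] := boolP (odd j).
    have ltj : (j < (box_mu lam).*2)%N by lia.
    move: (odd1 _ hb') (odd2 _ hb); rewrite -tb' tb /=.
    by move=> /(_ oj ltj) h1 /(_ oj ltj) h2; apply: nd; rewrite h1 h2.
  move: (even1 _ hb') (even2 _ hb); rewrite -tb' tb /=.
  by move=> /(_ ej le) h1 /(_ ej le) h2; apply: nd; rewrite h1 h2.
have cgt : (box_mu lam < c)%N.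
  rewrite ltnNge; apply/negP => cle.
  have lt : (tlam lam (c, d) < j)%N.
    by move: hb; rewrite mem_boxes /tlam /= cle; case: (d); lia.
  by move: (lt); rewrite -(IH' _ hb lt) tb ltnn.
have cgt' : (box_mu lam < c')%N.
  rewrite ltnNge; apply/negP => cle.
  by move: hb' tb'; rewrite mem_boxes /tlam /= cle; case: (d'); lia.
move: hb hb' cgt cgt' nd; rewrite !mem_boxes /box_mu.
by case: (d); case: (d') => //; lia.
Qed.

Definition residue (l : nat) (k : 'Z_l) (b : nat * bool) : 'Z_l :=
  (if b.2 then - k else k) + b.1.-1%:R.

(* The box of t containing j, for 1 <= j <= lam.1 + lam.2. *)
Definition box_of (lam : nat * nat) (t : nat * bool -> nat) (j : nat) :
  nat * bool := nth (1%N, false) (boxes lam) (index j [seq t b | b <- boxes lam]).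

Definition ilam (n l : nat) (k : 'Z_l) (lam : nat * nat) :
  {ffun 'I_n -> 'Z_l} := [ffun j : 'I_n => residue k (box_of lam (tlam lam) j.+1)].

(* When lam.1 = lam.2 both cases give a value larger than lam.1 + lam.2. *)
Definition a_lam (l m : nat) (lam : nat * nat) : nat :=
  if (lam.1 <= lam.2)%N then ((box_mu lam).*2 + m)%N
  else ((box_mu lam).*2 + (l - m))%N.

Definition q_lam (n l m : nat) (lam : nat * nat) : nat :=
  ((n - a_lam l m lam) %/ l)%N.

Section DotLine.
Variables (K : comNzRingType) (N : nat).
Local Notation F := (free_alg K 'I_N).
Local Notation X i := (free_gen K i : F).

Inductive DL_rel : F -> F -> Prop :=
| DL_comm (i j : 'I_N) : DL_rel (X i * X j) (X j * X i)
| DL_sq (i : 'I_N) : (0 < i)%N ->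
    DL_rel (X i ^+ 2) (- 2%:R * X i * \sum_(j < N | (j < i)%N) X j)
| DL_sq1 (i : 'I_N) : i = 0%N :> nat -> DL_rel (X i ^+ 2) 0.

Definition DL : Type := presented DL_rel.
HB.instance Definition _ := GRing.PzRing.on DL.
HB.instance Definition _ := GRing.Lmodule.on DL.

Definition DL_X (i : 'I_N) : DL := pgen DL_rel i.

End DotLine.

Section IdempotentTruncation.
Variables (K : comNzRingType) (n l m : nat) (k : 'Z_l) (lam : nat * nat).
Local Notation B := (blob K n k).
Local Notation e := (blob_e K k (ilam n k lam) : B).

(* Y_n(lambda); its identity is e, not 1. *)
Inductive Ysub : set B :=
| Ysub_e : Ysub e
| Ysub_y r : (1 <= r <= n)%N -> Ysub (blob_y K n k r * e)
| Ysub_lin (a : K) u v : Ysub u -> Ysub v -> Ysub (a *: u + v)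
| Ysub_mul u v : Ysub u -> Ysub v -> Ysub (u * v).

(* Y_(j+1) in 1-based numbering. *)
Definition Yel (j : nat) : B :=
  let r := (a_lam l m lam + j * l)%N in
  (blob_y K n k r.+1 - blob_y K n k r) * e.

(* Ordered product in Y_n(lambda): the empty product is its identity e. *)
Definition Ymon (N : nat) (alpha : {ffun 'I_N -> bool}) : B :=
  \big[*%R/e]_(j < N | alpha j) Yel j.

(* Unital algebra homomorphisms DL_N -> Y_n(lambda), as maps into B. *)
Definition is_Yhom (N : nat) (Phi : DL K N -> B) : Prop :=
  [/\ linear Phi, forall u v, Phi (u * v) = Phi u * Phi v, Phi 1 = e
    & forall u, Ysub (Phi u)].

End IdempotentTruncation.

Definition is_basis (K : comNzRingType) (V : lmodType K) (U : set V)
    (I : finType) (b : I -> V) : Prop :=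
  (forall c : I -> K, \sum_i c i *: b i = 0 -> forall i, c i = 0) /\
  (forall v, U v <-> exists c : I -> K, v = \sum_i c i *: b i).

Definition has_dim (K : comNzRingType) (V : lmodType K) (U : set V)
    (d : nat) : Prop := exists b : 'I_d -> V, is_basis U b.

Arguments blob K n {l} k.
Arguments Ysub K n {l} k lam _.
Arguments Yel K n {l} m k lam j.
Arguments Ymon K n {l} m k lam {N} alpha.
Arguments is_Yhom K n {l} k lam {N} Phi.
Arguments DL_X K {N} i.

(* Main.v *)
(* A sequence i with e(i) <> 0 is a walk whose state is the unordered pair of
   residues of the two addable boxes of a one-line bipartition. Induction along
   the walk shows that e(i) = 0 off such walks, that y_r^2 e(i) = 0, and that
   y_{r+1} e(i) = (+/-) y_r e(i) away from the walls, where the two residues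
   agree. For i = i^lambda the walls sit at lengths a_lambda + j l, so the
   y_r e are all 0 or one of Z_j = Y_1 + ... + Y_j, the relation Z_j^2 = 0 is
   the dot-line relation for Y_j, and squarefree monomials span.

   An ideal of the dot-line algebra that misses X_1 ... X_N is zero, so
   independence reduces to Y_1 ... Y_N = Z_1 ... Z_N <> 0. The blob generators
   act on functions on words in two letters, valued in K(x), with y_r
   multiplying by the weight 0 or x of the r-th letter and psi_r acting as a
   transposition or a divided difference. This deforms the blob algebra: on the
   lattice of functions that are polynomial over K[x] in the letter weights on
   each residue class, the relations hold modulo x. If Z_1 ... Z_N e were 0 it
   would therefore send the constant 1 into x times the lattice. But the
   alternating sum of its image over the 2^N reflections of the word of lambda
   in the walls is x^N up to sign, whereas that of x times a lattice function is
   divisible by x^(N+1). *)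

Require Import Defs.
From HB Require Import structures.
From mathcomp Require Import all_boot all_order all_algebra.
From mathcomp Require Import perm zify ring.
From mathcomp Require Import generic_quotient ring_quotient.
From mathcomp Require Import boolp classical_sets functions reals.
From mathcomp Require Import complex.
From mathcomp Require Import finmap.
From mathcomp.multinomials Require Import monalg.

Import GRing.Theory.
Local Open Scope ring_scope.

Set Implicit Arguments.
Unset Strict Implicit.
Unset Printing Implicit Defensive.

(** * Actions of the free algebra *)

(** The deformation is needed because at [x = 0] every [y_r] acts on words by zero; for nonzero [x]
    a product of [y_r] is detected by its order of vanishing in [x]. Of the relations only
    [y_1 e(i) = 0] fails on words. The operators therefore do not define a module over the blob
    algebra, and the computation takes place in the free algebra, where elements of the ideal of
    relations send the lattice into [x] times itself. Divided differences divide by [x] or [-x], so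
    functions with values in K[x] are not preserved; polynomials in the letter weights are, one for
    each residue sequence since the residues decide how [psi_r] acts. Such a polynomial has an
    alternating sum divisible by x^N because each alternation kills what does not involve its block,
    while each weight taken from that block carries a factor [x]. The restriction on [m] enters
    through the start of the walk: [k] and [-k] differ by [2k = m], so the walk begins neither on a
    wall nor next to one. It also forces [l > 3], hence 2 and 3 are nonzero modulo [l] and short
    patterns of neighbouring residues have no accidental coincidences. *)

Section FreeAlgebra.
Variables (K : comNzRingType) (G : choiceType).

Lemma malgUZ (a : K) (w : {fmonom G}) :
  << a *g w >> = a *: << w >> :> free_alg K G.
Proof. by apply/malgP=> v; rewrite mcoeffZ !mcoeffU mulrnAr mulr1. Qed.

Lemma fmonom_cons g (w : seq G) :
  << FMonom (g :: w) >> = free_gen K g * << FMonom w >> :> free_alg K G.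
Proof. by rewrite malgM_def fgmulUU mulr1 fmuE /= /mmul /= fmmulE. Qed.

Lemma free_alg_ind (P : free_alg K G -> Prop) :
  P 1 -> (forall g, P (free_gen K g)) ->
  (forall a x y, P x -> P y -> P (a *: x + y)) ->
  (forall x y, P x -> P y -> P (x * y)) -> forall z, P z.
Proof.
move=> P1 Pg Plin PM z.
have P0 : P 0 by rewrite -(addNr (1 : free_alg K G)) -scaleN1r; apply: Plin.
rewrite (monalgE z).
elim: (enum_fset _) => [|w s IH]; rewrite ?big_nil // big_cons.
rewrite malgUZ; apply: Plin IH; case: w => w.
elim: w => [|g w IHw]; first by rewrite -fmoneE.
rewrite fmonom_cons; exact: PM (Pg g) IHw.
Qed.

Variables (S : comNzRingType) (iota : {rmorphism K -> S}) (V : lmodType S).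
Variable op : G -> V -> V.
Hypothesis op_linear : forall g, linear (op g).

(** Scalars pass through [iota] because words carry functions with values in a field extending [K],
    whereas the dot-line algebra later acts over [K] itself, with [iota] the identity. *)
Definition act (z : free_alg K G) (v : V) : V :=
  \sum_(w <- msupp z) iota z@_w *: foldr op v (w : seq G).

Lemma act_wide (D : {fset {fmonom G}}) z v : (msupp z `<=` D)%fset ->
  act z v = \sum_(w <- D) iota z@_w *: foldr op v (w : seq G).
Proof.
move=> le; rewrite [LHS](big_fset_incl _ le) => //= x xd /mcoeff_outdom ->.
by rewrite rmorph0 scale0r.
Qed.

Lemma actP a z1 z2 v : act (a *: z1 + z2) v = iota a *: act z1 v + act z2 v.
Proof.
set D := (msupp (a *: z1 + z2) `|` (msupp z1 `|` msupp z2))%fset.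
have s0 : (msupp (a *: z1 + z2) `<=` D)%fset by exact: fsubsetUl.
have s1 : (msupp z1 `<=` D)%fset by rewrite /D fsubsetU // fsubsetUl orbT.
have s2 : (msupp z2 `<=` D)%fset by rewrite /D fsubsetU // fsubsetUr orbT.
rewrite (act_wide _ s0) (act_wide _ s1) (act_wide _ s2) scaler_sumr -big_split.
apply: eq_bigr => w _ /=.
by rewrite mcoeffD mcoeffZ rmorphD rmorphM scalerDl scalerA.
Qed.

Lemma act0 v : act 0 v = 0.
Proof. by rewrite /act msupp0 big_seq_fset0. Qed.

Lemma actD z1 z2 v : act (z1 + z2) v = act z1 v + act z2 v.
Proof. by have := actP 1 z1 z2 v; rewrite rmorph1 !scale1r. Qed.

Lemma actB z1 z2 v : act (z1 - z2) v = act z1 v - act z2 v.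
Proof. by have := actP (-1) z2 z1 v; rewrite rmorphN1 !scaleN1r ![- _ + _]addrC. Qed.

Lemma actU w v : act << w >> v = foldr op v (w : seq G).
Proof.
by rewrite (act_wide _ msuppU_le) big_seq_fset1 mcoeffUU rmorph1 scale1r.
Qed.

Lemma act1 v : act 1 v = v.
Proof. by rewrite actU fm1. Qed.

Lemma act_gen g v : act (free_gen K g) v = op g v.
Proof. by rewrite actU fmuE. Qed.

Lemma foldr_op_linear w : linear (foldr op ^~ w).
Proof. by elim: w => //= g w IH a u v; rewrite IH op_linear. Qed.

Lemma act_linear z : linear (act z).
Proof.
move=> a u v; rewrite /act scaler_sumr -big_split; apply: eq_bigr => w _ /=.
by rewrite foldr_op_linear scalerDr !scalerA mulrC.
Qed.

Lemma op0 g : op g 0 = 0.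
Proof.
have := op_linear g 1 0 0; rewrite !scale1r addr0 => h.
by apply: (addIr (op g 0)); rewrite add0r -h.
Qed.

Lemma actM z1 z2 v : act (z1 * z2) v = act z1 (act z2 v).
Proof.
move: z1 z2 v; apply: free_alg_ind =>
  [z2 v|g z2 v|a x y IHx IHy z2 v|x y IHx IHy z2 v].
- by rewrite mul1r act1.
- rewrite act_gen; move: z2.
  have hU w : act (free_gen K g * << w >>) v = op g (act << w >> v).
    by case: w => w; rewrite -fmonom_cons !actU.
  have hadd : forall s (c : _ -> K),
      act (free_gen K g * (\sum_(w <- s) c w *: << w >>)) v =
      op g (act (\sum_(w <- s) c w *: << w >>) v).
    elim=> [|w s IH] c; first by rewrite big_nil mulr0 act0 op0.
    rewrite big_cons mulrDr -[free_gen K g * (_ *: _)]free_algAr.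
    apply: etrans (actP _ _ _ _) _; apply: etrans (congr1 _ (IH c)) _.
    apply: etrans (congr1 (fun u => iota (c w) *: u + _) (hU w)) _.
    apply: etrans _ (congr1 (op g) (esym (actP _ _ _ _))).
    exact/esym/op_linear.
  move=> z2; rewrite (monalgE z2).
  have -> : \sum_(w <- msupp z2) << z2@_w *g w >>
     = \sum_(w <- msupp z2) z2@_w *: (<< w >> : free_alg K G).
    by apply: eq_bigr => w _; rewrite malgUZ.
  exact: hadd.
- have -> : (a *: x + y) * z2 = a *: (x * z2) + y * z2.
    by rewrite mulrDl scalerAl.
  apply: etrans (actP _ _ _ _) _; apply: etrans _ (esym (actP _ _ _ _)).
  exact: (congr2 (fun u w => iota a *: u + w) (IHx z2 v) (IHy z2 v)).
- rewrite -mulrA; apply: etrans (IHx _ _) _; apply: etrans _ (esym (IHx _ _)).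
  exact: (congr1 (act x) (IHy z2 v)).
Qed.

End FreeAlgebra.

(** * Folded walks *)

Section FoldedWalk.
Variables (I : comNzRingType) (k : I).
Hypotheses (two_neq0 : 2%:R != 0 :> I) (three_neq0 : 3%:R != 0 :> I).
Hypotheses (kk_neq1 : k + k != 1) (kk_neqN1 : k + k != -1).

Lemma succ_neq (a : I) : (a + 1 == a) = false.
Proof. by rewrite -subr_eq0 addrAC subrr add0r oner_eq0. Qed.

Lemma succ2_neq (a : I) : (a + 1 + 1 == a) = false.
Proof.
rewrite -subr_eq0 (_ : _ - a = 2%:R); last by ring.
exact/negbTE.
Qed.

Lemma succ3_neq (a : I) : (a + 1 + 1 + 1 == a) = false.
Proof.
rewrite -subr_eq0 (_ : _ - a = 3%:R); last by ring.
exact/negbTE.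
Qed.

(** For far residues [psi_r^2 e(i) = e(i)], so [psi_r] identifies [e(i)] with [e(s_r i)] and the two
    letters may be exchanged freely. *)
Definition far (a b : I) := [&& a != b, b != a + 1 & a != b + 1].

Lemma farC a b : far a b = far b a.
Proof. by rewrite /far eq_sym; congr (_ && _); rewrite andbC. Qed.

Lemma not_far a b : ~~ far a b -> [\/ a = b, b = a + 1 | a = b + 1].
Proof.
rewrite /far; case: eqP => [->|_]; first by constructor 1.
case: eqP => [->|_]; first by constructor 2.
by case: eqP => [->|_] //; constructor 3.
Qed.

Lemma far_succ2 a : far (a + 1 + 1) a.
Proof.
by rewrite /far succ2_neq eq_sym succ3_neq (inj_eq (addIr 1)) succ_neq.
Qed.

(* A residue sequence is read as a walk whose state is the unordered pair of
   residues of the two addable boxes; identifying the two boxes folds the walk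
   along the walls, where both addable boxes have the same residue. *)
Inductive good : seq I -> I -> I -> Prop :=
| good_nil : good [::] k (- k)
| good_step s a b : good s a b -> good (rcons s a) (a + 1) b
| good_swap s a b : good s a b -> good s b a.

Lemma good_nil_inv a b : good [::] a b -> a = k /\ b = - k \/ a = - k /\ b = k.
Proof.
move eqt : [::] => t h; elim: h eqt => {t a b}.
- by left.
- by case.
- by move=> s a b _ IH /IH[] [-> ->]; [right | left].
Qed.

(** The starting residues differ by [2k], which is neither 1 nor -1. Hence a walk in a state
    [{a, a + 1}] has a last letter, which the case analyses below inspect. *)
Lemma good_nil_succ a : ~ good [::] a (a + 1).
Proof.
move=> /good_nil_inv[[-> /eqP]|[-> /eqP]].
  rewrite -subr_eq0 opprK addrAC => /eqP h.
  by move: kk_neqN1; rewrite -addr_eq0 h eqxx.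
rewrite addrC subr_eq => /eqP h.
by move: kk_neq1; rewrite -h eqxx.
Qed.

Lemma good_rcons_inv s z a b : good (rcons s z) a b ->
  exists2 c, good s z c & a = z + 1 /\ b = c \/ a = c /\ b = z + 1.
Proof.
move eqt : (rcons s z) => t h; elim: h s z eqt => {t a b}.
- by move=> s z /(congr1 size); rewrite size_rcons.
- by move=> t a b hg _ s z /rcons_inj[-> ->]; exists b => //; left.
- by move=> t a b _ IH s z /IH[c hc []] [-> ->]; exists c => //; [right | left].
Qed.

(** The component just extended by [v] has next residue [v + 1], so off the walls exactly one
    continuation has it. The two continuations thus carry opposite signs in [follows]. *)
Lemma good_sign s v a b : good (rcons s v) a b -> a != b ->
  (b == v + 1) = ~~ (a == v + 1).
Proof.
move=> /good_rcons_inv[c _ [] [-> ->]]; rewrite eqxx /= => h.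
  by rewrite eq_sym; exact/negbTE.
by rewrite h.
Qed.

Variables (B : pzRingType) (y psi : nat -> B) (E : seq I -> B).

Hypothesis yC : forall i j, y i * y j = y j * y i.
Hypothesis yE : forall j s, y j * E s = E s * y j.
Hypothesis psiE : forall s a b u,
  psi (size s) * E (s ++ a :: b :: u) = E (s ++ b :: a :: u) * psi (size s).
Hypothesis psiy : forall r j, j != r -> j != r.+1 -> psi r * y j = y j * psi r.
Hypothesis psiyS : forall s a b u,
  psi (size s) * y (size s).+1 * E (s ++ a :: b :: u) =
  (y (size s) * psi (size s) + (a == b)%:R) * E (s ++ a :: b :: u).
Hypothesis ySpsi : forall s a b u,
  y (size s).+1 * psi (size s) * E (s ++ a :: b :: u) =
  (psi (size s) * y (size s) + (a == b)%:R) * E (s ++ a :: b :: u).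
Hypothesis psi2_eq : forall s a u, psi (size s) ^+ 2 * E (s ++ a :: a :: u) = 0.
Hypothesis psi2_up : forall s a u,
  psi (size s) ^+ 2 * E (s ++ a :: (a + 1) :: u) =
  (y (size s).+1 - y (size s)) * E (s ++ a :: (a + 1) :: u).
Hypothesis psi2_down : forall s a u,
  psi (size s) ^+ 2 * E (s ++ (a + 1) :: a :: u) =
  (y (size s) - y (size s).+1) * E (s ++ (a + 1) :: a :: u).
Hypothesis psi2_far : forall s a b u, far a b ->
  psi (size s) ^+ 2 * E (s ++ a :: b :: u) = E (s ++ a :: b :: u).
Hypothesis braid : forall s a u,
  psi (size s) * psi (size s).+1 * psi (size s) * E (s ++ [:: a, a + 1, a & u]) =
  (psi (size s).+1 * psi (size s) * psi (size s).+1 + 1)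
    * E (s ++ [:: a, a + 1, a & u]).
Hypothesis y0E : forall a u, y 0 * E (a :: u) = 0.
Hypothesis E_first : forall a u, a != k -> a != - k -> E (a :: u) = 0.
Hypothesis E_second : forall a u, a = k \/ a = - k ->
  E (a :: (a - 1) :: u) = 0.

Lemma psiE1 s c a b u : psi (size s).+1 * E (s ++ [:: c, a, b & u]) =
  E (s ++ [:: c, b, a & u]) * psi (size s).+1.
Proof. by have := psiE (rcons s c) a b u; rewrite !cat_rcons size_rcons. Qed.

Lemma conj_far s a b u : far a b -> E (s ++ a :: b :: u) =
  psi (size s) * E (s ++ b :: a :: u) * psi (size s).
Proof. by move=> h; rewrite -[LHS]psi2_far // expr2 -mulrA psiE mulrA. Qed.

Lemma E_far s a b u : far a b -> E (s ++ b :: a :: u) = 0 ->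
  E (s ++ a :: b :: u) = 0.
Proof. by move=> /conj_far-> ->; rewrite mulr0 mul0r. Qed.

Lemma y_far s a b u : far a b -> y (size s).+1 * E (s ++ a :: b :: u) =
  psi (size s) * (y (size s) * E (s ++ b :: a :: u)) * psi (size s).
Proof.
move=> h; rewrite (conj_far _ _ h) 2!mulrA ySpsi.
by rewrite eq_sym; case/and3P: h => /negbTE-> _ _; rewrite addr0 !mulrA.
Qed.

(** [psi_r^2] produces the difference of the two [y], and it factors through the vanishing
    idempotent of the exchanged sequence. *)
Lemma y_up s a u : E (s ++ (a + 1) :: a :: u) = 0 ->
  y (size s).+1 * E (s ++ a :: (a + 1) :: u) =
  y (size s) * E (s ++ a :: (a + 1) :: u).
Proof.
move=> h; apply/eqP; rewrite -subr_eq0 -mulrBl -psi2_up expr2 -mulrA psiE h.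
by rewrite mul0r mulr0.
Qed.

(** Multiplying the hypothesis by [psi_r] gives [psi_r e = 0], because [psi_r^2 e = 0]; the
    hypothesis then reads [e = psi_r e (y_{r+1} - y_r) = 0]. *)
Lemma psi_diff_eq0 s a u :
  psi (size s) * (y (size s).+1 - y (size s)) * E (s ++ a :: a :: u) =
    E (s ++ a :: a :: u) ->
  E (s ++ a :: a :: u) = 0.
Proof.
set r := size s; set e := E _ => h.
have yDe : (y r.+1 - y r) * e = e * (y r.+1 - y r) by rewrite mulrBl mulrBr !yE.
have pe : psi r * e = 0.
  by rewrite -h !mulrA -expr2 -mulrA yDe mulrA psi2_eq mul0r.
by rewrite -h -mulrA yDe mulrA pe mul0r.
Qed.

(** On a repeated residue [y_r] cannot act like an element commuting with [psi_r]: the term 1 in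
    [psi_r y_{r+1} e = (y_r psi_r + 1) e] would have nothing to cancel it, which is the situation of
    [psi_diff_eq0]. *)
Lemma E_eq_lo s a u w : psi (size s) * w = w * psi (size s) ->
  y (size s) * E (s ++ a :: a :: u) = w * E (s ++ a :: a :: u) ->
  E (s ++ a :: a :: u) = 0.
Proof.
set r := size s; set e := E _ => wC we; apply: psi_diff_eq0.
rewrite -/r -/e mulrBr mulrBl psiyS eqxx mulrDl mul1r -/r -/e.
rewrite -(mulrA (y r)) psiE -/r -/e [y r * _]mulrA we -mulrA -psiE -/r -/e.
by rewrite mulrA -wC -mulrA -we mulrA addrAC subrr add0r.
Qed.

Lemma E_eq_hi s a u w : psi (size s) * w = w * psi (size s) ->
  y (size s).+1 * E (s ++ a :: a :: u) = w * E (s ++ a :: a :: u) ->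
  E (s ++ a :: a :: u) = 0.
Proof.
set r := size s; set e := E _ => wC we; apply: psi_diff_eq0.
rewrite -/r -/e mulrBr mulrBl -mulrA we mulrA wC -mulrA psiE -/r -/e.
rewrite mulrA -we -mulrA -psiE mulrA ySpsi eqxx -/r -/e mulrDl mul1r.
by rewrite addrAC subrr add0r.
Qed.

(** Sliding [psi_r] past [y_{r+1}^2] gives [(y_r + y_{r+1}) e = psi_r y_{r+1}^2 e], since
    [y_r^2 e = 0]. So [psi_r] kills this sum, and sliding [y_{r+1}] past that [psi_r] leaves the sum
    itself. *)
Lemma y_eq s a u : y (size s) ^+ 2 * E (s ++ a :: a :: u) = 0 ->
  y (size s).+1 * E (s ++ a :: a :: u) = - y (size s) * E (s ++ a :: a :: u).
Proof.
set r := size s; set e := E _ => y2.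
have pe : psi r * e = e * psi r by exact: psiE.
have pyS : psi r * y r.+1 * e = y r * psi r * e + e.
  by rewrite psiyS eqxx mulrDl mul1r.
have ySp : y r.+1 * psi r * e = psi r * y r * e + e.
  by rewrite ySpsi eqxx mulrDl mul1r.
have ye j : y j * e = e * y j by exact: yE.
have sE : (y r + y r.+1) * e = psi r * y r.+1 ^+ 2 * e.
  rewrite expr2 mulrA -[RHS]mulrA ye mulrA pyS [RHS]mulrDl -ye.
  rewrite -[_ * e * _]mulrA -ye -!mulrA (mulrA (psi r)) pyS mulrDr !mulrA -expr2.
  by rewrite -mulrA pe mulrA y2 mul0r add0r mulrDl.
have sC : (y r + y r.+1) * e = e * (y r + y r.+1) by rewrite mulrDl mulrDr !ye.
have psE : psi r * ((y r + y r.+1) * e) = 0.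
  by rewrite sE expr2 -!mulrA ye (mulrA _ e) ye !mulrA -expr2 psi2_eq !mul0r.
have : y r.+1 * (psi r * ((y r + y r.+1) * e)) = 0 by rewrite psE mulr0.
rewrite sC !mulrA ySp mulrDl -sC -(mulrA (psi r)) ye -!mulrA.
have -> : y r * (y r + y r.+1) = (y r + y r.+1) * y r.
  by rewrite mulrDl mulrDr (yC r r.+1).
rewrite (mulrA e) -sC [psi r * _]mulrA psE mul0r add0r mulrDl => /eqP.
by rewrite addrC addr_eq0 mulNr => /eqP.
Qed.

Lemma E_braid s a u : E (s ++ [:: a + 1, a, a & u]) = 0 ->
  E (s ++ [:: a, a, a + 1 & u]) = 0 -> E (s ++ [:: a, a + 1, a & u]) = 0.
Proof.
move=> h1 h2; have := braid s a u.
rewrite mulrDl mul1r -!mulrA psiE psiE1 h1 h2 !mul0r !mulr0 add0r.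
by move=> ->.
Qed.

(** One cubic term of the braid relation vanishes, so the relation reads
    [e = - psi_{r+1} psi_r e' psi_{r+1}] with [e'] the idempotent of [(a, a, a + 1)]. Through this
    expression [y_{r+2}] becomes [y_{r+1}] on [e'], which [y_eq] turns into [- y_r]. *)
Lemma y_braid s a u : E (s ++ [:: a + 1, a, a & u]) = 0 ->
  y (size s) ^+ 2 * E (s ++ [:: a, a, a + 1 & u]) = 0 ->
  y (size s).+2 * E (s ++ [:: a, a + 1, a & u]) =
    - y (size s) * E (s ++ [:: a, a + 1, a & u]).
Proof.
move=> h1 h2; set r := size s; set e := E _.
set e' := E (s ++ [:: a, a, a + 1 & u]).
have pe : psi r.+1 * e = e' * psi r.+1 by exact: psiE1.
have pe' : psi r * e' = e' * psi r by exact: psiE.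
have ee : e = - (psi r.+1 * psi r * e' * psi r.+1).
  have := braid s a u; rewrite mulrDl mul1r -!mulrA psiE h1 !(mul0r, mulr0).
  rewrite psiE1 -/r -/e -/e' => /eqP.
  by rewrite eq_sym addrC addr_eq0 => /eqP ->; rewrite !mulrA.
have yS : y r.+2 * psi r.+1 * e' = psi r.+1 * y r.+1 * e'.
  have := ySpsi (rcons s a) a (a + 1) u.
  by rewrite !size_rcons !cat_rcons eq_sym succ_neq addr0.
have yl : y r.+1 * e' = - y r * e' by exact: y_eq.
have pyr : psi r.+1 * y r = y r * psi r.+1.
  by apply: psiy; rewrite neq_ltn ?ltnS ?leqnn ?leqnSn.
rewrite {1}ee mulrN -(mulrA (psi _)) pe' !mulrA yS.
rewrite -(mulrA (psi _)) yl mulNr mulrN !mulNr opprK.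
rewrite [psi r.+1 * _]mulrA pyr -(mulrA _ e') -pe' !mulrA.
rewrite [in RHS]ee mulrN opprK !mulrA.
by [].
Qed.

(** The element [d = (y_{r+1} - y_r) e] equals [psi_r e' psi_r]. On it [y_{r+1}] acts as [-w], that
    is as [- y_r], so [(y_{r+1} + y_r) d = 0], which says [y_{r+1}^2 e = y_r^2 e]. *)
Lemma y_sqr_up s a u w : psi (size s) * w = w * psi (size s) ->
  y (size s) * E (s ++ a :: (a + 1) :: u) = w * E (s ++ a :: (a + 1) :: u) ->
  y (size s) * E (s ++ (a + 1) :: a :: u) = - w * E (s ++ (a + 1) :: a :: u) ->
  y (size s) ^+ 2 * E (s ++ a :: (a + 1) :: u) = 0 ->
  y (size s).+1 ^+ 2 * E (s ++ a :: (a + 1) :: u) = 0.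
Proof.
set r := size s; set e := E _; set e' := E _ => wC we we' y2.
have d : (y r.+1 - y r) * e = psi r * e' * psi r.
  by rewrite -psi2_up expr2 -mulrA psiE mulrA.
have yd : y r.+1 * ((y r.+1 - y r) * e) = - y r * ((y r.+1 - y r) * e).
  rewrite {1}d !mulrA ySpsi succ_neq addr0 -(mulrA (psi r)) we'.
  rewrite mulNr mulrN mulNr mulrA wC !mulNr; congr (- _).
  rewrite -!mulrA (mulrA (psi r) e') -d.
  have -> : (y r.+1 - y r) * e = e * (y r.+1 - y r) by rewrite mulrBl mulrBr !yE.
  by rewrite !mulrA -we.
have : y r.+1 * ((y r.+1 - y r) * e) + y r * ((y r.+1 - y r) * e) = 0.
  by rewrite yd mulNr addNr.
rewrite -mulrDl mulrA.
have -> : (y r.+1 + y r) * (y r.+1 - y r) = y r.+1 ^+ 2 - y r ^+ 2.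
  rewrite mulrDl !mulrBr (yC r r.+1) addrA subrK.
  by rewrite !expr2.
by rewrite mulrBl y2 subr0.
Qed.

(** * The simultaneous induction along the walk *)

Definition dies n := forall s a b c u, size s = n -> good s a b ->
  c != a -> c != b -> E (s ++ c :: u) = 0.
(** The sign is plus when [z] continues the component of [v]. In the deformed model a change of
    letter replaces a weight [w] by [x - w], hence the minus sign modulo [x]. *)
Definition follows n := forall s v z c u, size s = n -> good (rcons s v) z c ->
  z != c -> y n.+1 * E (s ++ v :: z :: u) =
  (if z == v + 1 then y n else - y n) * E (s ++ v :: z :: u).
Definition squares_zero n := forall s z c u, size s = n -> good s z c ->
  y n ^+ 2 * E (s ++ z :: u) = 0.

Lemma psi_sign_comm r j (b : bool) : (j < r)%N ->
  psi r * (if b then y j else - y j) = (if b then y j else - y j) * psi r.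
Proof.
move=> jr; have h : psi r * y j = y j * psi r.
  by apply: psiy; rewrite neq_ltn ?jr // ltnW.
by case: b => //; rewrite mulrN h mulNr.
Qed.

Lemma y_sqr_sign n m (b : bool) e : (forall j, y j * e = e * y j) ->
  y n * e = (if b then y m else - y m) * e ->
  y n ^+ 2 * e = y m ^+ 2 * e.
Proof.
move=> ye h; rewrite expr2 -mulrA h.
have -> : (if b then y m else - y m) * e = e * (if b then y m else - y m).
  by case: b {h}; rewrite // mulNr mulrN ye.
rewrite mulrA h; case: b {h}; first by rewrite -mulrA -ye mulrA -expr2.
by rewrite !mulNr mulrN opprK -mulrA -ye mulrA -expr2.
Qed.

(** Off a wall [y_n] is, up to sign, the preceding [y]. On a wall the last two residues are
    [v, v + 1], reached from the state [{v, v + 1}]; after the letter [t] before them, both orders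
    are walks, with opposite signs by [good_sign], which is the input of [y_sqr_up]. *)
Lemma squares_zero_step n :
  (forall m, (m < n)%N -> squares_zero m /\ follows m) -> squares_zero n.
Proof.
move=> IH s z c u; elim/last_ind: s => [|s v _] sz hg.
  by rewrite -sz expr2 -mulrA y0E mulr0.
rewrite size_rcons in sz; rewrite cat_rcons.
have [sv fv] : squares_zero (size s) /\ follows (size s) by apply: IH; rewrite -sz.
have hv : exists d, good s v d.
  by case/good_rcons_inv: (hg) => d hd _; exists d.
have sq0 : y (size s) ^+ 2 * E (s ++ v :: z :: u) = 0.
  by case: hv => d hd; exact: sv hd.
have [zc|zc] := eqVneq z c; last first.
  rewrite -sz -[RHS]sq0; apply: (y_sqr_sign (b := z == v + 1)).
    by move=> j; exact: yE.
  exact: fv hg zc.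
have {hv hg zc} hg : good s v (v + 1) /\ z = v + 1.
  subst c; case/good_rcons_inv: hg => d hd [] [].
    by move=> <- zd; rewrite -{1}zd in hd.
  by move=> -> <-.
case: hg => hg ez; subst z.
elim/last_ind: s => [|s t _] in sz sv fv sq0 hg *; first by case: (good_nil_succ hg).
rewrite size_rcons in sz sv fv sq0; rewrite !cat_rcons in sq0 *.
have [_ ft] : squares_zero (size s) /\ follows (size s) by apply: IH; rewrite -sz.
have vv : v != v + 1 by rewrite eq_sym succ_neq.
have h1 := ft s t v (v + 1) (v + 1 :: u) erefl hg vv.
have h2 := ft s t (v + 1) v (v :: u) erefl (good_swap hg).
rewrite succ_neq in h2; have {}h2 := h2 isT.
rewrite (good_sign hg vv) in h2.
rewrite -sz -(cat_rcons t s) -(size_rcons s t).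
apply: (y_sqr_up (w := if v == t + 1 then y (size s) else - y (size s))).
- by apply: psi_sign_comm; rewrite size_rcons.
- by rewrite size_rcons !cat_rcons.
- by rewrite size_rcons !cat_rcons h2; case: (v == _); rewrite //= ?opprK.
- by rewrite size_rcons !cat_rcons.
Qed.

Lemma follows_step n : dies n -> squares_zero n ->
  (forall m, (m < n)%N -> [/\ dies m, squares_zero m & follows m]) -> follows n.
Proof.
move=> Dn Sn IH s v z c u sz hg zc; subst n.
case/good_rcons_inv: hg => d hd [] [ez ec]; subst z c.
  by rewrite eqxx; apply: y_up; apply: Dn hd _ _; rewrite ?succ_neq.
rewrite (negbTE zc).
have [vd|nvd] := eqVneq v d.
  by subst d; apply: y_eq; apply: Sn hd.
have [fvd|] := boolP (far v d); last first.
  case/not_far => ev; first by rewrite ev eqxx in nvd.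
    by rewrite ev eqxx in zc.
  subst v.
  elim/last_ind: s => [|s t _] in Dn Sn IH hd *.
    by case: (good_nil_succ (good_swap hd)).
  have [Ds Ss fs] : [/\ dies (size s), squares_zero (size s) & follows (size s)].
    by apply: IH; rewrite size_rcons.
  rewrite !cat_rcons !size_rcons.
  (* The state before [v = d + 1] is [{d, d + 1}]. Either [t = d], and [d, d + 1, d] is a braid
     pattern, or [d = t + 1], and [t, t + 2, t + 1] is rearranged to [t + 2, t, t + 1] because [t]
     and [t + 2] are far. *)
  case/good_rcons_inv: (hd) => e he [] [et ee].
    have et' : d = t by apply: (addIr 1).
    subst t; subst e.
    rewrite y_braid.
    - have := fs s d (d + 1) d (d :: u) erefl hd; rewrite succ_neq eqxx.
      by move=> /(_ isT) h; rewrite !mulNr h.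
    - by apply: Ds he _ _; rewrite ?succ_neq.
    - exact: Ss he.
  subst e; subst d.
  have ft : far t (t + 1 + 1) by rewrite farC far_succ2.
  have hg2 : good (rcons s (t + 1 + 1)) (t + 1 + 1 + 1) t.
    exact/good_step/good_swap.
  have up : y (size s).+2 * E (s ++ [:: t + 1 + 1, t, t + 1 & u]) =
            y (size s).+1 * E (s ++ [:: t + 1 + 1, t, t + 1 & u]).
    rewrite -(cat_rcons _ s) -(size_rcons s (t + 1 + 1)); apply: y_up.
    by apply: Dn hg2 _ _; rewrite ?size_rcons ?succ_neq // eq_sym succ2_neq.
  have pyr : psi (size s) * y (size s).+2 = y (size s).+2 * psi (size s).
    by apply: psiy; rewrite neq_ltn ltnS ?leqnSn ?leqnn orbT.
  have fs1 : y (size s).+1 * E (s ++ [:: t, t + 1 + 1, t + 1 & u]) =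
       - y (size s) * E (s ++ [:: t, t + 1 + 1, t + 1 & u]).
    have := fs s t (t + 1 + 1) (t + 1) (t + 1 :: u) erefl hd.
    by rewrite succ_neq; apply.
  rewrite mulNr fs1 mulNr opprK (conj_far _ _ ft) 2!mulrA -pyr -(mulrA (psi _)).
  rewrite up mulrA psiyS succ2_neq addr0.
  by rewrite !mulrA.
elim/last_ind: s => [|s t _] in Dn Sn IH hd *.
  by rewrite mulNr y0E oppr0 (y_far [::]) // y0E mulr0 mul0r.
have [_ _ fs] : [/\ dies (size s), squares_zero (size s) & follows (size s)].
  by apply: IH; rewrite size_rcons.
rewrite (y_far _ _ fvd) mulNr !cat_rcons size_rcons.
have h1 := fs s t v d (d :: u) erefl hd nvd.
have h2 := fs s t d v (v :: u) erefl (good_swap hd).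
rewrite eq_sym nvd (good_sign hd nvd) in h2.
rewrite (h2 isT) h1 mulrA psi_sign_comm // -(mulrA _ (psi _)).
have := psiE1 s t d v u => ->; rewrite -!mulrA.
have := psi2_far (rcons s t) u fvd.
rewrite size_rcons cat_rcons expr2 -mulrA psiE1 => h.
have {}h : E (s ++ [:: t, v, d & u]) * psi (size s).+1 * psi (size s).+1 =
  E (s ++ [:: t, v, d & u]).
  by rewrite -(psiE1 s t d v) -mulrA -psiE1 mulrA -expr2; move: h;
     rewrite -psiE1 mulrA -expr2.
rewrite -!mulrA in h; rewrite h.
by case: (v == _); rewrite /= ?mulNr ?opprK.
Qed.

Section DiesStep.
Variable n : nat.
Hypothesis IH : forall m, (m < n)%N -> dies m /\ follows m.

(** On this idempotent the first of the two [y] is, up to sign, the preceding one, or 0 at the start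
    of the walk; it commutes with [psi_r], so [E_eq_lo] applies. *)
Lemma E_repeat s z c u : (size s < n)%N -> good s z c -> z != c ->
  E (s ++ z :: z :: u) = 0.
Proof.
elim/last_ind: s => [|s v _] sz hg zc.
  by apply: (@E_eq_lo [::] z u 0); rewrite ?mulr0 ?mul0r ?y0E.
rewrite size_rcons in sz.
have [_ fv] := IH (ltnW sz).
apply: (E_eq_lo (w := if z == v + 1 then y (size s) else - y (size s))).
  by apply: psi_sign_comm; rewrite size_rcons.
by rewrite size_rcons !cat_rcons; apply: fv hg zc.
Qed.

Lemma E_up_down s a c u : ((size s).+1 < n)%N -> good s a c -> a != c ->
  E (s ++ [:: a, a + 1, a & u]) = 0.
Proof.
move=> sz hg ac; apply: E_braid; last first.
  rewrite -cat_rcons; have [D _] := IH sz.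
  apply: D (good_step hg) _ _ => //; first by rewrite size_rcons.
  by rewrite eq_sym succ_neq.
have [ec|nc] := eqVneq c (a + 1); last first.
  have [D _] := IH (ltnW sz).
  by apply: D hg _ _; rewrite ?succ_neq // eq_sym.
subst c; rewrite -cat_rcons.
apply: (E_repeat (c := a + 1 + 1)); rewrite ?size_rcons //.
  exact/good_swap/good_step/good_swap.
by rewrite eq_sym succ2_neq.
Qed.
End DiesStep.

(** A letter [c] far from its predecessor [z] moves in front of it, where it already dies, and a
    repeated letter is [E_repeat]. The hard case is [z = c + 1]: up to two more letters are
    inspected, until a forbidden start, a braid pattern, a repetition or a far exchange appears. *)
Lemma dies_step n : (forall m, (m < n)%N -> dies m /\ follows m) -> dies n.
Proof.
move=> IH s a b c u sz; elim/last_ind: s => [|s z _] in sz *.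
  move=> /good_nil_inv[] [-> ->] h1 h2; first exact: E_first.
  exact: E_first.
rewrite size_rcons in sz; move=> hg ca cb.
have {a b hg ca cb} [d hd [cz cd]] :
    exists2 d, good s z d & c != z + 1 /\ c != d.
  by case/good_rcons_inv: hg => d hd [] [ea eb]; exists d => //;
    rewrite -ea -eb.
have Ds : dies (size s) by case: (IH (size s)) => //; rewrite -sz.
rewrite cat_rcons.
have [zc|nzc] := eqVneq c z.
  by subst z; apply: (E_repeat IH) hd cd; rewrite -sz.
have [fzc|] := boolP (far z c).
  by apply: E_far => //; apply: Ds hd _ _.
case/not_far => [ez|ez|ez]; [by rewrite ez eqxx in nzc|by rewrite ez eqxx in cz|].
subst z.
elim/last_ind: s => [|s v _] in sz hd Ds *.
  rewrite -{2}[c](addrK 1); apply: E_second.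
  by case: (good_nil_inv hd) => [[-> _]|[-> _]]; [left|right].
rewrite size_rcons in sz; rewrite size_rcons in Ds; rewrite cat_rcons.
case/good_rcons_inv: (hd) => e he [] [ez ed].
  move/addIr: ez => ez; subst v e.
  by apply: (E_up_down IH) he cd; rewrite -sz.
subst d e.
have [ev|nv] := eqVneq v (c + 1).
  subst v.
  (* The sequence is [c + 1, c + 1, c]. As [c + 1, c, c + 1] dies, the quadratic relation makes
     [y_{r+1}] and [y_{r+2}] agree here, and [y_{r+2}] commutes with [psi_r]. *)
  apply: (E_eq_hi (w := y (size s).+2)).
    by apply: psiy; rewrite neq_ltn ?ltnS ?leqnSn ?leqnn orbT.
  have h0 : E (s ++ [:: c + 1, c, c + 1 & u]) = 0.
    by rewrite -cat_rcons; apply: Ds hd _ _; rewrite ?size_rcons.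
  have := psi2_down (rcons s (c + 1)) c u.
  rewrite size_rcons cat_rcons expr2 -mulrA psiE1 h0 mul0r mulr0 mulrBl.
  by move/eqP; rewrite eq_sym subr_eq0 => /eqP.
have [fv|] := boolP (far v (c + 1)).
  apply: E_far => //; rewrite -cat_rcons; apply: E_far.
    case/and3P: fv => h1 h2 h3; apply/and3P; split=> //.
    by apply: contraNneq h2 => ->.
  apply: Ds (good_step (good_swap he)) _ _; rewrite ?size_rcons //.
  by case/and3P: fv => _ h2 _; apply: contraNneq h2 => ->.
case/not_far => [ev|ev|ev]; first by rewrite ev eqxx in nv.
  move/addIr: ev => ev; subst v.
  apply: (E_up_down IH) he _; first by rewrite -sz.
  by rewrite eq_sym succ_neq.
subst v.
elim/last_ind: s => [|s t _] in sz hd he Ds *.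
  by case: (good_nil_succ (good_swap he)).
rewrite size_rcons in sz; rewrite size_rcons in Ds; rewrite cat_rcons.
case/good_rcons_inv: (he) => f hf [] [et ef].
  have et' : t = c + 1 by apply: (addIr 1); rewrite -et.
  subst t f.
  apply: E_braid.
    have [D _] : dies (size s) /\ follows (size s) by apply: IH; lia.
    by apply: D hf _ _; rewrite ?succ_neq.
  rewrite -2!cat_rcons; apply: E_far; first exact: far_succ2.
  by apply: Ds (good_step (good_swap (good_step hf))) _ _; rewrite ?size_rcons.
move/addIr: ef => ef; subst t f.
apply: E_far; first by rewrite farC far_succ2.
rewrite -cat_rcons.
apply: (E_up_down IH (c := c + 1 + 1 + 1)).
- by rewrite size_rcons -sz.
- exact/good_swap/good_step/good_swap.
- by rewrite eq_sym succ3_neq.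
Qed.

Lemma folded_walk n : [/\ dies n, squares_zero n & follows n].
Proof.
elim/ltn_ind: n => n IH.
have Dn : dies n by apply: dies_step => m /IH[].
have Sn : squares_zero n by apply: squares_zero_step => m /IH[].
by split=> //; apply: follows_step.
Qed.

End FoldedWalk.

(** * Presented algebras and the blob relations *)

(* The algebra is kept abstract here: on the free algebra itself, conversion
   would unfold the monoid-algebra product. *)
Section QuotientRelations.
Variables (K : comNzRingType) (A : lalgType K) (rel : A -> A -> Prop).
Local Notation pi := (alg_pi (fun z => exists x y, rel x y /\ z = x - y)).

Lemma alg_pi0 : pi 0 = 0.
Proof. by apply: (addIr (pi 0)); rewrite -alg_piD !add0r. Qed.

Lemma alg_piB x y : pi (x - y) = pi x - pi y.
Proof. by apply/eqP; rewrite eq_sym subr_eq -alg_piD subrK. Qed.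

Lemma alg_pi_bool (b : bool) : pi b%:R = b%:R.
Proof. by case: b; rewrite ?alg_pi0. Qed.

Lemma pi_rel x y : rel x y -> pi x = pi y.
Proof.
by move=> h; apply/alg_piP/ideal_predP; apply: ideal_gen_in; exists x, y.
Qed.

Let piE := (expr2, alg_piM, alg_piB, alg_piD, alg_pi_bool, alg_pi1, alg_pi0).

Lemma pi_rel0 x : rel x 0 -> pi x = 0.
Proof. by move/pi_rel; rewrite !piE. Qed.

Lemma pi_relM0 x y : rel (x * y) 0 -> pi x * pi y = 0.
Proof. by move/pi_rel; rewrite !piE. Qed.

Lemma pi_relM x y z : rel (x * y) z -> pi x * pi y = pi z.
Proof. by move/pi_rel; rewrite !piE. Qed.

Lemma pi_relMM x y z t : rel (x * y) (z * t) -> pi x * pi y = pi z * pi t.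
Proof. by move/pi_rel; rewrite !piE. Qed.

Lemma pi_rel_slide x y z t (b : bool) e : rel (x * y * e) ((z * t + b%:R) * e) ->
  pi x * pi y * pi e = (pi z * pi t + b%:R) * pi e.
Proof. by move/pi_rel; rewrite !piE. Qed.

Lemma pi_rel_sqr0 x e : rel (x ^+ 2 * e) 0 -> pi x ^+ 2 * pi e = 0.
Proof. by move/pi_rel; rewrite !piE. Qed.

Lemma pi_rel_sqr x e : rel (x ^+ 2 * e) e -> pi x ^+ 2 * pi e = pi e.
Proof. by move/pi_rel; rewrite !piE. Qed.

Lemma pi_rel_sqrB x y z e : rel (x ^+ 2 * e) ((y - z) * e) ->
  pi x ^+ 2 * pi e = (pi y - pi z) * pi e.
Proof. by move/pi_rel; rewrite !piE. Qed.

Lemma pi_rel_sqr_sum (J : Type) (r : seq J) (P : pred J) (E : J -> A) x :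
  rel (x ^+ 2) (- 2%:R * x * \sum_(j <- r | P j) E j) ->
  pi x ^+ 2 = - 2%:R * pi x * \sum_(j <- r | P j) pi (E j).
Proof.
move/pi_rel; rewrite -[- 2%:R]sub0r mulr2n !piE !mulr2n sub0r => ->; congr (_ * _).
exact: (big_morph pi (@alg_piD _ _ _) alg_pi0).
Qed.

Lemma pi_rel_braid x y e : rel (x * y * x * e) ((y * x * y + 1) * e) ->
  pi x * pi y * pi x * pi e = (pi y * pi x * pi y + 1) * pi e.
Proof. by move/pi_rel; rewrite !piE. Qed.

End QuotientRelations.

Section AlgebraPresentation.
Variables (K : comNzRingType) (G : choiceType).
Variable rel : free_alg K G -> free_alg K G -> Prop.

Definition presented_pi (x : free_alg K G) : presented rel := alg_pi _ x.

Lemma presented_piD x y :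
  presented_pi (x + y) = presented_pi x + presented_pi y.
Proof. exact: alg_piD. Qed.

Lemma presented_pi0 : presented_pi 0 = 0.
Proof. exact: alg_pi0. Qed.

Lemma presented_piM x y :
  presented_pi (x * y) = presented_pi x * presented_pi y.
Proof. exact: alg_piM. Qed.

Lemma presented_pi1 : presented_pi 1 = 1.
Proof. by []. Qed.

Lemma presented_piZ a x : presented_pi (a *: x) = a *: presented_pi x.
Proof. exact: alg_piZ. Qed.

Lemma presented_pi_surj (u : presented rel) : exists x, u = presented_pi x.
Proof. by exists (generic_quotient.repr u); rewrite /presented_pi alg_piK. Qed.

Lemma presented_ind (P : presented rel -> Prop) :
  P 1 -> (forall g, P (pgen rel g)) ->
  (forall a x y, P x -> P y -> P (a *: x + y)) ->
  (forall x y, P x -> P y -> P (x * y)) -> forall u, P u.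
Proof.
move=> P1 Pg Plin PM u; have [x ->] := presented_pi_surj u.
move: x; apply: free_alg_ind => // [a x y hx hy|x y hx hy].
  by rewrite presented_piD presented_piZ; apply: Plin.
by rewrite presented_piM; apply: PM.
Qed.

Lemma presented_pi_eq0 x : presented_pi x = 0 ->
  ideal_gen (fun z => exists x y, rel x y /\ z = x - y) x.
Proof.
by rewrite -presented_pi0 => /alg_piP/ideal_predP; rewrite subr0.
Qed.

End AlgebraPresentation.

Section BlobRelations.
Variables (K : comNzRingType) (n l : nat) (k : 'Z_l).
Local Notation B := (blob K n k).
Local Notation gen := (pgen (@blob_rel K n l k)).
Local Notation pi := (@presented_pi K _ (@blob_rel K n l k)).

Definition seq_ffun (t : seq 'Z_l) : {ffun 'I_n -> 'Z_l} :=
  [ffun j : 'I_n => nth 0 t j].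

(* Generators indexed from 0 by all of nat, and idempotents by all sequences;
   they vanish outside the range of the presentation. *)
Definition by_ (j : nat) : B :=
  oapp (fun s : 'I_n => gen (Gy l s)) 0 (insub j).
Definition bpsi (r : nat) : B :=
  oapp (fun s : 'I_n.-1 => gen (Gpsi l s)) 0 (insub r).
Definition bE (t : seq 'Z_l) : B :=
  if size t == n then blob_e K k (seq_ffun t) else 0.

Lemma by_ord (s : 'I_n) : by_ s = gen (Gy l s).
Proof. by rewrite /by_ valK. Qed.

Lemma bpsi_ord (s : 'I_n.-1) : bpsi s = gen (Gpsi l s).
Proof. by rewrite /bpsi valK. Qed.

Lemma by_out j : (n <= j)%N -> by_ j = 0.
Proof. by move=> h; rewrite /by_ insubF // ltnNge h. Qed.

Lemma bpsi_out j : (n.-1 <= j)%N -> bpsi j = 0.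
Proof. by move=> h; rewrite /bpsi insubF // ltnNge h. Qed.

Lemma by_comm r j : by_ r * by_ j = by_ j * by_ r.
Proof.
have [hr|/by_out->] := ltnP r n; last by rewrite mul0r mulr0.
have [hj|/by_out->] := ltnP j n; last by rewrite mul0r mulr0.
rewrite -[r]/(nat_of_ord (Ordinal hr)) -[j]/(nat_of_ord (Ordinal hj)) !by_ord.
exact/pi_relMM/blob_yy.
Qed.

Lemma by_bE j t : by_ j * bE t = bE t * by_ j.
Proof.
have [hj|/by_out->] := ltnP j n; last by rewrite mul0r mulr0.
rewrite /bE; case: eqP => _; last by rewrite mul0r mulr0.
rewrite -[j]/(nat_of_ord (Ordinal hj)) by_ord.
exact/pi_relMM/blob_ye.
Qed.

Lemma bE_idem t : bE t * bE t = bE t.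
Proof.
rewrite /bE; case: eqP => _; last by rewrite mul0r.
have := @blob_ee K n l k (seq_ffun t) (seq_ffun t).
by rewrite eqxx; apply: pi_relM.
Qed.

Lemma bpsi_by r j : j != r -> j != r.+1 -> bpsi r * by_ j = by_ j * bpsi r.
Proof.
move=> h1 h2.
have [hj|/by_out->] := ltnP j n; last by rewrite mul0r mulr0.
have [hr|/bpsi_out->] := ltnP r n.-1; last by rewrite mul0r mulr0.
rewrite -[j]/(nat_of_ord (Ordinal hj)) -[r]/(nat_of_ord (Ordinal hr)).
by rewrite by_ord bpsi_ord; apply/pi_relMM/blob_psiy.
Qed.

(** Dictionary between the presentation, whose residue sequences are functions on ['I_n], and the
    walk argument, which splits them as lists. *)
Lemma two_positions (s u : seq 'Z_l) a b : size (s ++ a :: b :: u) = n ->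
  exists r : 'I_n.-1, [/\ r = size s :> nat,
    seq_ffun (s ++ a :: b :: u) (lo r) = a,
    seq_ffun (s ++ a :: b :: u) (hi r) = b
    & swap r (seq_ffun (s ++ a :: b :: u)) = seq_ffun (s ++ b :: a :: u)].
Proof.
rewrite size_cat /= => sz; have hr : (size s < n.-1)%N by lia.
exists (Ordinal hr).
have e1 : seq_ffun (s ++ a :: b :: u) (lo (Ordinal hr)) = a.
  by rewrite ffunE /= nth_cat ltnn subnn.
have e2 : seq_ffun (s ++ a :: b :: u) (hi (Ordinal hr)) = b.
  by rewrite ffunE /= nth_cat ltnNge leqnSn subSnn.
split=> //; apply/ffunP=> j; rewrite !ffunE.
case: tpermP => [->|->|/eqP h1 /eqP h2].
- by rewrite /= !nth_cat ltnn subnn ltnNge leqnSn subSnn.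
- by rewrite /= !nth_cat ltnn subnn ltnNge leqnSn subSnn.
rewrite !nth_cat; case: ltnP => // hj.
have : (j - size s)%N != 0%N.
  apply: contraNneq h1 => h; apply/eqP/val_inj.
  by rewrite /= -(subnKC hj) h addn0.
have : (j - size s)%N != 1%N.
  apply: contraNneq h2 => h; apply/eqP/val_inj.
  by rewrite /= -(subnKC hj) h addn1.
by case: (j - size s)%N => [|[|]].
Qed.

Lemma bpsi_bE s a b u : bpsi (size s) * bE (s ++ a :: b :: u) =
  bE (s ++ b :: a :: u) * bpsi (size s).
Proof.
rewrite /bE !size_cat /=; case: eqP => [sz|_]; last by rewrite mulr0 mul0r.
have [|r [<- _ _ <-]] := @two_positions s u a b; first by rewrite size_cat.
by rewrite bpsi_ord; apply/pi_relMM/blob_psie.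
Qed.

Lemma by_lo (r : 'I_n.-1) : by_ r = gen (Gy l (lo r)).
Proof. by rewrite -by_ord. Qed.

Lemma by_hi (r : 'I_n.-1) : by_ r.+1 = gen (Gy l (hi r)).
Proof. by rewrite -by_ord. Qed.

Lemma bpsi_byS s a b u : bpsi (size s) * by_ (size s).+1 * bE (s ++ a :: b :: u) =
  (by_ (size s) * bpsi (size s) + (a == b)%:R) * bE (s ++ a :: b :: u).
Proof.
rewrite /bE; case: eqP => [sz|_]; last by rewrite [LHS]mulr0 [RHS]mulr0.
have [r [<- h1 h2 _]] := two_positions sz.
have := @blob_psiyhi K n l k r (seq_ffun (s ++ a :: b :: u)).
rewrite h1 h2 bpsi_ord by_lo by_hi; apply: pi_rel_slide.
Qed.

Lemma byS_bpsi s a b u : by_ (size s).+1 * bpsi (size s) * bE (s ++ a :: b :: u) =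
  (bpsi (size s) * by_ (size s) + (a == b)%:R) * bE (s ++ a :: b :: u).
Proof.
rewrite /bE; case: eqP => [sz|_]; last by rewrite [LHS]mulr0 [RHS]mulr0.
have [r [<- h1 h2 _]] := two_positions sz.
have := @blob_yhipsi K n l k r (seq_ffun (s ++ a :: b :: u)).
rewrite h1 h2 bpsi_ord by_lo by_hi; apply: pi_rel_slide.
Qed.

Lemma bpsi2_eq s a u : bpsi (size s) ^+ 2 * bE (s ++ a :: a :: u) = 0.
Proof.
rewrite /bE; case: eqP => [sz|_]; last by rewrite mulr0.
have [r [<- h1 h2 _]] := two_positions sz.
have := @blob_psi2_eq K n l k r (seq_ffun (s ++ a :: a :: u)).
by rewrite h1 h2 bpsi_ord => /(_ erefl); apply: pi_rel_sqr0.
Qed.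

Lemma bpsi2_up s a u : bpsi (size s) ^+ 2 * bE (s ++ a :: (a + 1) :: u) =
  (by_ (size s).+1 - by_ (size s)) * bE (s ++ a :: (a + 1) :: u).
Proof.
rewrite /bE; case: eqP => [sz|_]; last by rewrite [LHS]mulr0 [RHS]mulr0.
have [r [<- h1 h2 _]] := two_positions sz.
have := @blob_psi2_succ K n l k r (seq_ffun (s ++ a :: (a + 1) :: u)).
rewrite h1 h2 bpsi_ord by_lo by_hi => /(_ erefl); apply: pi_rel_sqrB.
Qed.

Lemma bpsi2_down s a u : bpsi (size s) ^+ 2 * bE (s ++ (a + 1) :: a :: u) =
  (by_ (size s) - by_ (size s).+1) * bE (s ++ (a + 1) :: a :: u).
Proof.
rewrite /bE; case: eqP => [sz|_]; last by rewrite [LHS]mulr0 [RHS]mulr0.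
have [r [<- h1 h2 _]] := two_positions sz.
have := @blob_psi2_pred K n l k r (seq_ffun (s ++ (a + 1) :: a :: u)).
rewrite h1 h2 addrK bpsi_ord by_lo by_hi => /(_ erefl); apply: pi_rel_sqrB.
Qed.

Lemma bpsi2_far s a b u : far a b ->
  bpsi (size s) ^+ 2 * bE (s ++ a :: b :: u) = bE (s ++ a :: b :: u).
Proof.
move=> fab; rewrite /bE; case: eqP => [sz|_]; last by rewrite mulr0.
have [r [<- h1 h2 _]] := two_positions sz.
have := @blob_psi2_far K n l k r (seq_ffun (s ++ a :: b :: u)).
case/and3P: fab => n1 n2 n3; rewrite h1 h2 !inE !negb_or (eq_sym b) n1 n2 /=.
rewrite eq_sym subr_eq n3 bpsi_ord => /(_ isT); apply: pi_rel_sqr.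
Qed.

Lemma bpsi_braid s a u :
  bpsi (size s) * bpsi (size s).+1 * bpsi (size s) * bE (s ++ [:: a, a + 1, a & u])
  = (bpsi (size s).+1 * bpsi (size s) * bpsi (size s).+1 + 1)
    * bE (s ++ [:: a, a + 1, a & u]).
Proof.
rewrite /bE; case: eqP => [sz|_]; last by rewrite [LHS]mulr0 [RHS]mulr0.
have [r [er h1 h2 _]] := two_positions sz.
have [r' [er' _ h3 _]] : exists r' : 'I_n.-1, [/\ r' = (size s).+1 :> nat,
    seq_ffun (s ++ [:: a, a + 1, a & u]) (lo r') = a + 1,
    seq_ffun (s ++ [:: a, a + 1, a & u]) (hi r') = a & True].
  have := @two_positions (rcons s a) u (a + 1) a.
  by rewrite !cat_rcons size_rcons => /(_ sz) [r' [? ? ? _]]; exists r'.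
have := @blob_braid K n l k r r' (seq_ffun (s ++ [:: a, a + 1, a & u])).
rewrite h1 h2 h3 addrK eqxx er' er => /(_ erefl).
by rewrite -er' -er !bpsi_ord; apply: pi_rel_braid.
Qed.

Lemma bE_first a u : a != k -> a != - k -> bE (a :: u) = 0.
Proof.
move=> h1 h2; rewrite /bE; case: eqP => // sz.
have n0 : (0 < n)%N by rewrite -sz.
by apply/pi_rel0/(@blob_e1 _ _ _ _ (Ordinal n0)); rewrite // ffunE.
Qed.

Lemma by0_bE a u : by_ 0 * bE (a :: u) = 0.
Proof.
have [h|] := boolP ((a == k) || (a == - k)); last first.
  by rewrite negb_or => /andP[h1 h2]; rewrite bE_first // mulr0.
rewrite /bE; case: eqP => [sz|_]; last by rewrite mulr0.
have n0 : (0 < n)%N by rewrite -sz.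
rewrite -[0%N]/(nat_of_ord (Ordinal n0)) by_ord.
by apply/pi_relM0/blob_y1; rewrite // ffunE.
Qed.

Lemma bE_second a u : a = k \/ a = - k -> bE (a :: (a - 1) :: u) = 0.
Proof.
move=> ha; rewrite /bE; case: eqP => // sz.
have n0 : (0 < n)%N by rewrite -sz.
have n1 : (1 < n)%N by rewrite -sz.
apply/pi_rel0/(@blob_e2 _ _ _ _ (Ordinal n0) (Ordinal n1)); rewrite // !ffunE /=.
by case: ha => ->; rewrite !eqxx ?orbT.
Qed.

Hypotheses (two_neq0 : 2%:R != 0 :> 'Z_l) (three_neq0 : 3%:R != 0 :> 'Z_l).
Hypotheses (kk_neq1 : k + k != 1) (kk_neqN1 : k + k != -1).

Lemma blob_folded_walk r :
  squares_zero k by_ bE r /\ follows k by_ bE r.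
Proof.
have [] := folded_walk two_neq0 three_neq0 kk_neq1 kk_neqN1 by_comm by_bE
  bpsi_bE bpsi_by bpsi_byS byS_bpsi bpsi2_eq bpsi2_up bpsi2_down bpsi2_far
  bpsi_braid by0_bE bE_first bE_second r.
by [].
Qed.

End BlobRelations.

(** * Words and their residues *)

Section WordResidues.
Variables (I : comNzRingType) (k : I).
Implicit Types (p u w : seq bool).

(* A word lists the components of the boxes of a standard bitableau in the
   order of their entries; [true] is the second component. *)
Definition next_res p (b : bool) : I :=
  (if b then - k else k) + (count_mem b p)%:R.

Lemma next_res_nil b : next_res [::] b = if b then - k else k.
Proof. exact: addr0. Qed.

Lemma next_res_cat p u b :
  next_res (p ++ u) b = next_res p b + (count_mem b u)%:R.
Proof. by rewrite /next_res count_cat natrD addrA. Qed.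

Fixpoint res_from p w : seq I :=
  if w is b :: w' then next_res p b :: res_from (rcons p b) w' else [::].

Definition res w := res_from [::] w.

Lemma res_from_cat p u w : res_from p (u ++ w) = res_from p u ++ res_from (p ++ u) w.
Proof.
elim: u p => [|b u IH] p /=; first by rewrite cats0.
by rewrite IH cat_rcons.
Qed.

Lemma res_cat u w : res (u ++ w) = res u ++ res_from u w.
Proof. exact: res_from_cat. Qed.

Lemma size_res_from p w : size (res_from p w) = size w.
Proof. by elim: w p => //= b w IH p; rewrite IH. Qed.

Lemma size_res w : size (res w) = size w.
Proof. exact: size_res_from. Qed.

Lemma next_res_perm p p' b : perm_eq p p' -> next_res p b = next_res p' b.
Proof. by move=> /seq.permP h; rewrite /next_res h. Qed.

Lemma res_from_perm p p' w : perm_eq p p' -> res_from p w = res_from p' w.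
Proof.
elim: w p p' => //= b w IH p p' h; rewrite (next_res_perm _ h); congr (_ :: _).
by apply: IH; rewrite -!cats1 perm_cat2r.
Qed.

Lemma next_res_rcons p a b : next_res (rcons p a) b = next_res p b + (a == b)%:R.
Proof. by rewrite /next_res -cats1 count_cat /= addn0 natrD addrA. Qed.

(** Distinct letters do not count towards each other's residue, and later residues depend only on
    the multiset of letters before them. *)
Lemma res_swap p a b u : a != b ->
  res (p ++ a :: b :: u) =
    res p ++ next_res p a :: next_res p b :: res_from (p ++ [:: a; b]) u /\
  res (p ++ b :: a :: u) =
    res p ++ next_res p b :: next_res p a :: res_from (p ++ [:: a; b]) u.
Proof.
move=> ab; rewrite !res_cat /= !next_res_rcons (eq_sym b) (negbTE ab) /= !addr0.
rewrite -!cats1 -!catA; split=> //.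
rewrite (@res_from_perm (p ++ [:: b; a]) (p ++ [:: a; b])) //.
by rewrite perm_cat2l (perm_catC [:: b] [:: a]).
Qed.

Lemma good_res w : good k (res w) (next_res w false) (next_res w true).
Proof.
elim/last_ind: w => [|w b IH].
  by rewrite /next_res /= !addr0; exact: good_nil.
rewrite -cats1 res_cat /= cats1 !(next_res_rcons, cats1); case: b; rewrite addr0.
  exact/good_swap/good_step/good_swap.
exact/good_step.
Qed.

End WordResidues.

Lemma nth_swap_far (T : Type) (x0 : T) p s a b u : s != size p -> s != (size p).+1 ->
  nth x0 (p ++ b :: a :: u) s = nth x0 (p ++ a :: b :: u) s.
Proof.
move=> h1 h2; rewrite !nth_cat; case: ltnP => // hs.
have : (s - size p)%N != 0%N by lia.
have : (s - size p)%N != 1%N by lia.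
by case: (s - size p)%N => [|[]].
Qed.

Lemma nth_first (T : Type) (x0 : T) p a u : nth x0 (p ++ a :: u) (size p) = a.
Proof. by rewrite nth_cat ltnn subnn. Qed.

Lemma nth_second (T : Type) (x0 : T) p a b u : nth x0 (p ++ a :: b :: u) (size p).+1 = b.
Proof. by rewrite nth_cat ltnNge leqnSn subSnn. Qed.

Lemma nth_third (T : Type) (x0 : T) p a b c u :
  nth x0 (p ++ [:: a, b, c & u]) (size p).+2 = c.
Proof. by have := nth_second x0 (rcons p a) b c u; rewrite cat_rcons size_rcons. Qed.

Lemma cat_inj_size (T : Type) (s1 s2 t1 t2 : seq T) :
  size s1 = size s2 -> s1 ++ t1 = s2 ++ t2 -> s1 = s2 /\ t1 = t2.
Proof.
move=> sz e; split.
  by rewrite -(take_size_cat t1 sz) e take_size_cat.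
by rewrite -(drop_size_cat t1 sz) e drop_size_cat.
Qed.

Lemma split_two (T : Type) r (s : seq T) : (r.+1 < size s)%N ->
  exists p a b u, s = p ++ a :: b :: u /\ size p = r.
Proof.
move=> h; exists (take r s); have := size_drop r s.
case e : (drop r s) => [|a [|b u]] /= hs; [by lia|by lia|].
by exists a, b, u; rewrite -e cat_take_drop size_take; split=> //; rewrite ltnW // ltnW.
Qed.

(** * Deformed operators on functions on words *)

Section WordFunctions.
Variables (I : comNzRingType) (k : I) (F : fieldType) (x : F) (tl : bool).
Hypothesis x_neq0 : x != 0.
Hypotheses (two_neq0 : 2%:R != 0 :> I) (three_neq0 : 3%:R != 0 :> I).
Local Notation V := (seq bool -> F).
Local Notation next_res := (next_res k).
Local Notation res := (res k).
Implicit Types (p u w : seq bool) (f g h : V).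

(** The two weights differ by [x] or [-x], the only denominator that [psi_op] introduces. *)
Definition weight (b : bool) : F := if b == tl then 0 else x.
Local Notation X := weight.

Lemma weightB a b : a != b -> X b - X a != 0.
Proof.
rewrite /weight; case: a; case: b => //; case: tl => //= _;
  by rewrite ?subr0 // sub0r oppr_eq0.
Qed.

Definition y_op (r : nat) f : V := fun w => X (nth false w r) * f w.

(** Modelled on the polynomial representation of a quiver Hecke algebra. The factor [X b - X a] sits
    on one direction of the exchange only, so that both directions compose to the quadratic
    relation. Equal letters have residues [i, i + 1] and equal weights, so the value 0 agrees with
    [psi_r^2 = y_{r+1} - y_r]. *)
Definition psi_op (r : nat) f : V := fun w =>
  if drop r w is a :: b :: u then
    let p := take r w in
    if a == b then 0
    else if next_res p a == next_res p b then
      (f w - f (p ++ b :: a :: u)) / (X b - X a)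
    else (if next_res p b == next_res p a + 1 then X b - X a else 1)
         * f (p ++ b :: a :: u)
  else 0.

Lemma psi_opE p a b u f : psi_op (size p) f (p ++ a :: b :: u) =
  if a == b then 0
  else if next_res p a == next_res p b then
    (f (p ++ a :: b :: u) - f (p ++ b :: a :: u)) / (X b - X a)
  else (if next_res p b == next_res p a + 1 then X b - X a else 1)
       * f (p ++ b :: a :: u).
Proof. by rewrite /psi_op drop_size_cat // take_size_cat. Qed.

Lemma psi_opE1 p a b c u f : psi_op (size p).+1 f (p ++ [:: a, b, c & u]) =
  if b == c then 0
  else if next_res (rcons p a) b == next_res (rcons p a) c then
    (f (p ++ [:: a, b, c & u]) - f (p ++ [:: a, c, b & u])) / (X c - X b)
  else (if next_res (rcons p a) c == next_res (rcons p a) b + 1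
        then X c - X b else 1) * f (p ++ [:: a, c, b & u]).
Proof. by have := psi_opE (rcons p a) b c u f; rewrite size_rcons !cat_rcons. Qed.

Lemma psi_y_far p a b u s f : s != size p -> s != (size p).+1 ->
  psi_op (size p) (y_op s f) (p ++ a :: b :: u) =
  y_op s (psi_op (size p) f) (p ++ a :: b :: u).
Proof.
move=> h1 h2; rewrite /y_op !psi_opE !(@nth_swap_far _ false p s a b u h1 h2).
by case: ifP => _; [rewrite mulr0|case: ifP => _; ring].
Qed.

Lemma psi_y_hi p a b u f :
  psi_op (size p) (y_op (size p).+1 f) (p ++ a :: b :: u) =
  y_op (size p) (psi_op (size p) f) (p ++ a :: b :: u) +
  (next_res p a == next_res (rcons p a) b)%:R * f (p ++ a :: b :: u).
Proof.
rewrite /y_op !psi_opE !nth_first !nth_second next_res_rcons.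
have [<-|ab] := eqVneq a b.
  by rewrite mulr0 eq_sym succ_neq mul0r addr0.
have := weightB ab; rewrite /= addr0 => w0.
case: ifP => _ /=; last by ring.
by field.
Qed.

Lemma y_hi_psi p a b u f :
  y_op (size p).+1 (psi_op (size p) f) (p ++ a :: b :: u) =
  psi_op (size p) (y_op (size p) f) (p ++ a :: b :: u) +
  (next_res p a == next_res (rcons p a) b)%:R * f (p ++ a :: b :: u).
Proof.
rewrite /y_op !psi_opE !nth_first !nth_second next_res_rcons.
have [<-|ab] := eqVneq a b.
  by rewrite mulr0 eq_sym succ_neq mul0r addr0.
have := weightB ab; rewrite /= addr0 => w0.
case: ifP => _ /=; last by ring.
by field.
Qed.

Lemma psi_psi p a b u f :
  psi_op (size p) (psi_op (size p) f) (p ++ a :: b :: u) =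
  (let i := next_res p a in let j := next_res (rcons p a) b in
   if i == j then 0
   else if j == i + 1 then X b - X a
   else if i == j + 1 then X a - X b else 1) * f (p ++ a :: b :: u).
Proof.
rewrite !psi_opE next_res_rcons (eq_sym b a).
have [<-|ab] := eqVneq a b.
  by rewrite /= eq_sym succ_neq eqxx subrr mul0r.
rewrite /= addr0 (eq_sym (next_res p b) (next_res p a)).
have := weightB ab => w0.
have w0' : X a - X b != 0 by rewrite -opprB oppr_eq0.
case: eqP => [_|_]; first by rewrite /=; field; rewrite w0 w0'.
case: eqP => [->|_]; last by case: ifP => _; rewrite ?mul1r ?mulr1.
by rewrite eq_sym succ2_neq // mul1r.
Qed.

Lemma psi_far p q a b c d u f :
  let s := size (p ++ a :: b :: q) in
  psi_op (size p) (psi_op s f) (p ++ a :: b :: q ++ c :: d :: u) =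
  psi_op s (psi_op (size p) f) (p ++ a :: b :: q ++ c :: d :: u).
Proof.
move=> s.
have sE a' b' c' d' g : size (p ++ a' :: b' :: q) = s ->
   perm_eq (p ++ a' :: b' :: q) (p ++ a :: b :: q) ->
   psi_op s g (p ++ a' :: b' :: q ++ c' :: d' :: u) =
   if c' == d' then 0
   else if next_res (p ++ a :: b :: q) c' == next_res (p ++ a :: b :: q) d' then
     (g (p ++ a' :: b' :: q ++ c' :: d' :: u)
      - g (p ++ a' :: b' :: q ++ d' :: c' :: u)) / (X d' - X c')
   else (if next_res (p ++ a :: b :: q) d' == next_res (p ++ a :: b :: q) c' + 1
         then X d' - X c' else 1) * g (p ++ a' :: b' :: q ++ d' :: c' :: u).
  move=> sz pe.
  have := psi_opE (p ++ a' :: b' :: q) c' d' u g.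
  by rewrite sz -!catA /= !(next_res_perm k _ pe) => ->.
have pab : perm_eq (p ++ b :: a :: q) (p ++ a :: b :: q).
  by rewrite perm_cat2l (perm_catCA [:: b] [:: a] q).
have sab : size (p ++ b :: a :: q) = s by rewrite /s !size_cat.
rewrite psi_opE !sE // !psi_opE.
case: (a == b); case: (c == d) => //; rewrite ?mulr0 ?subrr ?mul0r ?if_same //.
do 2!case: ifP => _; do ?[case: ifP => _]; ring.
Qed.

(** Only the three letters and the two next residues [P], [Q] after [p] matter. For each of the
    eight triples the branches are decided by whether [P] and [Q] are equal or neighbours; 2 and 3
    being nonzero rules out other coincidences. *)
Lemma psi_braid p a b c u f :
  let w := p ++ [:: a, b, c & u] in
  let i := next_res p a in let j := next_res (rcons p a) b in
  let z := next_res (rcons (rcons p a) b) c in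
  psi_op (size p) (psi_op (size p).+1 (psi_op (size p) f)) w =
  psi_op (size p).+1 (psi_op (size p) (psi_op (size p).+1 f)) w +
  (if (z == i) && (i == j - 1) then 1
   else if (z == i) && (i == j + 1) then - 1 else 0) * f w.
Proof.
have pred1 (s t : I) : (s == t - 1) = (t == s + 1) by rewrite eq_sym subr_eq.
have succ_inj (s t : I) : (s + 1 == t + 1) = (s == t) by rewrite (inj_eq (addIr 1)).
have succN (s : I) : (s == s + 1) = false by rewrite eq_sym succ_neq.
have succN2 (s : I) : (s == s + 1 + 1) = false by rewrite eq_sym succ2_neq.
have succN3 (s : I) : (s == s + 1 + 1 + 1) = false by rewrite eq_sym succ3_neq.
have simpE := (pred1, succ_inj, succ_neq, succN, succ2_neq two_neq0, succN2,
  succ3_neq three_neq0, succN3, eqxx).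
have wtf : X true - X false != 0 by exact: weightB.
have wft : X false - X true != 0 by exact: weightB.
rewrite /= !(psi_opE, psi_opE1, next_res_rcons).
case: a; case: b; case: c => /=; rewrite ?addr0 ?simpE /=;
  move: (next_res p true) (next_res p false) (X true) (X false) wtf wft;
  move=> P Q xt xf wtf wft; rewrite ?mul0r ?mulr0 ?addr0 //;
  (have [->|PQ] := eqVneq P Q; rewrite ?simpE /= ?mul0r ?mulr0 ?addr0 ?subrr //;
   first (try by field; rewrite ?wtf ?wft));
  rewrite 1?eq_sym ?(negbTE PQ) /=.
all: rewrite ?(eq_sym (P + 1) Q) ?(eq_sym (Q + 1) P).
all: have [e1|h1] := eqVneq Q (P + 1); rewrite ?e1 ?simpE /= ?mul0r ?mulr0 ?addr0 //.
all: have [e2|h2] := eqVneq P (Q + 1); rewrite ?e2 ?simpE /= ?mul0r ?mulr0 ?addr0 //.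
all: by field; rewrite ?wtf ?wft.
Qed.

End WordFunctions.

(** * The lattice of functions polynomial on residue classes *)

Section WordLattice.
Variables (I : comNzRingType) (k : I) (F : fieldType) (x : F) (tl : bool).
Hypothesis x_neq0 : x != 0.
Hypothesis three_neq0 : 3%:R != 0 :> I.
Variable A : F -> Prop.
Hypotheses (A1 : A 1) (Ax : A x) (AD : forall a b, A a -> A b -> A (a + b)).
Hypotheses (AN : forall a, A a -> A (- a)) (AM : forall a b, A a -> A b -> A (a * b)).
Local Notation V := (seq bool -> F).
Local Notation X := (weight x tl).
Local Notation y_op := (y_op x tl).
Local Notation psi_op := (psi_op k x tl).
Local Notation res := (res k).
Local Notation next_res := (next_res k).
Implicit Types (p u w : seq bool) (f g h : V).

Lemma A0 : A 0.
Proof. by rewrite -(addrN 1); apply: AD (AN A1). Qed.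

(** These are the polynomials in the letter weights over [A], generated by [y_op] so that statements
    about them follow by adding one factor at a time. *)
Inductive polyfun : V -> Prop :=
| polyfun_const a : A a -> polyfun (fun _ => a)
| polyfun_lin a f g : A a -> polyfun f -> polyfun g ->
    polyfun (fun w => a * f w + g w)
| polyfun_y r f : polyfun f -> polyfun (y_op r f).

Lemma polyfunD f g : polyfun f -> polyfun g -> polyfun (fun w => f w + g w).
Proof.
move=> hf hg; rewrite (_ : (fun w => _) = fun w => 1 * f w + g w).
  exact: polyfun_lin.
by apply/funext => w; rewrite mul1r.
Qed.

Lemma polyfunB f g : polyfun f -> polyfun g -> polyfun (fun w => f w - g w).
Proof.
move=> hf hg; rewrite (_ : (fun w => _) = fun w => -1 * g w + f w).
  by apply: polyfun_lin => //; apply: AN.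
by apply/funext => w; rewrite mulN1r addrC.
Qed.

Lemma polyfun_swap r g : polyfun g -> exists2 h, polyfun h &
  forall p (a b : bool) u, size p = r -> h (p ++ a :: b :: u) = g (p ++ b :: a :: u).
Proof.
elim=> {g} [a ha|c f g hc _ [f' hf' ef] _ [g' hg' eg]|s f _ [h hh eh]].
- by exists (fun _ => a) => //; apply: polyfun_const.
- exists (fun w => c * f' w + g' w); first exact: polyfun_lin.
  by move=> p a b u sz; rewrite ef ?eg.
have [->|h1] := eqVneq s r.
  exists (y_op r.+1 h); first exact: polyfun_y.
  by move=> p a b u sz; rewrite /y_op eh // -sz nth_first nth_second.
have [->|h2] := eqVneq s r.+1.
  exists (y_op r h); first exact: polyfun_y.
  by move=> p a b u sz; rewrite /y_op eh // -sz nth_first nth_second.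
exists (y_op s h); first exact: polyfun_y.
by move=> p a b u sz; rewrite /y_op eh // nth_swap_far ?sz.
Qed.

(** Here the division by [X b - X a] is absorbed. Divided differences commute with [y_s] for [s]
    other than [r] and [r + 1], and obey a twisted Leibniz rule for these two, with correction terms
    [- f] and [f]. *)
Lemma polyfun_demazure r g : polyfun g -> exists2 h, polyfun h &
  forall p (a b : bool) u, size p = r -> a != b -> h (p ++ a :: b :: u) =
    (g (p ++ a :: b :: u) - g (p ++ b :: a :: u)) / (X b - X a).
Proof.
elim=> {g} [a ha|c f g hc _ [f' hf' ef] _ [g' hg' eg]|s f hf [h hh eh]].
- exists (fun _ => 0); first by apply: polyfun_const; exact: A0.
  by move=> p a' b u _ _; rewrite subrr mul0r.
- exists (fun w => c * f' w + g' w); first exact: polyfun_lin.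
  by move=> p a b u sz ab; rewrite ef ?eg //; ring.
have [->|h1] := eqVneq s r.
  exists (fun w => y_op r.+1 h w - f w).
    by apply: polyfunB => //; apply: polyfun_y.
  move=> p a b u sz ab; rewrite /y_op eh // -sz !nth_first nth_second.
  have := weightB tl x_neq0 ab.
  move: (X a) (X b) (f (p ++ [:: a, b & u])) (f (p ++ [:: b, a & u])).
  by move=> xa xb f1 f2 w0; field.
have [->|h2] := eqVneq s r.+1.
  exists (fun w => y_op r h w + f w).
    by apply: polyfunD => //; apply: polyfun_y.
  move=> p a b u sz ab; rewrite /y_op eh // -sz !nth_first !nth_second.
  have := weightB tl x_neq0 ab.
  move: (X a) (X b) (f (p ++ [:: a, b & u])) (f (p ++ [:: b, a & u])).
  by move=> xa xb f1 f2 w0; field.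
exists (y_op s h); first exact: polyfun_y.
move=> p a b u sz ab; rewrite /y_op eh // (@nth_swap_far _ false p s a b u) ?sz //.
by ring.
Qed.

(** The polynomial may change with the residue sequence [t], because the branch taken by [psi_op]
    does. Vanishing off length [n] lets identities be tested on words of length [n] only. *)
Definition lattice n f := (forall w, size w != n -> f w = 0) /\
  forall t, exists2 g, polyfun g & forall w, res w = t -> f w = g w.

Lemma lattice_lin n a f g : A a -> lattice n f -> lattice n g ->
  lattice n (fun w => a * f w + g w).
Proof.
move=> ha [f0 hf] [g0 hg]; split=> [w sw|t]; first by rewrite f0 // g0 // mulr0 addr0.
have [f' hf' ef] := hf t; have [g' hg' eg] := hg t.
exists (fun w => a * f' w + g' w); first exact: polyfun_lin.
by move=> w rw; rewrite ef // eg.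
Qed.

Lemma lattice_y n r f : lattice n f -> lattice n (y_op r f).
Proof.
move=> [f0 hf]; split=> [w sw|t]; first by rewrite /y_op f0 // mulr0.
have [f' hf' ef] := hf t; exists (y_op r f'); first exact: polyfun_y.
by move=> w rw; rewrite /y_op ef.
Qed.

Lemma lattice_restrict n f (P : seq I -> bool) : lattice n f ->
  lattice n (fun w => if P (res w) then f w else 0).
Proof.
move=> [f0 hf]; split=> [w sw|t]; first by rewrite f0 ?if_same.
have [f' hf' ef] := hf t; have [Pt|Pt] := boolP (P t).
  by exists f' => // w rw; rewrite rw Pt ef.
exists (fun _ => 0); first by apply: polyfun_const; exact: A0.
by move=> w rw; rewrite rw (negbTE Pt).
Qed.

(** The residues [c, d] at [r, r + 1] fix the branch on the whole class. If [c = d] the letters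
    differ and a divided difference is taken. If [d = c + 1] the factor is [y_{r+1} - y_r], which
    vanishes on equal letters just as [psi_op] does. In the other cases the letters again differ and
    are exchanged. *)
Lemma lattice_psi n r f : lattice n f -> lattice n (psi_op r f).
Proof.
move=> [f0 hf]; split=> [w sw|t].
  have [h|h] := ltnP r.+1 (size w); last first.
    rewrite /psi_op; have := size_drop r w.
    by case: (drop r w) => [|a [|b u]] //= hs; lia.
  have [p [a [b [u [ew sp]]]]] := split_two h.
  rewrite -sp ew psi_opE !f0 ?mulr0 ?subrr ?mul0r ?if_same //;
    by move: sw; rewrite ew !size_cat.
have [h|h] := ltnP r.+1 (size t); last first.
  exists (fun _ => 0); first by apply: polyfun_const; exact: A0.
  move=> w rw; move: h; rewrite -rw size_res => h.
  rewrite /psi_op; have := size_drop r w.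
  by case: (drop r w) => [|a [|b u]] //= hs; lia.
have [q [c [d [v [et sq]]]]] := split_two h.
have key w : res w = t -> exists p a b u, [/\ w = p ++ a :: b :: u, size p = r,
    next_res p a = c, (if a == b then next_res p a + 1 else next_res p b) = d
  & a != b -> res (p ++ b :: a :: u) = q ++ d :: c :: v].
  move=> rw; have hw : (r.+1 < size w)%N by rewrite -(size_res k) rw.
  have [p [a [b [u [ew sp]]]]] := split_two hw.
  exists p, a, b, u; move: rw; rewrite ew et res_cat /= next_res_rcons.
  case/cat_inj_size; first by rewrite size_res sp sq.
  move=> eq [e1 e2 e3]; split=> //.
    by rewrite -e2; case: eqP => [->|]; rewrite /= ?addr0.
  move=> ab; have [r1 r2] := res_swap k p u ab.
  rewrite r2 eq e1 -[next_res p b]addr0 -(_ : (a == b)%:R = 0) ?(negbTE ab) //.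
  rewrite (negbTE ab) in e2 *; rewrite e2; congr (_ ++ [:: _, _ & _]).
  by rewrite -e3 -!cats1 -catA.
have [ecd|ncd] := eqVneq c d.
  have [g hg eg] := hf t; have [g' hg' eg'] := polyfun_demazure r hg.
  exists g' => // w rw; have [p [a [b [u [ew sp e1 e2 e3]]]]] := key w rw.
  have ab : a != b.
    apply: contraTneq isT => ab; move: e2; rewrite ab eqxx -ecd -e1 ab => /eqP.
    by rewrite succ_neq.
  move: e2; rewrite (negbTE ab) => e2.
  rewrite -sp ew psi_opE (negbTE ab) e1 e2 ecd eqxx eg' // !eg -?ew //.
  by rewrite et e3 // ecd.
have [g hg eg] := hf (q ++ d :: c :: v).
have [g' hg' eg'] := polyfun_swap r hg.
have [edc|ndc] := eqVneq d (c + 1).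
  exists (fun w => y_op r.+1 g' w - y_op r g' w).
    by apply: polyfunB; apply: polyfun_y.
  move=> w rw; have [p [a [b [u [ew sp e1 e2 e3]]]]] := key w rw.
  rewrite /y_op -{1 2 3}sp ew psi_opE nth_first nth_second -mulrBl.
  have [ab|ab] := eqVneq a b; first by rewrite ab subrr mul0r.
  move: e2; rewrite (negbTE ab) => e2; rewrite e1 e2 (negbTE ncd) edc eqxx.
  by rewrite eg' // (eg _ (e3 ab)).
exists g' => // w rw; have [p [a [b [u [ew sp e1 e2 e3]]]]] := key w rw.
have ab : a != b.
  by apply: contraNneq ndc => ab; rewrite -e2 ab eqxx -e1 ab.
move: e2; rewrite (negbTE ab) => e2.
rewrite -sp ew psi_opE (negbTE ab) e1 e2 (negbTE ncd) (negbTE ndc) mul1r eg' //.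
by rewrite (eg _ (e3 ab)).
Qed.

End WordLattice.

(** * Alternating sums over words *)

Section AlternatingSums.
Variables (F : fieldType) (x : F) (tl : bool).
Variable A : F -> Prop.
Hypotheses (A1 : A 1) (Ax : A x) (AD : forall a b, A a -> A b -> A (a + b)).
Hypotheses (AN : forall a, A a -> A (- a)) (AM : forall a b, A a -> A b -> A (a * b)).
Local Notation V := (seq bool -> F).
Local Notation X := (weight x tl).
Local Notation y_op := (y_op x tl).
Implicit Types (c : seq (nat * option bool)) (p : seq bool) (g h : V).

(* Words made of constant blocks: [(m, Some b)] is a block [b^m], and
   [(m, None)] a block of length [m] over which the sum alternates. *)
Fixpoint alt c p g : F :=
  match c with
  | [::] => g p
  | (m, Some b) :: c' => alt c' (p ++ nseq m b) g
  | (m, None) :: c' =>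
      alt c' (p ++ nseq m (~~ tl)) g - alt c' (p ++ nseq m tl) g
  end.

Definition dim c := count (fun B : nat * option bool => B.2 == None) c.

Lemma alt_ext c p g h :
  (forall w, g (p ++ w) = h (p ++ w)) -> alt c p g = alt c p h.
Proof.
elim: c p => [|[m [b|]] c IH] p e /=; first by have := e [::]; rewrite cats0.
  by apply: IH => w; rewrite -catA.
by congr (_ - _); apply: IH => w; rewrite -catA.
Qed.

Lemma alt_lin c p a g h :
  alt c p (fun w => a * g w + h w) = a * alt c p g + alt c p h.
Proof. by elim: c p => [|[m [b|]] c IH] p //=; rewrite !IH; ring. Qed.

Lemma alt_const c p a : alt c p (fun _ => a) = a * (dim c == 0%N)%:R.
Proof.
elim: c p => [|[m [b|]] c IH] p /=; rewrite ?mulr1 ?IH //.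
by rewrite subrr mulr0.
Qed.

Lemma alt_y_fixed c p r g : (r < size p)%N ->
  alt c p (y_op r g) = X (nth false p r) * alt c p g.
Proof.
move=> h; rewrite -[RHS]addr0 -[X in _ + X](mul0r (dim c == 0%N)%:R).
rewrite -(alt_const c p) -alt_lin; apply: alt_ext => w.
by rewrite /y_op nth_cat h addr0.
Qed.

(** A letter in a constant block contributes a scalar. In an alternating block the summand with
    letter [tl] has weight 0 and the other has weight [x], so the block becomes constant at the
    price of one factor [x]. *)
Lemma alt_y c r s :
  (exists b, forall p g, size p = s -> (s <= r)%N ->
     alt c p (y_op r g) = X b * alt c p g) \/
  (exists2 c', dim c = (dim c').+1 & forall p g, size p = s -> (s <= r)%N ->
     alt c p (y_op r g) = x * alt c' p g).
Proof.
elim: c s => [|[m o] c IH] s /=.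
  (* Past the last block [nth] returns its default [false], still a fixed letter. *)
  left; exists false => p g <- h.
  by rewrite /y_op nth_default.
have [rm|mr] := ltnP r (s + m).
  have nthE b p : size p = s -> (s <= r)%N -> nth false (p ++ nseq m b) r = b.
    move=> sp sr; rewrite nth_cat sp ltnNge sr /= nth_nseq.
    by case: ltnP => //; lia.
  have szE b p : size p = s -> (r < size (p ++ nseq m b))%N.
    by rewrite size_cat size_nseq => ->.
  case: o => [b|]; [left; exists b | right; exists ((m, Some (~~ tl)) :: c)] => //.
    by move=> p g sp sr; rewrite alt_y_fixed ?szE // nthE.
  move=> p g sp sr; rewrite !alt_y_fixed ?szE // !nthE // /weight eqxx.
  by case: tl => /=; rewrite mul0r subr0.
have szE b p : size p = s -> size (p ++ nseq m b) = (s + m)%N.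
  by rewrite size_cat size_nseq => ->.
case: (IH (s + m)%N) => [[b hb]|[c' dc hc]].
  left; exists b => p g sp sr; case: o => [b'|]; first by rewrite hb ?szE.
  by rewrite !hb ?szE // mulrBr.
right; exists ((m, o) :: c'); first by rewrite /= dc addnS.
move=> p g sp sr; case: o => [b'|]; first by rewrite hc ?szE.
by rewrite !hc ?szE //= mulrBr.
Qed.

(** Constants are killed by any alternation, and each alternation removed by a factor [y_op r] is
    paid for by a factor [x], so the exponent never drops below [dim c]. *)
Lemma alt_polyfun g : polyfun x tl A g ->
  forall c p, exists2 a, A a & alt c p g = a * x ^+ dim c.
Proof.
have Az : A 0 by rewrite -(addrN 1); apply: AD (AN A1).
have Axn n : A (x ^+ n) by elim: n => // n IH; rewrite exprS; apply: AM.
elim=> {g} [a ha c p|b f g hb _ IHf _ IHg c p|r f _ IH c p].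
- rewrite alt_const; case: eqP => [->|_]; first by exists a; rewrite ?expr0.
  by exists 0; rewrite // mulr0 mul0r.
- have [a1 h1 e1] := IHf c p; have [a2 h2 e2] := IHg c p.
  exists (b * a1 + a2); first by apply: AD => //; apply: AM.
  by rewrite alt_lin e1 e2 mulrDl mulrA.
have AX b : A (X b) by rewrite /weight; case: ifP.
have [rp|pr] := ltnP r (size p).
  have [a ha e] := IH c p; exists (X (nth false p r) * a); first exact: AM.
  by rewrite alt_y_fixed // e mulrA.
case: (alt_y c r (size p)) => [[b hb]|[c' dc hc]].
  have [a ha e] := IH c p; exists (X b * a); first exact: AM.
  by rewrite hb // e mulrA.
have [a ha e] := IH c' p; exists a => //.
by rewrite hc // e dc exprS mulrCA.
Qed.

Fixpoint starts (ms : seq nat) (s : nat) : seq nat :=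
  if ms is m :: ms' then s :: starts ms' (s + m) else [::].

Definition alternating (ms : seq nat) := [seq (m, None : option bool) | m <- ms].

(** Only the word all of whose blocks consist of [~~ tl] contributes: any other has a block starting
    with a letter of weight 0. *)
Lemma alt_starts ms p a : all (leq 1) ms ->
  alt (alternating ms) p
    (fun w => a * \prod_(i <- starts ms (size p)) X (nth false w i))
  = a * x ^+ size ms.
Proof.
elim: ms p a => [|m ms IH] p a /=; first by rewrite big_nil.
move=> /andP[m0 hms].
have step b : alt (alternating ms) (p ++ nseq m b)
    (fun w => a * \prod_(i <- size p :: starts ms (size p + m)) X (nth false w i))
    = a * X b * x ^+ size ms.
  rewrite -(IH (p ++ nseq m b)) //; apply: alt_ext => w.
  rewrite big_cons mulrA size_cat size_nseq.
  rewrite !nth_cat size_cat size_nseq ltnn subnn -{1}(addn0 (size p)) ltn_add2l m0.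
  by rewrite nth_nseq m0.
rewrite !step /weight eqxx exprS; case: tl => /=;
  by rewrite mulr0 mul0r subr0 mulrA.
Qed.

Fixpoint blocks (ms : seq nat) (bs : seq bool) : seq bool :=
  match ms, bs with
  | m :: ms', b :: bs' => nseq m b ++ blocks ms' bs'
  | _, _ => [::]
  end.

Lemma alt_blocks ms p g h :
  (forall bs, size bs = size ms -> g (p ++ blocks ms bs) = h (p ++ blocks ms bs)) ->
  alt (alternating ms) p g = alt (alternating ms) p h.
Proof.
elim: ms p => [|m ms IH] p e /=; first by have := e [::] erefl; rewrite /= cats0.
by congr (_ - _); apply: IH => bs sz; rewrite -!catA; apply: (e (_ :: bs));
  rewrite /= sz.
Qed.

(** The alternating sums of the two sides would be [x^N] and [x a x^N] with [a] in [A], where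
    [N = size ms]; cancelling [x^N] would make [x] a unit of [A]. *)
Lemma starts_not_dvd ms p g : x != 0 -> (forall a, A a -> x * a != 1) ->
  polyfun x tl A g -> all (leq 1) ms ->
  ~ forall bs, size bs = size ms ->
    \prod_(i <- starts ms (size p)) X (nth false (p ++ blocks ms bs) i)
    = x * g (p ++ blocks ms bs).
Proof.
move=> x0 nunit hg hms e.
have [a ha ea] := alt_polyfun hg (alternating ms) p.
have dimE : dim (alternating ms) = size ms.
  by rewrite /dim /alternating count_map; elim: (ms) => //= m s ->.
have := alt_starts p 1 hms.
rewrite (@alt_blocks ms p _ (fun w => x * g w + 0)); last first.
  by move=> bs sz; rewrite mul1r addr0 e.
rewrite alt_lin alt_const mul0r addr0 ea dimE mul1r mulrA.
move/(canRL (mulfK (expf_neq0 _ x0))); rewrite divff ?expf_neq0 //.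
by move/eqP; rewrite (negbTE (nunit _ ha)).
Qed.

End AlternatingSums.

(** * The deformed representation on words *)

Section ActionShapes.
Variables (K : comNzRingType) (G : choiceType).
Variables (S : comNzRingType) (iota : {rmorphism K -> S}) (V : lmodType S).
Variable op : G -> V -> V.
Hypothesis op_linear : forall g, linear (op g).
Local Notation act := (act iota op).
Local Notation actM := (actM iota op_linear).
Implicit Types (z t : free_alg K G).

Lemma actN z v : act (- z) v = - act z v.
Proof. by rewrite -sub0r actB act0 sub0r. Qed.

Lemma act_bool (b : bool) v : act b%:R v = b%:R *: v.
Proof. by case: b; rewrite ?act1 ?scale1r // act0 scale0r. Qed.

Lemma act_sum (J : Type) (r : seq J) (P : pred J) (E : J -> free_alg K G) v :
  act (\sum_(j <- r | P j) E j) v = \sum_(j <- r | P j) act (E j) v.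
Proof.
by apply: (big_morph (fun z => act z v)) => [a b|]; rewrite ?actD ?act0.
Qed.

Lemma act_gen2 g h v :
  act (free_gen K g * free_gen K h) v = op g (op h v).
Proof. by rewrite (actM (free_gen K g) (free_gen K h)) !act_gen. Qed.

Lemma act_gen3 g h e v :
  act (free_gen K g * free_gen K h * free_gen K e) v = op g (op h (op e v)).
Proof.
by rewrite (actM (free_gen K g * free_gen K h) (free_gen K e)) act_gen2 act_gen.
Qed.

Lemma act_sqr g e v :
  act (free_gen K g ^+ 2 * free_gen K e) v = op g (op g (op e v)).
Proof. by rewrite expr2 act_gen3. Qed.

Lemma act_slide g h (b : bool) e v :
  act ((free_gen K g * free_gen K h + b%:R) * free_gen K e) v =
    op g (op h (op e v)) + b%:R *: op e v.
Proof.
rewrite (actM (free_gen K g * free_gen K h + b%:R) (free_gen K e)) act_gen.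
by rewrite (actD _ _ (free_gen K g * free_gen K h) b%:R) act_gen2 act_bool.
Qed.

Lemma act_diff g h e v :
  act ((free_gen K g - free_gen K h) * free_gen K e) v =
    op g (op e v) - op h (op e v).
Proof.
rewrite (actM (free_gen K g - free_gen K h) (free_gen K e)) act_gen.
by rewrite (actB _ _ (free_gen K g) (free_gen K h)) !act_gen.
Qed.

Lemma act_braid_l g h e v :
  act (free_gen K g * free_gen K h * free_gen K g * free_gen K e) v =
    op g (op h (op g (op e v))).
Proof.
rewrite (actM (free_gen K g * free_gen K h * free_gen K g) (free_gen K e)).
by rewrite act_gen3 act_gen.
Qed.

Lemma act_braid_r g h (b c : bool) e v :
  act ((free_gen K g * free_gen K h * free_gen K g
        + (if b then 1 else if c then -1 else 0)) * free_gen K e) v =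
    op g (op h (op g (op e v)))
    + (if b then 1 else if c then -1 else 0) *: op e v.
Proof.
set z := free_gen K g * _ * _; set t := if b then _ else _.
rewrite (actM (z + t) (free_gen K e)) act_gen (actD _ _ z t) act_gen3.
congr (_ + _); rewrite /t; case: (b); first by rewrite act1 scale1r.
by case: (c); rewrite ?actN ?act1 ?scaleN1r // act0 scale0r.
Qed.

Variables (T : Type) (ev : V -> T).

(** One lemma for each shape of defining relation. The map [ev] will be evaluation at a word of
    length [n], so that a relation is checked one word at a time. *)
Lemma act_gen22 g h g' h' v : ev (op g (op h v)) = ev (op g' (op h' v)) ->
  ev (act (free_gen K g * free_gen K h) v) =
  ev (act (free_gen K g' * free_gen K h') v).
Proof.
move=> eq; apply: etrans (congr1 ev (act_gen2 _ _ _)) _.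
exact: etrans eq (esym (congr1 ev (act_gen2 _ _ _))).
Qed.

Lemma act_gen3_slide g h g' h' (b : bool) e v :
  ev (op g (op h (op e v))) = ev (op g' (op h' (op e v)) + b%:R *: op e v) ->
  ev (act (free_gen K g * free_gen K h * free_gen K e) v) =
  ev (act ((free_gen K g' * free_gen K h' + b%:R) * free_gen K e) v).
Proof.
move=> eq; apply: etrans (congr1 ev (act_gen3 _ _ _ _)) _.
exact: etrans eq (esym (congr1 ev (act_slide _ _ _ _ _))).
Qed.

Lemma act_sqr0 g e v : ev (op g (op g (op e v))) = ev 0 ->
  ev (act (free_gen K g ^+ 2 * free_gen K e) v) = ev (act 0 v).
Proof.
move=> eq; apply: etrans (congr1 ev (act_sqr _ _ _)) _.
exact: etrans eq (esym (congr1 ev (act0 _ _ _))).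
Qed.

Lemma act_sqr_id g e v : ev (op g (op g (op e v))) = ev (op e v) ->
  ev (act (free_gen K g ^+ 2 * free_gen K e) v) = ev (act (free_gen K e) v).
Proof.
move=> eq; apply: etrans (congr1 ev (act_sqr _ _ _)) _.
exact: etrans eq (esym (congr1 ev (act_gen _ _ _ _))).
Qed.

Lemma act_sqr_diff g h h' e v :
  ev (op g (op g (op e v))) = ev (op h (op e v) - op h' (op e v)) ->
  ev (act (free_gen K g ^+ 2 * free_gen K e) v) =
  ev (act ((free_gen K h - free_gen K h') * free_gen K e) v).
Proof.
move=> eq; apply: etrans (congr1 ev (act_sqr _ _ _)) _.
exact: etrans eq (esym (congr1 ev (act_diff _ _ _ _))).
Qed.

Lemma act_braid g h (b c : bool) e v :
  ev (op g (op h (op g (op e v)))) =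
  ev (op h (op g (op h (op e v)))
      + (if b then 1 else if c then -1 else 0) *: op e v) ->
  ev (act (free_gen K g * free_gen K h * free_gen K g * free_gen K e) v) =
  ev (act ((free_gen K h * free_gen K g * free_gen K h
            + (if b then 1 else if c then -1 else 0)) * free_gen K e) v).
Proof.
move=> eq; apply: etrans (congr1 ev (act_braid_l _ _ _ _)) _.
exact: etrans eq (esym (congr1 ev (act_braid_r _ _ _ _ _ _))).
Qed.

End ActionShapes.

(** * The blob relations modulo [x] *)

Section WordRepresentation.
Variables (K : comNzRingType) (n l : nat) (k : 'Z_l).
Variables (F : fieldType) (iota : {rmorphism K -> F}) (x : F) (tl : bool).
Hypothesis x_neq0 : x != 0.
Hypotheses (two_neq0 : 2%:R != 0 :> 'Z_l) (three_neq0 : 3%:R != 0 :> 'Z_l).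
Hypotheses (kk_neq0 : k + k != 0) (kk_neq1 : k + k != 1) (kk_neqN1 : k + k != -1).
Variable A : F -> Prop.
Hypotheses (A1 : A 1) (Ax : A x) (AD : forall a b, A a -> A b -> A (a + b)).
Hypotheses (AN : forall a, A a -> A (- a)) (AM : forall a b, A a -> A b -> A (a * b)).
Hypothesis Aiota : forall a, A (iota a).
Local Notation V := (seq bool -> F^o).
Local Notation X := (weight x tl).
Local Notation y_op := (y_op x tl).
Local Notation psi_op := (psi_op k x tl).
Local Notation res := (res k).
Local Notation next_res := (next_res k).
Local Notation L := (lattice k x tl A n).

Definition e_op (i : {ffun 'I_n -> 'Z_l}) (f : V) : V :=
  fun w => if seq_ffun n (res w) == i then f w else 0.

Definition word_op (g : blob_gen n l) : V -> V :=
  match g with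
  | Gpsi r => psi_op r
  | Gy s => y_op s
  | Ge i => e_op i
  end.

Lemma word_op_linear g : linear (word_op g).
Proof.
move=> a f h; apply/funext => w.
change (word_op g (fun u => a * f u + h u) w = a * word_op g f w + word_op g h w).
case: g => [r|s|i] /=.
- rewrite /psi_op; case: (drop r w) => [|b [|c u]]; rewrite ?mulr0 ?addr0 //.
  by case: ifP => _; [rewrite mulr0 addr0|case: ifP => _; ring].
- by rewrite /y_op; ring.
- by rewrite /e_op; case: ifP => _ //; rewrite mulr0 addr0.
Qed.

Lemma lattice_op g (f : V) : L f -> L (word_op g f).
Proof.
case: g => [r|s|i] hf /=; first exact: lattice_psi.
  exact: lattice_y.
exact: (lattice_restrict A1 AD AN (fun t => seq_ffun n t == i)).
Qed.

Local Notation act := (act iota word_op).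
Local Notation FA := (free_alg K (blob_gen n l)).
Local Notation actM := (actM iota word_op_linear).

Lemma lattice_act (z : FA) (f : V) : L f -> L (act z f).
Proof.
move: z f; apply: free_alg_ind => [f hf|g f hf|a z1 z2 h1 h2 f hf|z1 z2 h1 h2 f hf].
- by rewrite act1.
- by rewrite act_gen; apply: lattice_op.
- rewrite actP; apply: lattice_lin => //; [exact: h1|exact: h2].
- by rewrite actM; apply/h1/h2.
Qed.

Definition blob_rel_set (z : FA) := exists a b, blob_rel k a b /\ z = a - b.

(** The elements sending the lattice into [x] times itself form a two-sided ideal, because every
    element of the free algebra preserves the lattice; it suffices to test the defining
    relations. *)
Lemma act_ideal (z : FA) : (forall a b, blob_rel k a b -> forall f : V, L f ->
    exists2 f' : V, L f' & act a f = act b f + x *: f') ->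
  ideal_gen blob_rel_set z ->
  forall f : V, L f -> exists2 f' : V, L f' & act z f = x *: f'.
Proof.
have L0 : L 0.
  split=> [w _|t] //; exists (fun _ => 0) => //.
  by apply: polyfun_const; rewrite -(addrN 1); apply: AD (AN A1).
move=> hrel; elim=> {z} [z [a [b [hab ->]]] f hf|f hf|u v _ IHu _ IHv f hf
  |a u _ IH f hf|a u _ IH f hf].
- have [f' hf' e] := hrel _ _ hab f hf; exists f' => //.
  by rewrite actB e addrAC subrr add0r.
- by exists 0; rewrite ?act0 ?scaler0.
- have [f1 h1 e1] := IHu f hf; have [f2 h2 e2] := IHv f hf.
  exists (f1 - f2); last by rewrite actB e1 e2 scalerBr.
  rewrite addrC -scaleN1r; apply: lattice_lin => //; exact: AN.
- have [f' hf' e] := IH f hf; exists (act a f'); first exact: lattice_act.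
  rewrite actM e; have := act_linear iota word_op_linear a x f' 0.
  have -> : act a 0 = 0.
    have := act_linear iota word_op_linear a 1 0 0; rewrite !scale1r addr0 => h.
    by apply: (addIr (act a 0)); rewrite add0r -h.
  by rewrite !addr0.
- by rewrite actM; apply/IH/lattice_act.
Qed.


Lemma lattice_ext (f h : V) : L f -> L h ->
  (forall w, size w = n -> f w = h w) -> f = h.
Proof.
move=> [f0 _] [h0 _] e; apply/funext => w.
by have [/e //|sw] := eqVneq (size w) n; rewrite f0 ?h0.
Qed.

(** On the support of [e_op i f] the residue sequence is [i], so coefficients computed from the word
    turn into those written in the relations. *)
Lemma e_op_coef (c : {ffun 'I_n -> 'Z_l} -> F) i (f : V) w :
  c (seq_ffun n (res w)) * e_op i f w = c i * e_op i f w.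
Proof. by rewrite /e_op; case: eqP => [->//|_]; rewrite !mulr0. Qed.

Lemma word_at w (r : 'I_n.-1) : size w = n -> exists p a b u,
  [/\ w = p ++ a :: b :: u, r = size p :> nat,
      seq_ffun n (res w) (lo r) = next_res p a
    & seq_ffun n (res w) (hi r) = next_res (rcons p a) b].
Proof.
move=> sw; have rn : (r.+1 < size w)%N by rewrite sw; exact: (ltn_ord (hi r)).
have [p [a [b [u [ew sp]]]]] := split_two rn.
exists p, a, b, u; split=> //; rewrite ew res_cat /=.
  by rewrite ffunE /= -sp -(size_res k p) nth_first.
by rewrite ffunE /= -sp -(size_res k p) nth_second.
Qed.

Lemma swapK (r : 'I_n.-1) : involutive (@swap n l r).
Proof. by move=> i; apply/ffunP => j; rewrite !ffunE tpermK. Qed.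

Lemma e_op_swap p a b u (r : 'I_n.-1) i : size (p ++ a :: b :: u) = n ->
  r = size p :> nat -> a != b ->
  (seq_ffun n (res (p ++ b :: a :: u)) == i) =
  (seq_ffun n (res (p ++ a :: b :: u)) == swap r i).
Proof.
move=> sw rp ab; have [e1 e2] := res_swap k p u ab.
rewrite e1 e2.
have := @two_positions n l (res p) (res_from k (p ++ [:: a; b]) u)
  (next_res p a) (next_res p b).
rewrite -e1 size_res sw => /(_ erefl)[r' [er _ _ <-]].
have -> : r' = r by apply/val_inj; rewrite /= er size_res rp.
by rewrite -(inj_eq (inv_inj (@swapK r))) swapK.
Qed.

Lemma psi_e (r : 'I_n.-1) i (f : V) w : size w = n ->
  psi_op r (e_op i f) w = e_op (swap r i) (psi_op r f) w.
Proof.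
move=> sw; have [p [a [b [u [ew rp _ _]]]]] := word_at r sw.
rewrite ew in sw *; rewrite rp /e_op !psi_opE.
have [ab|ab] := eqVneq a b; first by rewrite if_same.
rewrite (e_op_swap _ sw rp ab).
case: ifP => [/eqP er|_]; last by case: (seq_ffun _ _ == _); rewrite ?mulr0.
have -> : (seq_ffun n (res (p ++ a :: b :: u)) == i) =
          (seq_ffun n (res (p ++ a :: b :: u)) == swap r i).
  rewrite -(e_op_swap _ sw rp ab); have [e1 e2] := res_swap k p u ab.
  by rewrite e1 e2 er.
by case: ifP => // _; rewrite subrr mul0r.
Qed.

Lemma psi_far_lt (r s : 'I_n.-1) (f : V) w : size w = n -> (r.+1 < s)%N ->
  psi_op r (psi_op s f) w = psi_op s (psi_op r f) w.
Proof.
move=> sw rs; have [p' [c [d [u [ew sp _ _]]]]] := word_at s sw.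
have [p [a [b [q [ep rp]]]]] : exists p a b q,
    p' = p ++ a :: b :: q /\ size p = r.
  by apply: split_two; rewrite -sp.
rewrite ew sp ep -rp -catA /=; exact: psi_far.
Qed.

Lemma sqr_coef (r : 'I_n.-1) i (f : V) w : size w = n ->
  psi_op r (psi_op r (e_op i f)) w =
  (if i (lo r) == i (hi r) then 0
   else if i (hi r) == i (lo r) + 1 then X (nth false w r.+1) - X (nth false w r)
   else if i (lo r) == i (hi r) + 1 then X (nth false w r) - X (nth false w r.+1)
   else 1) * e_op i f w.
Proof.
move=> sw; have [p [a1 [b1 [u [ew rp lo_r hi_r]]]]] := word_at r sw.
rewrite rp {1}ew psi_psi //= -ew -lo_r -hi_r ew nth_first nth_second -ew.
exact: (e_op_coef (fun t => if t (lo r) == t (hi r) then 0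
  else if t (hi r) == t (lo r) + 1 then X b1 - X a1
  else if t (lo r) == t (hi r) + 1 then X a1 - X b1 else 1)).
Qed.

(** All relations hold exactly, with [f' = 0], except [y_1 e(i) = 0], whose left side multiplies by
    the weight of the first letter. *)
Lemma act_rel a b : blob_rel k a b -> forall f : V, L f ->
  exists2 f' : V, L f' & act a f = act b f + x *: f'.
Proof.
move=> hab f hf.
have L0 : L 0.
  split=> [w _|t] //; exists (fun _ => 0) => //.
  by apply: polyfun_const; rewrite -(addrN 1); apply: AD (AN A1).
have nonexact (c : F) (h : V) : A c -> L h ->
    (forall w, size w = n -> act a f w = act b f w + x * (c * h w)) ->
  exists2 f' : V, L f' & act a f = act b f + x *: f'.
  move=> Ac hh e; exists (fun w => c * h w + 0); first exact: lattice_lin.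
  have Lb : L (act b f) by exact: lattice_act.
  apply: lattice_ext => [||w sw]; first exact: lattice_act.
    have := lattice_lin Ax (lattice_lin Ac hh L0) Lb.
    by congr (lattice _ _ _ _ _ _); apply/funext => w; rewrite addrC.
  by rewrite e //; congr (_ + _ * _); rewrite addr0.
have exact_ : (forall w, size w = n -> act a f w = act b f w) ->
  exists2 f' : V, L f' & act a f = act b f + x *: f'.
  move=> e; apply: (nonexact 1 0) => // w sw.
  by rewrite e // mulr0 mulr0 addr0.
have kNk : (k == - k) = false by rewrite -subr_eq0 opprK (negbTE kk_neq0).
have Nkk : (- k == k) = false by rewrite eq_sym.
have first_res (s : 'I_n) w i : s = 0%N :> nat -> size w = n ->
    seq_ffun n (res w) = i -> i s = if nth false w s then - k else k.
  move=> s0 sw <-; rewrite ffunE s0; case: w sw => [sw|c w _].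
    by case: s {s0} => s; rewrite -sw.
  by rewrite /= next_res_nil.
case: hab nonexact exact_ => [s i s0 hi|s i s0 h1 h2|s t i s0 t1 hst|i j||s i|r i
  |s t|r s h1 h2|r s h|r i|r i|r i h|r i h|r i h|r i h|r s i rs] nonexact exact_.
(* As [k] and [-k] differ, [i s != k] says that the first letter is [true]; its weight is [x] times
   this constant. *)
- apply: (nonexact (if (i s != k) == tl then 0 else 1) (e_op i f)).
  + by case: ifP => // _; rewrite -(addrN 1); apply: AD (AN A1).
  + exact: (lattice_op (Ge i)).
  + move=> w sw; rewrite (act_gen2 iota word_op_linear) act0 add0r /=.
    rewrite /y_op /e_op; case: eqP => [ei|_]; last by rewrite !mulr0.
    rewrite (first_res _ _ _ s0 sw ei) /weight.
    by case: (nth _ _ _); rewrite ?eqxx ?Nkk /=; case: ifP => _;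
       rewrite ?mul0r ?mulr0 ?mul1r.
- apply: exact_ => w sw; rewrite act_gen act0 /= /e_op; case: eqP => // ei.
  by move: h1 h2; rewrite (first_res _ _ _ s0 sw ei); case: (nth _ _ _);
    rewrite eqxx.
- apply: exact_ => w sw; rewrite act_gen act0 /= /e_op; case: eqP => // ei.
  have n2 : (0 < n.-1)%N by rewrite -subn1 subn_gt0 -t1.
  have [p [a1 [b1 [u [ew rp lo_r hi_r]]]]] := word_at (Ordinal n2) sw.
  have p0 : p = [::] by case: (p) rp.
  have es : s = lo (Ordinal n2) by apply/val_inj; rewrite /= s0.
  have et : t = hi (Ordinal n2) by apply/val_inj; rewrite /= t1.
  move: hst; rewrite es et -ei lo_r hi_r p0 next_res_rcons !next_res_nil.
  (* After a first residue [k] the second is [k + 1] or [-k], and after [-k] it is [-k + 1] or [k].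
     The forbidden starts would need [2 = 0], [2k = 1] or [2k = -1]. *)
  have no2 (c : 'Z_l) : (c + 1 == c - 1) = false.
    by rewrite eq_sym subr_eq eq_sym succ2_neq.
  have NkB : (- k == k - 1) = false.
    apply: contraNF kk_neq1 => /eqP e.
    by rewrite -subr_eq0 -addrA -e subrr.
  have kNB : (k == - k - 1) = false.
    apply: contraNF kk_neqN1 => /eqP e.
    have e1 : k + 1 = - k by rewrite {1}e subrK.
    by rewrite -addr_eq0 -addrA e1 subrr.
  by case: (a1); case: (b1); rewrite /= ?addr0 ?no2 ?kNk ?Nkk ?NkB ?kNB ?andbF.
- apply: exact_ => w sw; rewrite (act_gen2 iota word_op_linear) /= /e_op.
  have [->|ij] := eqVneq i j; first by rewrite act_gen /= /e_op; case: (seq_ffun _ _ == j).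
  by rewrite act0; case: eqP => // ->; rewrite (negbTE ij).
- apply: exact_ => w sw; rewrite act1 act_sum fct_sumE.
  under eq_bigr => i _ do rewrite act_gen /= /e_op.
  by rewrite -big_mkcond /= (big_pred1 (seq_ffun n (res w))) // => i; rewrite eq_sym.
- apply: exact_ => w sw; apply: (act_gen22 iota word_op_linear (ev := fun u => u w)); rewrite /= /e_op /y_op.
  by case: ifP => // _; rewrite mulr0.
- by apply: exact_ => w sw; apply: (act_gen22 iota word_op_linear (ev := fun u => u w)); rewrite /=; exact: psi_e.
- apply: exact_ => w sw; apply: (act_gen22 iota word_op_linear (ev := fun u => u w)); rewrite /= /y_op.
  by rewrite mulrCA.
- apply: exact_ => w sw; apply: (act_gen22 iota word_op_linear (ev := fun u => u w)); rewrite /=.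
  have [p [a1 [b1 [u [-> rp _ _]]]]] := word_at r sw.
  by rewrite rp psi_y_far // -rp.
- apply: exact_ => w sw; apply: (act_gen22 iota word_op_linear (ev := fun u => u w)); rewrite /=.
  by case/orP: h => h; [|symmetry]; exact: psi_far_lt.
- apply: exact_ => w sw; apply: (act_gen3_slide iota word_op_linear (ev := fun u => u w)).
  rewrite /=.
  have [p [a1 [b1 [u [ew rp lo_r hi_r]]]]] := word_at r sw.
  rewrite [in LHS]rp {1}ew psi_y_hi // -rp -ew /=.
  congr (_ + _); rewrite -lo_r -hi_r.
  exact: (e_op_coef (fun t => (t (lo r) == t (hi r))%:R)).
- apply: exact_ => w sw; apply: (act_gen3_slide iota word_op_linear (ev := fun u => u w)).
  rewrite /=.
  have [p [a1 [b1 [u [ew rp lo_r hi_r]]]]] := word_at r sw.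
  rewrite [in LHS]rp {1}ew y_hi_psi // -rp -ew /=.
  congr (_ + _); rewrite -lo_r -hi_r.
  exact: (e_op_coef (fun t => (t (lo r) == t (hi r))%:R)).
- apply: exact_ => w sw; apply: (act_sqr0 iota word_op_linear (ev := fun u => u w)) => /=.
  by rewrite sqr_coef // h eqxx mul0r.
- apply: exact_ => w sw; apply: (act_sqr_diff iota word_op_linear (ev := fun u => u w)).
  rewrite /= sqr_coef // h eqxx eq_sym succ_neq.
  exact: mulrBl.
- apply: exact_ => w sw; apply: (act_sqr_diff iota word_op_linear (ev := fun u => u w)).
  rewrite /= sqr_coef //.
  have -> : i (lo r) = i (hi r) + 1 by rewrite h subrK.
  rewrite succ_neq eqxx eq_sym succ2_neq //; exact: mulrBl.
- apply: exact_ => w sw; apply: (act_sqr_id iota word_op_linear (ev := fun u => u w)) => /=.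
  rewrite sqr_coef //; move: h; rewrite !inE !negb_or => /and3P[n1 n2 n3].
  rewrite eq_sym (negbTE n1) (negbTE n2) -subr_eq eq_sym (negbTE n3).
  by rewrite mul1r.
- apply: exact_ => w sw; apply: (act_braid iota word_op_linear (ev := fun u => u w)).
  rewrite /=.
  have [p [a1 [b1 [u [ew rp lo_r hi_r]]]]] := word_at r sw.
  have [c [u' eu]] : exists c u', u = c :: u'.
    have := ltn_ord (hi s); rewrite /= rs rp -sw ew size_cat /=.
    by case: (u) => [|c u']; [rewrite !addnS addn0 ltnn|exists c, u'].
  have hi_s : seq_ffun n (res w) (hi s)
      = next_res (rcons (rcons p a1) b1) c.
    rewrite ew eu res_cat ffunE /= rs rp -(size_res k p).
    by rewrite nth_third.
  rewrite rs rp {1 2}ew eu psi_braid // -eu -ew -lo_r -hi_r -hi_s.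
  congr (_ + _).
  exact: (e_op_coef (fun t =>
    if (t (hi s) == t (lo r)) && (t (lo r) == t (hi r) - 1) then 1
    else if (t (hi s) == t (lo r)) && (t (lo r) == t (hi r) + 1) then -1 else 0)).
Qed.

End WordRepresentation.

(** * Nonvanishing of a product of dots *)

Section NonVanishing.
Variables (K : fieldType) (n l : nat) (k : 'Z_l).
Hypotheses (two_neq0 : 2%:R != 0 :> 'Z_l) (three_neq0 : 3%:R != 0 :> 'Z_l).
Hypotheses (kk_neq0 : k + k != 0) (kk_neq1 : k + k != 1) (kk_neqN1 : k + k != -1).
Local Notation F := {fraction {poly K}}.
Local Notation FA := (free_alg K (blob_gen n l)).
Local Notation x := (tofrac 'X : F).

Definition polyfrac (c : K) : F := tofrac c%:P.

Fact polyfrac_additive : zmod_morphism polyfrac.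
Proof. by move=> a b; rewrite /polyfrac polyCB tofracB. Qed.

Fact polyfrac_multiplicative : monoid_morphism polyfrac.
Proof. by split=> [|a b]; rewrite /polyfrac ?polyC1 ?tofrac1 // polyCM tofracM. Qed.

HB.instance Definition _ := GRing.isZmodMorphism.Build K F polyfrac polyfrac_additive.
HB.instance Definition _ :=
  GRing.isMonoidMorphism.Build K F polyfrac polyfrac_multiplicative.

Definition integral_frac (a : F) := exists p : {poly K}, a = tofrac p.

Lemma tofracX_neq0 : x != 0.
Proof. by rewrite tofrac_eq0 polyX_eq0. Qed.

Lemma tofracX_nonunit a : integral_frac a -> x * a != 1.
Proof.
move=> [p ->]; rewrite -tofracM -tofrac1 tofrac_eq.
apply/eqP => /(congr1 (horner^~ 0)).
by rewrite hornerM hornerX mul0r hornerC => /eqP; rewrite eq_sym oner_eq0.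
Qed.

Definition free_y (j : nat) : FA :=
  oapp (fun s : 'I_n => free_gen K (Gy l s)) 0 (insub j).

Lemma by_pi j : by_ K n k j = presented_pi (@blob_rel K n l k) (free_y j).
Proof.
by rewrite /by_ /free_y; case: insubP => [s _ _|_] //=; rewrite presented_pi0.
Qed.

Lemma act_free_y (F' : fieldType) (iota : {rmorphism K -> F'}) (z : F') tl
    (js : seq nat) (f : seq bool -> F'^o) w :
  all (fun j => j < n)%N js ->
  act iota (word_op k z tl) (\prod_(j <- js) free_y j) f w =
  \prod_(j <- js) weight z tl (nth false w j) * f w.
Proof.
elim: js f => [|j js IH] f /=; first by rewrite !big_nil act1 mul1r.
case/andP=> jn hjs; rewrite !big_cons.
rewrite (actM iota (word_op_linear k z tl) (free_y j)).
have -> : free_y j = free_gen K (Gy l (Ordinal jn)).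
  by rewrite /free_y insubT.
by rewrite act_gen /= /y_op IH // mulrA.
Qed.

Lemma starts_lt ms s : all (leq 1) ms ->
  all (fun j => j < s + sumn ms)%N (starts ms s).
Proof.
elim: ms s => //= m ms IH s /andP[m0 hms].
by rewrite addnA IH // andbT -addnA -{1}[s]addn0 ltn_add2l addn_gt0 m0.
Qed.

Lemma size_blocks ms bs : size bs = size ms -> size (blocks ms bs) = sumn ms.
Proof.
elim: ms bs => [|m ms IH] [|b bs] //= [] sz.
by rewrite size_cat size_nseq IH.
Qed.

(** All the block words share the residue sequence [t], so a single polynomial [g] describes the
    lattice function on all of them, and [starts_not_dvd] applies to it. *)
Lemma blob_starts_neq0 ms p t : all (leq 1) ms -> (size p + sumn ms)%N = n ->
  (forall bs, size bs = size ms -> res k (p ++ blocks ms bs) = t) ->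
  \prod_(j <- starts ms (size p)) by_ K n k j * bE K n k t != 0.
Proof.
move=> hms sz ht; apply/eqP.
have A1 : integral_frac 1 by exists 1; rewrite tofrac1.
have Ax : integral_frac x by exists 'X.
have AD a b : integral_frac a -> integral_frac b -> integral_frac (a + b).
  by move=> [a' ->] [b' ->]; exists (a' + b'); rewrite tofracD.
have AN a : integral_frac a -> integral_frac (- a).
  by move=> [a' ->]; exists (- a'); rewrite tofracN.
have AM a b : integral_frac a -> integral_frac b -> integral_frac (a * b).
  by move=> [a' ->] [b' ->]; exists (a' * b'); rewrite tofracM.
have Ai a : integral_frac (polyfrac a) by exists a%:P.
have wE bs : size bs = size ms -> size (p ++ blocks ms bs) = n.
  by move=> sbs; rewrite size_cat size_blocks.
have st : size t = n.
  by rewrite -(ht (nseq (size ms) true)) ?size_nseq // size_res wE // size_nseq.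
(* The choice of the letter of weight 0 is arbitrary. *)
pose tl := false.
pose z : FA := \prod_(j <- starts ms (size p)) free_y j.
pose e : FA := free_gen K (Ge (seq_ffun n t)).
have -> : \prod_(j <- starts ms (size p)) by_ K n k j * bE K n k t =
    presented_pi (@blob_rel K n l k) (z * e).
  rewrite presented_piM /bE st eqxx; congr (_ * _); rewrite /z.
  rewrite (big_morph _ (@presented_piM _ _ _) (@presented_pi1 _ _ _)).
  by apply: eq_bigr => j _; rewrite by_pi.
move/presented_pi_eq0 => hz.
pose f0 : seq bool -> F^o := fun w => if size w == n then 1 else 0.
have L0 : lattice k x tl integral_frac n f0.
  split=> [w /negbTE sw|u]; first by rewrite /f0 sw.
  exists (fun _ => if size u == n then 1 else 0).
    by apply: polyfun_const; case: ifP => // _; exists 0; rewrite tofrac0.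
  by move=> w <-; rewrite size_res.
have [f1 hf1 e1] := act_ideal tofracX_neq0 three_neq0 A1 AD AN Ai
  (fun a b hab f hf => act_rel tofracX_neq0 two_neq0 three_neq0 kk_neq0 kk_neq1
     kk_neqN1 A1 Ax AD AN Ai hab hf) hz L0.
have [_ /(_ t)[g hg eg]] := hf1.
apply: (starts_not_dvd A1 Ax AD AN AM tofracX_neq0 tofracX_nonunit hg hms).
move=> bs sbs; rewrite -eg; last exact: ht.
have := congr1 (fun u => u (p ++ blocks ms bs)) e1 => /= {e1} e1.
apply: etrans _ e1; rewrite (actM _ (word_op_linear k x tl) z e).
rewrite act_free_y; last by rewrite -sz; apply: starts_lt.
by rewrite act_gen /= /e_op (ht _ sbs) eqxx /f0 wE // eqxx mulr1.
Qed.

End NonVanishing.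

(** * The residue sequence of a bipartition *)

Lemma eq_Zp_nat l i j : (1 < l)%N ->
  (i%:R == j%:R :> 'Z_l) = (i == j %[mod l])%N.
Proof. by move=> l1; rewrite -(inj_eq val_inj) /= !val_Zp_nat. Qed.

Lemma box_of_tlam lam b : b \in boxes lam -> box_of lam (tlam lam) (tlam lam b) = b.
Proof.
move=> hb; have [pm _] := tlam_standard lam.
have inj : {in boxes lam &, injective (tlam lam)}.
  move=> c d hc hd e; have us : uniq [seq tlam lam b | b <- boxes lam].
    by rewrite (perm_uniq pm) iota_uniq.
  have ic : (index c (boxes lam) < size (boxes lam))%N by rewrite index_mem.
  have id : (index d (boxes lam) < size (boxes lam))%N by rewrite index_mem.
  have := nth_uniq 0%N _ _ us; rewrite size_map => /(_ _ _ ic id).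
  rewrite !(nth_map (1%N, false)) // !nth_index // e eqxx => /esym/eqP ei.
  by rewrite -(nth_index (1%N, false) hc) ei nth_index.
exact: nth_index_map.
Qed.

Section LambdaWord.
Variables (n l m : nat) (k : 'Z_l) (lam : nat * nat).
Hypotheses (l_gt1 : (1 < l)%N) (m_bound : (1 <= m < l)%N).
Hypotheses (m_neq0 : m%:R != 0 :> 'Z_l) (m_neq1 : m%:R != 1 :> 'Z_l).
Hypothesis k_def : k + k = m%:R.
Hypothesis lam_bip : (lam.1 + lam.2)%N = n.
Local Notation a := (a_lam l m lam).
Local Notation mu := (box_mu lam).
Local Notation next_res := (next_res k).
Local Notation res := (res k).

Definition tail_comp : bool := (lam.1 <= lam.2)%N.
(** Position [j] is 0-based and holds the entry [j + 1], so even positions below [2 mu] are the odd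
    entries, in the second component. *)
Definition comp_at (j : nat) : bool :=
  if (j < mu.*2)%N then ~~ odd j else tail_comp.
Definition lam_word (j : nat) := mkseq comp_at j.

Lemma mkseqS (T : Type) (f : nat -> T) j : mkseq f j.+1 = rcons (mkseq f j) (f j).
Proof. by rewrite /mkseq -addn1 iotaD map_cat cats1. Qed.

Lemma count_lam_word b j : count_mem b (lam_word j) =
  (if j <= mu.*2 then (if b then uphalf j else j./2)
   else if b == tail_comp then j - mu else mu)%N.
Proof.
elim: j => [|j IH]; first by case: b.
rewrite /lam_word mkseqS -cats1 count_cat /= addn0 -/(lam_word j) IH /comp_at.
have [h1|h1] := ltnP j mu.*2.
  rewrite (ltnW h1); have e1 : uphalf j = (odd j + j./2)%N := uphalf_half j.
  have e2 : (j.+1)./2 = uphalf j by [].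
  have e3 : uphalf j.+1 = (j./2).+1 by [].
  by case: (b); rewrite ?e3 ?e2 e1; case: (odd j) => /=; lia.
have [h2|h2] := leqP j mu.*2; last first.
  by rewrite eq_sym; case: eqP => _; lia.
have -> : j = mu.*2 by lia.
by rewrite uphalf_double doubleK; case: (b); case: tail_comp => /=; lia.
Qed.

Lemma res_lam_word j : res (lam_word j.+1) =
  rcons (res (lam_word j)) (next_res (lam_word j) (comp_at j)).
Proof. by rewrite /lam_word mkseqS -cats1 res_cat cats1. Qed.

Lemma nth_res_lam_word j N : (j < N)%N ->
  nth 0 (res (lam_word N)) j = next_res (lam_word j) (comp_at j).
Proof.
elim: N => // N IH; rewrite ltnS res_lam_word nth_rcons size_res size_mkseq.
by case: ltngtP => // [jN _|-> _]; first exact: IH.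
Qed.

Lemma lam_box j : (j < n)%N -> exists2 b, b \in boxes lam &
  tlam lam b = j.+1 /\ residue k b = next_res (lam_word j) (comp_at j).
Proof.
move=> jn; rewrite /next_res.
exists (if (j < mu.*2)%N then (j./2.+1, ~~ odd j) else ((j - mu).+1, tail_comp)).
  case: ltnP => h; rewrite mem_boxes /=.
    have := odd_double_half j; move: h; rewrite /box_mu.
    by case: (odd j) => /=; lia.
  move: h jn; rewrite -lam_bip /tail_comp /box_mu.
  by case: (leqP lam.1 lam.2); lia.
split; rewrite /tlam /residue /comp_at; case: ltnP => h /=.
- by have := odd_double_half j; case: (odd j) => /=; case: leqP; lia.
- by case: leqP; lia.
- rewrite count_lam_word (ltnW h); congr (_ + _%:R).
  by rewrite uphalf_half; case: (odd j).
- rewrite count_lam_word eqxx; congr (_ + _%:R); case: leqP => // h2.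
  have -> : j = mu.*2 by lia.
  by rewrite uphalf_double doubleK if_same; lia.
Qed.

Lemma seq_ffun_lam : seq_ffun n (res (lam_word n)) = ilam n k lam.
Proof.
apply/ffunP => j; rewrite !ffunE nth_res_lam_word //.
by have [b hb [<- <-]] := lam_box (ltn_ord j); rewrite box_of_tlam.
Qed.

Lemma natr_subl : ((l - m)%:R : 'Z_l) = - m%:R.
Proof.
have h : (m <= l)%N by lia.
by rewrite natrB // char_Zp // sub0r.
Qed.

(** The components alternate here, so their lengths differ by at most one and the two next residues
    differ by [-m] or [1 - m]. *)
Lemma wall_lt j : (j <= mu.*2)%N ->
  next_res (lam_word j) true != next_res (lam_word j) false.
Proof.
move=> h; rewrite /next_res !count_lam_word h uphalf_half natrD.
rewrite -subr_eq0 (_ : _ - _ = (odd j)%:R - (k + k)); last by ring.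
rewrite k_def subr_eq0; case: (odd j); rewrite eq_sym ?m_neq1 //.
Qed.

(** Origin of [a_lam]: one component has stopped at length [mu] and the other has length [j - mu],
    so the next residues agree when [j - 2 mu] is [2k = m] or [-2k = -m], according to the component
    that grows. *)
Lemma wall_ge j : (mu.*2 < j)%N ->
  (next_res (lam_word j) true == next_res (lam_word j) false) =
  (j == a %[mod l])%N.
Proof.
move=> h; rewrite /next_res !count_lam_word leqNgt h /= -eq_Zp_nat //.
have jE : j%:R = (j - mu)%:R + mu%:R :> 'Z_l by rewrite -natrD; congr _%:R; lia.
rewrite -[LHS]subr_eq0 -[RHS]subr_eq0 /a_lam -/tail_comp.
case: tail_comp => /=; rewrite jE natrD -addnn natrD.
  by congr (_ == 0); rewrite -k_def; ring.
rewrite natr_subl -k_def -oppr_eq0; rewrite -[RHS]oppr_eq0.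
rewrite -[LHS]oppr_eq0.
by congr (_ == 0); ring.
Qed.

Lemma tail_gt0 : (mu.*2 < a)%N.
Proof. by rewrite /a_lam; case: ifP; lia. Qed.

Lemma tail_lt j : (mu.*2 < j < a)%N -> (j != a %[mod l])%N.
Proof.
move=> /andP[h1 h2]; have : (a - j < l)%N by move: h2; rewrite /a_lam; case: ifP; lia.
move=> h3; rewrite eq_sym (eqn_mod_dvd _ (ltnW h2)).
by apply/negP => /dvdn_leq; rewrite subn_gt0 h2 => /(_ isT); lia.
Qed.

Lemma wall_at_a : next_res (lam_word a) true = next_res (lam_word a) false.
Proof. by apply/eqP; rewrite wall_ge ?tail_gt0. Qed.

Lemma res_from_nseq p b m' :
  res_from k p (nseq m' b) = mkseq (fun s => next_res p b + s%:R) m'.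
Proof.
elim: m' p => //= m' IH p; rewrite IH /mkseq /= addr0; congr (_ :: _).
rewrite -[1%N]addn0 iotaDl -map_comp; apply: eq_map => s /=.
by rewrite next_res_rcons eqxx natrD addrA.
Qed.

Lemma wall_nseq p b : next_res p true = next_res p false ->
  next_res (p ++ nseq l b) true = next_res (p ++ nseq l b) false /\
  next_res (p ++ nseq l b) false = next_res p false.
Proof.
have e c : next_res (p ++ nseq l b) c = next_res p c.
  by rewrite next_res_cat count_nseq natrM char_Zp // mulr0 addr0.
by rewrite !e.
Qed.

(** From a wall either letter produces the same residues, and [l] equal letters lead back to a wall
    with the same residue. Hence reflecting blocks in the walls does not change the residue
    sequence. *)
Lemma res_from_blocks p q r bs : next_res p true = next_res p false ->
  size bs = q.+1 ->
  res_from k p (blocks (rcons (nseq q l) r) bs) =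
  mkseq (fun s => next_res p false + s%:R) (q * l + r).
Proof.
elim: q p bs => [|q IH] p [|b bs] //= hw [] sz.
  rewrite cats0 res_from_nseq; apply: eq_map => s.
  by case: b; rewrite ?hw.
rewrite res_from_cat res_from_nseq; have [hw' e] := wall_nseq b hw.
rewrite IH // e mulSn -addnA /mkseq (iotaD 0 l (q * l + r)) map_cat add0n.
congr (_ ++ _); first by apply: eq_map => s; case: b {hw' e}; rewrite ?hw.
have -> : iota l (q * l + r) = [seq (l + s)%N | s <- iota 0 (q * l + r)].
  by rewrite -iotaDl addn0.
rewrite -map_comp; apply: eq_map => s /=.
by rewrite natrD char_Zp // add0r.
Qed.

End LambdaWord.

(** * The dot-line algebra *)

Section SquarefreeMonomials.
Variables (K : fieldType) (N : nat) (D : comPzRingType).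
Variables (scal : {rmorphism K -> D}) (X : 'I_N -> D).
Hypothesis X_sqr : forall i,
  X i ^+ 2 = - 2%:R * X i * \sum_(j < N | (j < i)%N) X j.
Hypothesis D_ind : forall P : D -> Prop, P 1 -> (forall j, P (X j)) ->
  (forall a u v, P u -> P v -> P (scal a * u + v)) ->
  (forall u v, P u -> P v -> P (u * v)) -> forall u, P u.

Definition mon (alpha : {ffun 'I_N -> bool}) : D := \prod_(j | alpha j) X j.

Definition initial (i : nat) : D := \prod_(j < N | (j < i)%N) X j.

Lemma initialS (i : 'I_N) : initial i.+1 = initial i * X i.
Proof.
rewrite /initial (bigD1 i) //= mulrC; congr (_ * _); apply: eq_bigl => j.
by rewrite ltnS ltn_neqAle andbC.
Qed.

Lemma initial_split (i : nat) j : (i < j)%N -> exists R, initial j = initial i.+1 * R.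
Proof.
move=> ij; exists (\prod_(s < N | (s < j)%N && ~~ (s < i.+1)%N) X s).
rewrite /initial (bigID (fun s : 'I_N => (s < i.+1)%N)) /=; congr (_ * _).
by apply: eq_bigl => s; case: (ltnP s i.+1) => h; rewrite ?andbF ?andbT //;
   apply: leq_trans h ij.
Qed.

(** Each term of [X_i^2] contains some [X_j] with [j < i], already a factor of [initial i]; this
    produces [initial j * X j ^+ 2], and induction applies. *)
Lemma initial_sqr (i : 'I_N) : initial i * X i ^+ 2 = 0.
Proof.
have [n] := ubnP (i : nat); elim: n i => // n IH i; rewrite ltnS => hi.
rewrite X_sqr mulrCA mulr_sumr big1 ?mulr0 // => j ji.
have [R ->] := initial_split ji; rewrite initialS mulrAC -(mulrA (initial j)).
by rewrite -expr2 (IH j (leq_trans ji hi)) mul0r.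
Qed.

Lemma initial_mul (i : nat) (j : 'I_N) : (j < i)%N -> initial i * X j = 0.
Proof.
move=> ji; have [R ->] := initial_split ji.
by rewrite initialS mulrAC -(mulrA (initial j)) -expr2 initial_sqr mul0r.
Qed.

Definition partial_sum (i : nat) : D := \sum_(j < N | (j <= i)%N) X j.

Lemma partial_sumS (i : 'I_N) :
  partial_sum i = X i + \sum_(j < N | (j < i)%N) X j.
Proof.
rewrite /partial_sum (bigD1 i) //=; congr (_ + _); apply: eq_bigl => j.
by rewrite ltn_neqAle andbC.
Qed.

(** Expanding the product, every cross term repeats a factor of an initial product and vanishes by
    [initial_mul]. *)
Lemma prod_partial_sum i : (i <= N)%N ->
  \prod_(j <- iota 0 i) partial_sum j = initial i.
Proof.
elim: i => [_|i IH iN]; first by rewrite big_nil /initial big_pred0.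
rewrite -addn1 iotaD big_cat /= big_seq1 (IH (ltnW iN)) addn1.
rewrite (initialS (Ordinal iN)) (partial_sumS (Ordinal iN)) mulrDr mulr_sumr.
by rewrite [X in _ + X]big1 ?addr0 // => j ji; exact: initial_mul.
Qed.

Definition squarefree_span (u : D) :=
  exists c : {ffun 'I_N -> bool} -> K, u = \sum_b scal (c b) * mon b.

Lemma span_mon b : squarefree_span (mon b).
Proof.
exists (fun b' => (b' == b)%:R); rewrite (bigD1 b) //= eqxx rmorph1 mul1r big1 ?addr0 //.
by move=> b' /negbTE->; rewrite rmorph0 mul0r.
Qed.

Lemma span_lin a u v : squarefree_span u -> squarefree_span v ->
  squarefree_span (scal a * u + v).
Proof.
move=> [c ->] [d ->]; exists (fun b => a * c b + d b).
rewrite mulr_sumr -big_split; apply: eq_bigr => b _ /=.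
by rewrite rmorphD rmorphM mulrDl mulrA.
Qed.

Lemma span0 : squarefree_span 0.
Proof. by exists (fun=> 0); rewrite big1 // => b _; rewrite rmorph0 mul0r. Qed.

Lemma span_sum (J : Type) (r : seq J) (P : pred J) (u : J -> D) :
  (forall j, P j -> squarefree_span (u j)) ->
  squarefree_span (\sum_(j <- r | P j) u j).
Proof.
move=> h; apply: big_ind => //; first exact: span0.
by move=> v w hv hw; rewrite -[v]mul1r -(rmorph1 scal); apply: span_lin.
Qed.

Definition toggle (j : 'I_N) (b : {ffun 'I_N -> bool}) : {ffun 'I_N -> bool} :=
  [ffun i => (i == j) (+) b i].

Lemma toggleK j : involutive (toggle j).
Proof. by move=> b; apply/ffunP => i; rewrite !ffunE addbA addbb. Qed.

Lemma mon_toggle j (b : {ffun 'I_N -> bool}) : b j -> mon b = X j * mon (toggle j b).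
Proof.
move=> bj; rewrite /mon (bigD1 j) //=; congr (_ * _); apply: eq_bigl => i.
by rewrite ffunE; case: eqP => [->|]; rewrite ?bj ?andbF ?andbT.
Qed.

Lemma X_mon j (b : {ffun 'I_N -> bool}) : ~~ b j -> X j * mon b = mon (toggle j b).
Proof.
move=> bj; rewrite [RHS](@mon_toggle j) ?toggleK //.
by rewrite ffunE eqxx (negbTE bj).
Qed.

(** If [X j] already occurs, the relation for its square gives [-2] times the sum of [X i * mon b]
    over [i < j]: the same monomial with smaller indices. *)
Lemma span_X_mon j b : squarefree_span (X j * mon b).
Proof.
have [n] := ubnP (j : nat); elim: n j => // n IH j; rewrite ltnS => hj.
have [bj|/X_mon->] := boolP (b j); last exact: span_mon.
rewrite (mon_toggle bj) mulrA -expr2 X_sqr.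
have -> : - 2%:R * X j * (\sum_(i < N | (i < j)%N) X i) * mon (toggle j b) =
    scal (- 2%:R) * (\sum_(i < N | (i < j)%N) X i * mon b) + 0.
  by rewrite -mulr_suml (mon_toggle bj) rmorphN rmorph_nat; ring.
apply: span_lin; last exact: span0.
by apply: span_sum => i ij; apply: IH; apply: leq_trans ij hj.
Qed.

Lemma spanP u : squarefree_span u.
Proof.
suff h v : squarefree_span v -> squarefree_span (u * v).
  rewrite -[u]mulr1; apply: h; have -> : 1 = mon [ffun=> false].
    by rewrite /mon big_pred0 // => j; rewrite ffunE.
  exact: span_mon.
elim/D_ind: u v => [v hv|j v [c ->]|a u w hu hw v hv|u w hu hw v hv].
- by rewrite mul1r.
- rewrite mulr_sumr; apply: span_sum => b _; rewrite mulrCA -[_ * _]addr0.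
  apply: span_lin; [exact: span_X_mon|exact: span0].
- by rewrite mulrDl -mulrA; apply: span_lin; [exact: hu|exact: hw].
- by rewrite -mulrA; apply/hu/hw.
Qed.

(* The kernel of Phi is an ideal not containing the socle X_1 ... X_N;
   multiplying by the X_j one at a time isolates every coefficient in front of
   the socle. *)
Lemma mon_indep (W : lmodType K) (Phi : D -> W) :
  (forall u v, Phi (u + v) = Phi u + Phi v) ->
  (forall a u, Phi (scal a * u) = a *: Phi u) ->
  (forall u v, Phi v = 0 -> Phi (u * v) = 0) -> Phi (initial N) != 0 ->
  forall c : {ffun 'I_N -> bool} -> K,
    Phi (\sum_b scal (c b) * mon b) = 0 -> forall b, c b = 0.
Proof.
move=> PhiD PhiZ ker top.
have Phi0 : Phi 0 = 0 by rewrite -(mul0r 0) -(rmorph0 scal) PhiZ scale0r.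
suff main j : (j <= N)%N -> forall c : {ffun 'I_N -> bool} -> K,
    (forall b, c b != 0 -> forall i : 'I_N, (i < N - j)%N -> b i) ->
    Phi (\sum_b scal (c b) * mon b) = 0 -> forall b, c b = 0.
  by move=> c; apply: (main N (leqnn N)) => b _ i; rewrite subnn.
elim: j => [_|j IH jN] c hc hPhi b.
  have c0 b' : b' != [ffun=> true] -> c b' = 0.
    apply: contra_neq_eq => h; apply/ffunP => i; rewrite ffunE.
    by apply: (hc _ h); rewrite subn0.
  have [->|/c0//] := eqVneq b [ffun=> true].
  move: hPhi; rewrite (bigD1 [ffun=> true]) //= big1 => [|b' /c0->]; last first.
    by rewrite rmorph0 mul0r.
  have -> : mon [ffun=> true] = initial N.
    by apply: eq_bigl => i; rewrite ffunE ltn_ord.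
  by rewrite addr0 PhiZ => /eqP; rewrite scaler_eq0 (negbTE top) orbF => /eqP.
have iN : (N - j.+1 < N)%N by rewrite ltn_subrL /= (leq_ltn_trans _ jN).
pose i := Ordinal iN.
have Xmon0 b' : c b' != 0 -> b' i -> X i * mon b' = 0.
  move=> cb bi; rewrite (mon_toggle bi) mulrA -expr2.
  have -> : mon (toggle i b') =
      initial i * \prod_(s < N | toggle i b' s && ~~ (s < i)%N) X s.
    rewrite /mon /initial (bigID (fun s : 'I_N => (s < i)%N)) /=.
    congr (_ * _); apply: eq_bigl => s; rewrite ffunE andbC.
    have [si|] := boolP (s < i)%N; rewrite //= (hc _ cb) //.
    by rewrite addbT; apply/eqP => e; move: si; rewrite e ltnn.
  by rewrite mulrA [_ * initial i]mulrC initial_sqr mul0r.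
(* Coefficients after multiplication by [X i]: a monomial without [X i] acquires it, and one
   containing [X i] dies since it also contains all lower factors. *)
pose c' (b' : {ffun 'I_N -> bool}) := if b' i then c (toggle i b') else 0.
have c'0 : forall b', c' b' = 0.
  apply: (IH (ltnW jN)) => [b' cb' s sj|].
    move: cb'; rewrite /c'; case: ifP; last by rewrite eqxx.
    move=> bi cb; have [->//|si] := eqVneq s i.
    have := hc _ cb s; rewrite ffunE (negbTE si) /=; apply.
    have : (s != N - j.+1 :> nat)%N by apply: contra si => /eqP e; apply/eqP/val_inj.
    by rewrite ltn_neqAle => ->; rewrite /= subnS -ltnS prednK // subn_gt0.
  rewrite -[RHS](ker (X i) _ hPhi); congr Phi.
  rewrite mulr_sumr [RHS](bigID (fun b' : {ffun 'I_N -> bool} => b' i)) /=.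
  rewrite [X in _ = X + _]big1 => [|b' bi]; last first.
    have [->|cb] := eqVneq (c b') 0; first by rewrite rmorph0 mul0r mulr0.
    by rewrite mulrCA Xmon0 ?mulr0.
  rewrite add0r (bigID (fun b' : {ffun 'I_N -> bool} => b' i)) /=.
  rewrite [X in _ + X]big1 => [|b' bi]; last first.
    by rewrite /c' (negbTE bi) rmorph0 mul0r.
  rewrite addr0 (reindex_inj (inv_inj (toggleK i))) /=.
  apply: eq_big => [b'|b' bi]; first by rewrite ffunE eqxx.
  rewrite /c' bi toggleK -X_mon; first exact: mulrCA.
  by move: bi; rewrite ffunE eqxx.
apply: (IH (ltnW jN)) hPhi b => b' cb s sj.
have [->|si] := eqVneq s i.
  apply: contraNT cb => bi; have := c'0 (toggle i b').
  by rewrite /c' ffunE eqxx (negbTE bi) /= toggleK => ->.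
apply: (hc _ cb).
have : (s != N - j.+1 :> nat)%N by apply: contra si => /eqP e; apply/eqP/val_inj.
by rewrite ltn_neqAle => ->; rewrite /= subnS -ltnS prednK // subn_gt0.
Qed.

End SquarefreeMonomials.

Section DotLineAlgebra.
Variables (K : fieldType) (N : nat).
Local Notation D := (DL K N).
Local Notation X := (@DL_X K N).

Lemma DL_ind (P : D -> Prop) : P 1 -> (forall j, P (X j)) ->
  (forall a u v, P u -> P v -> P (a *: u + v)) ->
  (forall u v, P u -> P v -> P (u * v)) -> forall u, P u.
Proof. exact: presented_ind. Qed.

Lemma DL_scalerAl (a : K) (u v : D) : a *: (u * v) = (a *: u) * v.
Proof. exact: presentedAl. Qed.

Lemma DL_scalerAr (a : K) (u v : D) : a *: (u * v) = u * (a *: v).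
Proof. exact: presentedAr. Qed.

Lemma comm_lin (a : K) (x u v : D) :
  x * u = u * x -> x * v = v * x -> x * (a *: u + v) = (a *: u + v) * x.
Proof.
move=> hu hv; apply: (GRing.commrD _ hv).
apply: etrans (esym (DL_scalerAr _ _ _)) _.
exact: etrans (congr1 (fun t => a *: t) hu) (DL_scalerAl _ _ _).
Qed.

Fact DL_mulC : commutative (@GRing.mul D).
Proof.
have XC i v : X i * v = v * X i.
  elim/DL_ind: v => [|j|a u v hu hv|u v hu hv].
  - by rewrite mulr1 mul1r.
  - exact/pi_relMM/DL_comm.
  - exact: (comm_lin _ hu hv).
  - exact: (GRing.commrM hu hv).
elim/DL_ind => [v|j v|a u w hu hw v|u w hu hw v].
- by rewrite mulr1 mul1r.
- exact: XC.
- exact: (esym (comm_lin a (esym (hu v)) (esym (hw v)))).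
- exact: (esym (GRing.commrM (esym (hu v)) (esym (hw v)))).
Qed.

HB.instance Definition _ := GRing.PzRing_hasCommutativeMul.Build D DL_mulC.

(** For the first generator the sum is empty, which merges both kinds of square relation. *)
Lemma DL_sqr i : X i ^+ 2 = - 2%:R * X i * \sum_(j < N | (j < i)%N) X j.
Proof.
have [i0|i_gt0] := posnP i; last exact/pi_rel_sqr_sum/DL_sq.
rewrite big_pred0 => [|j]; last by rewrite i0.
have h := @DL_sq1 K N i i0; rewrite mulr0 expr2.
by apply: pi_relM0; rewrite -expr2.
Qed.

Definition DL_scal (a : K) : D := a *: (1 : D).

Fact DL_scal_additive : zmod_morphism DL_scal.
Proof. by move=> a b; exact: scalerBl. Qed.

Lemma DL_scalE a u : DL_scal a * u = a *: u.
Proof. by apply: etrans (esym (DL_scalerAl _ _ _)) _; rewrite mul1r. Qed.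

Fact DL_scal_multiplicative : monoid_morphism DL_scal.
Proof.
split; first exact: scale1r.
by move=> a b; apply: etrans _ (esym (DL_scalE _ _)); rewrite /DL_scal scalerA.
Qed.

HB.instance Definition _ := GRing.isZmodMorphism.Build K D DL_scal DL_scal_additive.
HB.instance Definition _ :=
  GRing.isMonoidMorphism.Build K D DL_scal DL_scal_multiplicative.

Lemma DL_scal_ind (P : D -> Prop) : P 1 -> (forall j, P (X j)) ->
  (forall a u v, P u -> P v -> P (DL_scal a * u + v)) ->
  (forall u v, P u -> P v -> P (u * v)) -> forall u, P u.
Proof.
by move=> h1 hX hl; apply: DL_ind => // a u v; rewrite -DL_scalE; apply: hl.
Qed.

End DotLineAlgebra.

(** * Modules over the dot-line algebra *)

Section DotLineAction.
Variables (K : fieldType) (N : nat) (V : lmodType K) (op : 'I_N -> V -> V).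
Hypothesis op_linear : forall j, linear (op j).
Hypothesis opC : forall i j v, op i (op j v) = op j (op i v).
Hypothesis op_sqr : forall i v,
  op i (op i v) = (- 2%:R : K) *: op i (\sum_(j < N | (j < i)%N) op j v).
Local Notation D := (DL K N).
Local Notation act := (act idfun op).

Lemma act_DL_rel a b v : DL_rel a b -> act a v = act b v.
Proof.
case=> [i j|i i0|i i0].
- apply: etrans (act_gen2 idfun op_linear _ _ _) _.
  by apply: etrans _ (esym (act_gen2 idfun op_linear _ _ _)); apply: opC.
- set x := free_gen K i; set s := \sum_(j < N | _) _.
  rewrite expr2; apply: etrans (act_gen2 idfun op_linear _ _ _) _.
  apply: etrans _ (esym (actM idfun op_linear (- 2%:R * x) s v)).
  apply: etrans _ (esym (actM idfun op_linear (- 2%:R) x _)).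
  rewrite actN mulr2n actD act1 act_gen op_sqr act_sum.
  rewrite mulr2n opprD scalerDl scaleN1r opprD; congr (- op i _ - op i _).
    by apply: eq_bigr => j _; rewrite act_gen.
  by apply: eq_bigr => j _; rewrite act_gen.
- rewrite expr2; apply: etrans (act_gen2 idfun op_linear _ _ _) _.
  rewrite act0 op_sqr big_pred0 => [|j]; last by rewrite i0.
  by rewrite (op0 op_linear) scaler0.
Qed.

Lemma act_DL_ideal z v :
  ideal_gen (fun z => exists x y, @DL_rel K N x y /\ z = x - y) z -> act z v = 0.
Proof.
have act_v0 a : act a 0 = 0.
  have := act_linear idfun op_linear a 1 0 0; rewrite !scale1r addr0 => h.
  by apply: (addIr (act a 0)); rewrite add0r -h.
move=> h; elim: h v => {z} [z [a [b [hab ->]]] v|v|x y _ IHx _ IHy v|a x _ IH v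
  |a x _ IH v].
- by rewrite actB (act_DL_rel v hab) subrr.
- exact: act0.
- by rewrite actB IHx IHy subrr.
- by rewrite (actM idfun op_linear a x) IH.
- by rewrite (actM idfun op_linear x a) IH.
Qed.

Definition DL_act (u : D) (v : V) : V := act (generic_quotient.repr u) v.

Lemma DL_act_pi z v : DL_act (presented_pi (@DL_rel K N) z) v = act z v.
Proof.
apply/eqP; rewrite eq_sym -subr_eq0 /DL_act -actB; apply/eqP.
by apply: act_DL_ideal; apply/ideal_predP; apply: repr_alg_pi.
Qed.

Lemma DL_act_gen j v : DL_act (DL_X K j) v = op j v.
Proof. by apply: etrans (DL_act_pi _ _) _; exact: act_gen. Qed.

Lemma DL_act1 v : DL_act 1 v = v.
Proof. by apply: etrans (DL_act_pi 1 v) _; exact: act1. Qed.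

Lemma DL_actP a u w v : DL_act (a *: u + w) v = a *: DL_act u v + DL_act w v.
Proof.
have [x ->] := presented_pi_surj u; have [y ->] := presented_pi_surj w.
rewrite -presented_piZ -presented_piD; apply: etrans (DL_act_pi _ _) _.
apply: etrans (actP _ _ _ _ _ _) _.
by congr (_ *: _ + _); apply: esym; exact: DL_act_pi.
Qed.

Lemma DL_actM u w v : DL_act (u * w) v = DL_act u (DL_act w v).
Proof.
have [x ->] := presented_pi_surj u; have [y ->] := presented_pi_surj w.
rewrite -presented_piM; apply: etrans (DL_act_pi _ _) _.
apply: etrans (actM _ op_linear _ _ _) _.
by apply: esym; apply: etrans (DL_act_pi _ _) _; congr act; exact: DL_act_pi.
Qed.

End DotLineAction.

(** * The algebra generated by the dots *)

Lemma corner_absorb (R : pzRingType) (c e : R) : c * e = e * c -> e * e = e ->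
  e * (c * e) = c * e.
Proof. by move=> ce ee; rewrite ce mulrA ee. Qed.

Lemma mulCA_comm (R : pzRingType) (x y v : R) : x * y = y * x ->
  x * (y * v) = y * (x * v).
Proof. by move=> xy; rewrite mulrA xy mulrA. Qed.

Lemma sqr_mul (R : pzRingType) (x w v : R) : x * x = - (x * w) - (x * w) ->
  x * (x * v) = - (x * (w * v)) - (x * (w * v)).
Proof. by move=> xx; rewrite mulrA xx mulrBl mulNr -mulrA. Qed.

Lemma scaleN2r (R : pzRingType) (V : lmodType R) (v : V) :
  (- 2%:R) *: v = - v - v.
Proof. by rewrite mulr2n opprD scalerDl scaleN1r. Qed.

Lemma sqr_diff_comm (R : pzRingType) (z w : R) : z * w = w * z -> z * z = 0 ->
  w * w = 0 -> (z - w) * (z - w) = - ((z - w) * w) - ((z - w) * w).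
Proof.
move=> zw zz ww; rewrite mulrBr; congr (_ - _).
by rewrite !mulrBl zz ww zw sub0r subr0.
Qed.

Lemma corner_mul (R : pzRingType) (u v e : R) : v * e = e * v -> e * e = e ->
  (u * e) * (v * e) = u * v * e.
Proof. by move=> ve ee; rewrite -mulrA ve (mulrA e) ee -ve mulrA. Qed.

Section LambdaRelations.
Variables (K : fieldType) (n l m : nat) (k : 'Z_l) (lam : nat * nat).
Hypotheses (l_gt1 : (1 < l)%N) (m_bound : (1 <= m < l)%N).
Hypotheses (m_neq0 : m%:R != 0 :> 'Z_l) (m_neq1 : m%:R != 1 :> 'Z_l).
Hypothesis m_neqN1 : m%:R != -1 :> 'Z_l.
Hypotheses (two_neq0 : 2%:R != 0 :> 'Z_l) (three_neq0 : 3%:R != 0 :> 'Z_l).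
Hypothesis k_def : k + k = m%:R.
Hypothesis lam_bip : (lam.1 + lam.2)%N = n.
Hypotheses (n_gt : (a_lam l m lam < n)%N) (n_nmod : (n != a_lam l m lam %[mod l])%N).
Local Notation a := (a_lam l m lam).
Local Notation mu := (box_mu lam).
Local Notation N := (q_lam n l m lam).+1.
Local Notation B := (blob K n k).
Local Notation yy j := (by_ K n k j).
Local Notation e := (blob_e K k (ilam n k lam) : B).
Local Notation word := (lam_word lam).

Let ffun_lam := seq_ffun_lam k l_gt1 m_bound m_neq0 m_neq1 lam_bip.
Let low_nowall := wall_lt l_gt1 m_bound m_neq0 m_neq1 k_def lam_bip.
Let tail_wall := wall_ge l_gt1 m_bound m_neq0 m_neq1 k_def lam_bip.
Let ta := tail_gt0 l_gt1 m_bound m_neq0 m_neq1 lam_bip.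
Let tail_nowall := tail_lt l_gt1 m_bound m_neq0 m_neq1 lam_bip.

Lemma lam_idem : e = bE K n k (res k (word n)).
Proof.
by rewrite /bE size_res size_mkseq eqxx ffun_lam.
Qed.

Lemma kk_facts : [/\ k + k != 0, k + k != 1 & k + k != -1].
Proof. by rewrite k_def. Qed.

Lemma res_word_prefix j : (j <= n)%N ->
  exists u, res k (word n) = res k (word j) ++ u.
Proof.
move=> h; exists (res_from k (word j) (mkseq (fun s => comp_at lam (j + s)) (n - j))).
rewrite -res_cat; congr (res k _); rewrite /lam_word /mkseq -{1}(subnKC h).
rewrite iotaD map_cat add0n; congr (_ ++ _).
have -> : iota j (n - j) = [seq (j + s)%N | s <- iota 0 (n - j)].
  by rewrite -iotaDl addn0.
by rewrite -map_comp.
Qed.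

Lemma y_lam_square r : (r < n)%N -> yy r ^+ 2 * e = 0.
Proof.
move=> h; have [_ k1 k2] := kk_facts.
have [sq _] := blob_folded_walk K n two_neq0 three_neq0 k1 k2 r.
have [u eu] := res_word_prefix h.
rewrite lam_idem eu res_lam_word cat_rcons.
have [c hc] : exists c, good k (res k (word r))
    (next_res k (word r) (comp_at lam r)) c.
  have hg := good_res k (word r); case: (comp_at lam r).
    by exists (next_res k (word r) false); exact: good_swap.
  by exists (next_res k (word r) true).
by apply: sq hc; rewrite size_res size_mkseq.
Qed.

Lemma y_lam_step r : (r.+1 < n)%N ->
  next_res k (word r.+1) true != next_res k (word r.+1) false ->
  exists b : bool, yy r.+1 * e = (if b then yy r else - yy r) * e /\
    (comp_at lam r = comp_at lam r.+1 -> b).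
Proof.
move=> h nw; have [_ k1 k2] := kk_facts.
have [_ fo] := blob_folded_walk K n two_neq0 three_neq0 k1 k2 r.
have [u eu] := res_word_prefix h.
set v := next_res k (word r) (comp_at lam r).
set z := next_res k (word r.+1) (comp_at lam r.+1).
exists (z == v + 1); split; last first.
  move=> ec; rewrite /z -ec /lam_word mkseqS next_res_rcons eqxx.
  by rewrite -/(lam_word lam r) eqxx.
rewrite lam_idem eu !res_lam_word !cat_rcons -/v -/z.
have [c [hc zc]] : exists c, good k (res k (word r.+1)) z c /\ z != c.
  rewrite /z; have hg := good_res k (word r.+1); case: (comp_at lam r.+1).
    by exists (next_res k (word r.+1) false); split=> //; exact: good_swap.
  by exists (next_res k (word r.+1) true); rewrite eq_sym.
by apply: fo zc; rewrite ?size_res ?size_mkseq // -res_lam_word.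
Qed.

(** The relation [y_1 e = 0] propagates up to sign as long as no wall is met, and the first wall is
    at length [a]. *)
Lemma y_lam_low r : (r < a)%N -> yy r * e = 0.
Proof.
elim: r => [|r IH] h.
  have [u eu] := res_word_prefix (leq_ltn_trans (leq0n a) n_gt).
  by rewrite lam_idem eu /= by0_bE.
have [|b [-> _]] := @y_lam_step r (ltn_trans h n_gt).
  have [h2|h2] := leqP r.+1 mu.*2; first exact: low_nowall.
  by rewrite tail_wall // tail_nowall // h2.
by case: b; rewrite ?mulNr IH ?oppr0 // ltnW.
Qed.

(** Past [2 mu] all letters lie in one component, so between walls the sign is always plus. *)
Lemma y_lam_const r : (a <= r)%N -> (r.+1 < n)%N -> (r.+1 != a %[mod l])%N ->
  yy r.+1 * e = yy r * e.
Proof.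
move=> ar rn rmod; have h : (mu.*2 < r.+1)%N by rewrite ltnS (leq_trans (ltnW ta)).
have [|b [-> hb]] := @y_lam_step r rn; first by rewrite tail_wall.
by rewrite hb // /comp_at !ltnNge (leq_trans (ltnW ta) ar) (ltnW h).
Qed.

Lemma y_lam_block j s : (s < l)%N -> (a + j * l + s < n)%N ->
  yy (a + j * l + s) * e = yy (a + j * l) * e.
Proof.
elim: s => [|s IH] sl hn; first by rewrite addn0.
rewrite addnS in hn *; rewrite -(IH (ltnW sl) (ltnW hn)); apply: (y_lam_const _ hn).
  by rewrite -addnA leq_addr.
rewrite -addnS -addnA -{2}[a]addn0 eqn_modDl modnMDl mod0n.
rewrite (modn_small sl); exact: isT.
Qed.

(** Strictness is where [n] not congruent to [a] modulo [l] enters: no wall lies at the very end of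
    the word. *)
Lemma lam_pos j : (j < N)%N -> (a + j * l < n)%N.
Proof.
rewrite ltnS => h; rewrite ltn_neqAle; apply/andP; split.
  by apply: contraNneq n_nmod => <-; rewrite addnC modnMDl.
rewrite -(leq_subRL _ (ltnW n_gt)); apply: leq_trans (leq_divM _ l).
by rewrite leq_mul2r h orbT.
Qed.

Lemma blob_yE r : blob_y K n k r = yy r.-1.
Proof. by []. Qed.

(** In 1-based numbering this is [y_{a+jl+1} e], the dot on the first letter after a wall; it
    telescopes to the sum of [Yel] up to [j]. *)
Definition Zel (j : nat) : B := yy (a + j * l) * e.

Lemma Yel0E : Yel K n m k lam 0 = Zel 0.
Proof.
rewrite /Yel !blob_yE mul0n addn0 /= mulrBl (@y_lam_low a.-1).
  by rewrite subr0 /Zel mul0n addn0.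
by rewrite ltn_predL (leq_ltn_trans _ ta).
Qed.

Lemma YelSE j : (j.+1 < N)%N -> Yel K n m k lam j.+1 = Zel j.+1 - Zel j.
Proof.
(* The letter just before the next wall is the last one of block [j], where the dot is still that of
   the start of the block. *)
move=> h; have E : yy (a + j.+1 * l).-1 * e = Zel j.
  have := lam_pos h; rewrite mulSn => hp.
  have -> : (a + (l + j * l)).-1 = (a + j * l + l.-1)%N.
    by rewrite addnCA addnC; case: (l) l_gt1 => // l' _; rewrite addnS.
  apply: y_lam_block; first by rewrite ltn_predL (ltnW l_gt1).
  apply: leq_ltn_trans hp; rewrite -addnA leq_add2l addnC leq_add2r.
  exact: leq_pred.
by rewrite /Yel !blob_yE mulrBl E.
Qed.

Lemma y_lam_Z r : (r < n)%N -> yy r * e = 0 \/ exists2 j, (j < N)%N & yy r * e = Zel j.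
Proof.
move=> rn; have [h|h] := ltnP r a; first by left; exact: y_lam_low.
right; exists ((r - a) %/ l)%N.
  by rewrite ltnS /q_lam leq_div2r // leq_sub2r // ltnW.
have rE : r = (a + (r - a) %/ l * l + (r - a) %% l)%N.
  by rewrite -addnA -divn_eq subnKC.
by rewrite {1}rE y_lam_block -?rE // ltn_pmod // ltnW.
Qed.

Lemma lam_y_comm j : yy j * e = e * yy j.
Proof. by rewrite lam_idem by_bE. Qed.

Lemma lam_ee : e * e = e.
Proof. by rewrite lam_idem bE_idem. Qed.

Lemma Zel_sqr j : (j < N)%N -> Zel j * Zel j = 0.
Proof.
move=> h; apply: etrans (corner_mul _ (lam_y_comm _) lam_ee) _.
by rewrite -expr2 y_lam_square // lam_pos.
Qed.

Lemma Zel_comm i j : Zel i * Zel j = Zel j * Zel i.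
Proof.
apply: etrans (corner_mul _ (lam_y_comm _) lam_ee) _.
apply: etrans _ (esym (corner_mul _ (lam_y_comm _) lam_ee)).
by rewrite by_comm.
Qed.

(** The word is cut at its walls: a prefix of length [a], then [q_lam] blocks of length [l] and a
    last one of length [r]. The dots sit exactly at the block starts. *)
Lemma Zel_top : \prod_(j <- iota 0 N) yy (a + j * l) * e != 0.
Proof.
have [k0 k1 k2] := kk_facts.
pose r := ((n - a) %% l)%N.
have nE : (q_lam n l m lam * l + r)%N = (n - a)%N by rewrite -divn_eq.
have r_gt0 : (0 < r)%N.
  rewrite lt0n; apply: contraNneq n_nmod => r0.
  have -> : n = (q_lam n l m lam * l + a)%N.
    by move: nE; rewrite r0 addn0 => ->; rewrite subnK // ltnW.
  by rewrite modnMDl.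
pose ms := rcons (nseq (q_lam n l m lam) l) r.
have hms : all (leq 1) ms.
  by rewrite all_rcons r_gt0 all_nseq (ltnW l_gt1) orbT.
have sms : sumn ms = (n - a)%N.
  by rewrite /ms -cats1 sumn_cat sumn_nseq /= addn0 mulnC.
have st s q : starts (rcons (nseq q l) r) s = [seq (s + j * l)%N | j <- iota 0 q.+1].
  elim: q s => [|q IH] s /=; first by rewrite mul0n addn0.
  have e1 : iota 1 q.+1 = [seq (1 + j)%N | j <- iota 0 q.+1].
    exact: (iotaDl 1 0).
  apply: etrans (congr1 (cons s) (IH (s + l)%N)) _.
  change (s :: [seq (s + l + j * l)%N | j <- iota 0 q.+1] =
    (s + 0 * l)%N :: [seq (s + j * l)%N | j <- iota 1 q.+1]).
  rewrite mul0n addn0 e1 -map_comp; congr (_ :: _).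
  by apply: eq_map => j /=; rewrite mulnDl mul1n addnA.
have wN bs : size bs = size ms ->
    res k (word a ++ blocks ms bs) = res k (word n).
  rewrite size_rcons size_nseq => sb.
  have ww := wall_at_a l_gt1 m_bound m_neq0 m_neq1 k_def lam_bip.
  have key b : size b = (q_lam n l m lam).+1 ->
      res k (word a ++ blocks ms b) = res k (word a) ++
      mkseq (fun s => next_res k (word a) false + s%:R) (n - a).
    by move=> hb; rewrite res_cat (res_from_blocks l_gt1 r ww hb) nE.
  (* The common residue sequence is identified on the choice filling every block with [tail_comp],
     which gives the word of [lam] itself. *)
  rewrite key //; rewrite -(key (nseq (q_lam n l m lam).+1 (tail_comp lam))) ?size_nseq //.
  congr (res k _).
  have -> : blocks ms (nseq (q_lam n l m lam).+1 (tail_comp lam)) =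
      nseq (n - a) (tail_comp lam).
    rewrite -nE /ms; elim: (q_lam n l m lam) => [|q IH] /=.
      by rewrite cats0.
    by rewrite IH -nseqD addnA -mulSn.
  rewrite /lam_word /mkseq -[in RHS](subnKC (ltnW n_gt)) iotaD map_cat.
  congr (_ ++ _); rewrite add0n; apply: (@eq_from_nth _ false).
    by rewrite size_nseq size_map size_iota.
  move=> i; rewrite size_nseq => hi.
  rewrite nth_nseq hi (nth_map 0%N) ?size_iota // nth_iota // /comp_at ifF //.
  by rewrite ltnNge (leq_trans (ltnW ta)) ?leq_addr.
have hsz : (size (word a) + sumn ms)%N = n.
  by rewrite size_mkseq sms subnKC // ltnW.
have := blob_starts_neq0 K two_neq0 three_neq0 k0 k1 k2 hms hsz wN.
by rewrite size_mkseq st big_map -lam_idem.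
Qed.

Local Notation Y := (Yel K n m k lam).
Local Notation D := (DL K N).
Local Notation X := (@DL_X K N).
Local Notation Ys := (Ysub K n k lam).

Definition Zprev (j : nat) : B := if j is j'.+1 then Zel j' else 0.

Lemma YelE j : (j < N)%N -> Y j = Zel j - Zprev j.
Proof.
case: j => [|j] h /=; last by apply: YelSE.
by rewrite subr0; apply: Yel0E.
Qed.

Lemma Zprev_sqr j : (j < N)%N -> Zprev j * Zprev j = 0.
Proof. by case: j => [|j] h /=; [rewrite mul0r|apply/Zel_sqr/ltnW]. Qed.

Lemma Z_Zprev i j : Zel i * Zprev j = Zprev j * Zel i.
Proof. by case: j => [|j] /=; [rewrite mul0r mulr0|exact: Zel_comm]. Qed.

Lemma Zprev_comm i j : Zprev i * Zprev j = Zprev j * Zprev i.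
Proof. by case: i => [|i] /=; [rewrite mul0r mulr0|exact: Z_Zprev]. Qed.

Lemma Yel_comm i j : (i < N)%N -> (j < N)%N -> Y i * Y j = Y j * Y i.
Proof.
move=> hi hj; rewrite (YelE hi) (YelE hj).
have c1 : GRing.comm (Zel i) (Zel j - Zprev j).
  by apply: GRing.commrB; [exact: Zel_comm|exact: Z_Zprev].
have c2 : GRing.comm (Zprev i) (Zel j - Zprev j).
  by apply: GRing.commrB; [exact/esym/Z_Zprev|exact: Zprev_comm].
exact: (esym (GRing.commrB (esym c1) (esym c2))).
Qed.

Lemma sum_Yel i : (i <= N)%N -> \sum_(j < N | (j < i)%N) Y j = Zprev i.
Proof.
elim: i => [_|i IH iN]; first by rewrite big_pred0.
rewrite (bigD1 (Ordinal iN)) //= (eq_bigl (fun j : 'I_N => (j < i)%N)).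
  by rewrite (IH (ltnW iN)) (YelE iN) subrK.
by move=> j; rewrite ltnS ltn_neqAle andbC.
Qed.

(** With [Y = Z - W] and [Z^2 = W^2 = 0] one gets [Y^2 = -2 Z W = -2 Y W]; here [W] is the sum of
    the preceding [Y_j] by [sum_Yel]. *)
Lemma Yel_sqr i : (i < N)%N ->
  Y i * Y i = - (Y i * Zprev i) - (Y i * Zprev i).
Proof.
move=> h; rewrite (YelE h); apply: sqr_diff_comm; first exact: Z_Zprev.
  exact: Zel_sqr.
exact: Zprev_sqr.
Qed.

Lemma Yel_e j : Y j * e = Y j.
Proof. by rewrite /Yel -mulrA lam_ee. Qed.

Lemma e_Yel j : e * Y j = Y j.
Proof.
apply: corner_absorb lam_ee; apply/esym/GRing.commrB; exact/esym/lam_y_comm.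
Qed.

Definition Yop (j : 'I_N) (v : B) : B := Y j * v.

Lemma Yop_linear j : linear (Yop j).
Proof.
move=> c u v; rewrite /Yop mulrDr; congr (_ + _).
exact/esym/presentedAr.
Qed.

Lemma Yop_comm i j v : Yop i (Yop j v) = Yop j (Yop i v).
Proof.
exact: mulCA_comm (Yel_comm (ltn_ord i) (ltn_ord j)).
Qed.

Lemma Yop_sqr i v : Yop i (Yop i v) =
  (- 2%:R : K) *: Yop i (\sum_(j < N | (j < i)%N) Yop j v).
Proof.
rewrite /Yop -mulr_suml (sum_Yel (ltnW (ltn_ord i))).
apply: etrans (sqr_mul _ (Yel_sqr (ltn_ord i))) _.
exact/esym/scaleN2r.
Qed.

Local Notation A := (DL_act Yop).
Let A_gen := DL_act_gen Yop_linear Yop_comm Yop_sqr.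
Let A1 := DL_act1 Yop_linear Yop_comm Yop_sqr.
Let AP := DL_actP Yop_linear Yop_comm Yop_sqr.
Let AM := DL_actM Yop_linear Yop_comm Yop_sqr.

Lemma DL_act_mulr u v t : A u (v * t) = A u v * t.
Proof.
elim/DL_ind: u v t => [|j|c u w hu hw|u w hu hw] v t.
- by rewrite !A1.
- by rewrite (A_gen j (v * t)) (A_gen j v); exact: mulrA.
- rewrite !AP hu hw mulrDl; congr (_ + _); exact: presentedAl.
- by rewrite !AM hw hu.
Qed.

Lemma e_DL_act u v : e * v = v -> e * A u v = A u v.
Proof.
elim/DL_ind: u v => [|j|c u w hu hw|u w hu hw] v hv.
- by rewrite !A1.
- by rewrite !A_gen /Yop mulrA e_Yel.
- rewrite !AP mulrDr hw //; congr (_ + _).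
  by apply: etrans (esym (presentedAr _ _ _)) _; congr (_ *: _); exact: hu.
- by rewrite !AM; apply/hu/hw.
Qed.

(** The target has unit [e], not 1, so the homomorphism is obtained by letting generators act on all
    of [B] by left multiplication by [Y_j] and evaluating at [e]. Multiplicativity holds because
    this action commutes with right multiplication. *)
Definition Yhom (u : D) : B := A u e.

Lemma YhomP c u v : Yhom (c *: u + v) = c *: Yhom u + Yhom v.
Proof. exact: AP. Qed.

Lemma YhomM u v : Yhom (u * v) = Yhom u * Yhom v.
Proof.
rewrite /Yhom AM -DL_act_mulr; congr (A u _).
exact/esym/e_DL_act/lam_ee.
Qed.

Lemma Yhom1 : Yhom 1 = e.
Proof. exact: A1. Qed.

Lemma Yhom_gen j : Yhom (X j) = Y j.
Proof. by rewrite /Yhom A_gen /Yop Yel_e. Qed.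

Lemma YhomD u v : Yhom (u + v) = Yhom u + Yhom v.
Proof. by have := YhomP 1 u v; rewrite !scale1r. Qed.

Lemma Yhom0 : Yhom 0 = 0.
Proof. by apply: (addIr (Yhom 0)); rewrite -YhomD !add0r. Qed.

Lemma YhomZ c u : Yhom (DL_scal N c * u) = c *: Yhom u.
Proof. by rewrite DL_scalE -[c *: u]addr0 YhomP Yhom0 addr0. Qed.

Lemma Yhom_sum (J : Type) (r : seq J) (P : pred J) (E : J -> D) :
  Yhom (\sum_(j <- r | P j) E j) = \sum_(j <- r | P j) Yhom (E j).
Proof. exact: (big_morph _ YhomD Yhom0). Qed.

Lemma Yhom_mon b : Yhom (mon X b) = Ymon K n m k lam b.
Proof.
rewrite /mon (big_morph _ YhomM Yhom1) /Ymon.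
by apply: eq_bigr => j _; exact: Yhom_gen.
Qed.

Lemma Yhom_lincomb (c : {ffun 'I_N -> bool} -> K) :
  Yhom (\sum_b DL_scal N (c b) * mon X b) = \sum_b c b *: Ymon K n m k lam b.
Proof. by rewrite Yhom_sum; apply: eq_bigr => b _; rewrite YhomZ Yhom_mon. Qed.

Lemma Yhom_partial_sum j : (j < N)%N -> Yhom (partial_sum X j) = Zel j.
Proof.
move=> h; rewrite (partial_sumS X (Ordinal h)) YhomD Yhom_sum Yhom_gen /=.
rewrite (eq_bigr (fun i : 'I_N => Y i)) => [|i _]; last exact: Yhom_gen.
by rewrite (sum_Yel (ltnW h)) (YelE h) subrK.
Qed.

(** The socle is rewritten as the product of partial sums, whose images are the [Zel j]. *)
Lemma Yhom_top : Yhom (initial X N) != 0.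
Proof.
rewrite -(prod_partial_sum (@DL_sqr K N)) // (big_morph _ YhomM Yhom1).
rewrite (eq_big_seq (fun j => Zel j)) => [|j]; last first.
  by rewrite mem_iota => /andP[_ h]; apply: Yhom_partial_sum.
have -> : \big[*%R/e]_(j <- iota 0 N) Zel j = \prod_(j <- iota 0 N) yy (a + j * l) * e.
  elim: (iota 0 N) => [|j s IH]; first by rewrite !big_nil mul1r.
  rewrite !big_cons IH; apply: corner_mul lam_ee.
  elim: s {IH} => [|i s IH]; first by rewrite big_nil mul1r mulr1.
  by rewrite big_cons; apply/esym/GRing.commrM; [exact/esym/lam_y_comm|exact/esym/IH].
exact: Zel_top.
Qed.

Lemma Yhom_indep (c : {ffun 'I_N -> bool} -> K) :
  \sum_b c b *: Ymon K n m k lam b = 0 -> forall b, c b = 0.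
Proof.
rewrite -Yhom_lincomb.
apply: (mon_indep (scal := DL_scal N) (@DL_sqr K N) YhomD YhomZ) Yhom_top c.
by move=> u v hv; rewrite YhomM hv mulr0.
Qed.

Lemma DL_span u : exists c : {ffun 'I_N -> bool} -> K,
  u = \sum_b DL_scal N (c b) * mon X b.
Proof. exact: (spanP (@DL_sqr K N) (@DL_scal_ind K N)). Qed.

Lemma Yhom_sub u : Ys (Yhom u).
Proof.
elim/DL_ind: u => [|j|c u v hu hv|u v hu hv].
- by rewrite Yhom1; exact: Ysub_e.
- rewrite Yhom_gen /Yel mulrBl addrC -scaleN1r.
  have := lam_pos (ltn_ord j) => hj.
  apply: Ysub_lin; apply: Ysub_y.
    by rewrite (ltnW hj) andbT addn_gt0 (leq_ltn_trans (leq0n _) ta).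
  exact: hj.
- by rewrite YhomP; apply: Ysub_lin.
- by rewrite YhomM; apply: Ysub_mul.
Qed.

(** Every generator [y_r e] is 0 or some [Zel j], hence the image of 0 or of a partial sum. *)
Lemma Yhom_surj v : Ys v -> exists u, Yhom u = v.
Proof.
elim=> {v} [|r /andP[r0 rn]|c u v _ [u' <-] _ [v' <-]|u v _ [u' <-] _ [v' <-]].
- by exists 1; exact: Yhom1.
- rewrite blob_yE; have rn' : (r.-1 < n)%N by rewrite prednK.
  case: (y_lam_Z rn') => [->|[j hj ->]]; first by exists 0; exact: Yhom0.
  by exists (partial_sum X j); exact: Yhom_partial_sum.
- by exists (c *: u' + v'); exact: YhomP.
- by exists (u' * v'); exact: YhomM.
Qed.

Lemma Ymon_basis : is_basis Ys (@Ymon K n l m k lam N).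
Proof.
split=> [c|v]; first exact: Yhom_indep.
split=> [/Yhom_surj[u <-]|[c ->]].
  by have [c ->] := DL_span u; exists c; exact: Yhom_lincomb.
by rewrite -Yhom_lincomb; exact: Yhom_sub.
Qed.

Lemma Yhom_inj : injective Yhom.
Proof.
move=> u v huv; apply/eqP; rewrite -subr_eq0; apply/eqP.
have h0 : Yhom (u - v) = 0.
  by rewrite addrC -scaleN1r YhomP huv scaleN1r addNr.
have [c ec] := DL_span (u - v).
have h1 : \sum_b c b *: Ymon K n m k lam b = 0 by rewrite -Yhom_lincomb -ec.
apply: etrans ec _; apply: big1 => b _.
by apply: etrans (DL_scalE _ _) _; rewrite (Yhom_indep h1 b) scale0r.
Qed.

Lemma Yhom_unique (Psi : D -> B) : is_Yhom K n k lam Psi ->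
  (forall j, Psi (X j) = Y j) -> Psi = Yhom.
Proof.
move=> [lin mulP one _] hX; apply/funext; elim/DL_ind => [|j|c u v hu hv|u v hu hv].
- by rewrite one Yhom1.
- by rewrite hX Yhom_gen.
- by rewrite lin YhomP hu hv.
- by rewrite mulP YhomM hu hv.
Qed.

Lemma Ysub_dim : has_dim Ys (2 ^ N)%N.
Proof.
have [ind spn] := Ymon_basis.
have card : (2 ^ N)%N = #|{ffun 'I_N -> bool}| by rewrite card_ffun card_bool card_ord.
pose f (i : 'I_(2 ^ N)) : {ffun 'I_N -> bool} := enum_val (cast_ord card i).
pose g (b : {ffun 'I_N -> bool}) : 'I_(2 ^ N) := cast_ord (esym card) (enum_rank b).
have fg : cancel g f by move=> b; rewrite /f /g cast_ordKV enum_rankK.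
have gf : cancel f g by move=> i; rewrite /f /g enum_valK cast_ordK.
have reidx (c : 'I_(2 ^ N) -> K) :
    \sum_i c i *: Ymon K n m k lam (f i) = \sum_b c (g b) *: Ymon K n m k lam b.
  rewrite (reindex g) /=; last by exists f => b _; [exact: fg|exact: gf].
  by apply: eq_bigr => b _; rewrite fg.
exists (fun i => Ymon K n m k lam (f i)); split=> [c|v].
  by rewrite reidx => h j; rewrite -(gf j); exact: ind h (f j).
rewrite spn; split=> [[c ->]|[c ->]]; last by exists (fun b => c (g b)); exact: reidx.
exists (fun i => c (f i)); rewrite reidx; apply: eq_bigr => b _.
by rewrite fg.
Qed.

End LambdaRelations.

Theorem theorem7p4 (R : realType) (n l m : nat) (q : R[i]) (k : 'Z_l)
    (lam : nat * nat)
    (n_gt0 : (0 < n)%N) (l_odd : odd l) (q_prim : l.-primitive_root q)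
    (m_bound : (1 <= m < l)%N)
    (m_nmod : (m%:R : 'Z_l) \notin [:: 0; 1; -1])
    (k_def : 2%:R * k = m%:R)
    (lam_bip : lam \in Bip1 n)
    (n_gt : (a_lam l m lam < n)%N)
    (n_nmod : (n != a_lam l m lam %[mod l])%N) :
  [/\ is_basis (Ysub R[i] n k lam) (@Ymon R[i] n l m k lam (q_lam n l m lam).+1),
      has_dim (Ysub R[i] n k lam) (2 ^ (q_lam n l m lam).+1)%N
    & exists Phi : DL R[i] (q_lam n l m lam).+1 -> blob R[i] n k,
      [/\ is_Yhom R[i] n k lam Phi,
          forall j, Phi (DL_X R[i] j) = Yel R[i] n m k lam j,
          forall Psi : DL R[i] (q_lam n l m lam).+1 -> blob R[i] n k,
            is_Yhom R[i] n k lam Psi ->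
            (forall j, Psi (DL_X R[i] j) = Yel R[i] n m k lam j) ->
            Psi = Phi,
          injective Phi
        & forall v, Ysub R[i] n k lam v -> exists u, Phi u = v]].
Proof.
have l_gt1 : (1 < l)%N by case/andP: m_bound; apply: leq_ltn_trans.
move: m_nmod; rewrite !inE !negb_or => /and3P[m0 m1 mN1].
(* For [l = 3] the remaining values [m = 1, 2] are congruent to 1 and -1. *)
have l_gt3 : (3 < l)%N.
  case: l l_odd l_gt1 m_bound k m0 m1 mN1 {q_prim k_def n_gt n_nmod}
    => [|[|[|[|l']]]] // _ _.
  by case: m => [|[|[|m']]].
have small i : (0 < i < 4)%N -> i%:R != 0 :> 'Z_l.
  move=> /andP[i0 i4]; rewrite -[0]/(0%:R) eq_Zp_nat // mod0n.
  by rewrite modn_small ?(leq_trans i4) // -lt0n.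
have kk : k + k = m%:R by rewrite -k_def mulr_natl mulr2n.
have lam_n : (lam.1 + lam.2)%N = n by apply/eqP.
have two0 := small 2 isT; have three0 := small 3 isT.
split.
- exact: (Ymon_basis _ l_gt1 m_bound m0 m1 mN1 two0 three0 kk lam_n n_gt n_nmod).
- exact: (Ysub_dim _ l_gt1 m_bound m0 m1 mN1 two0 three0 kk lam_n n_gt n_nmod).
exists (@Yhom R[i] n l m k lam); split.
- split.
  + exact: (YhomP l_gt1 m_bound m0 m1 mN1 two0 three0 kk lam_n n_gt n_nmod).
  + exact: (YhomM l_gt1 m_bound m0 m1 mN1 two0 three0 kk lam_n n_gt n_nmod).
  + exact: (Yhom1 _ l_gt1 m_bound m0 m1 mN1 two0 three0 kk lam_n n_gt n_nmod).
  + exact: (Yhom_sub l_gt1 m_bound m0 m1 mN1 two0 three0 kk lam_n n_gt n_nmod).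
- exact: (Yhom_gen _ l_gt1 m_bound m0 m1 mN1 two0 three0 kk lam_n n_gt n_nmod).
- exact: (Yhom_unique l_gt1 m_bound m0 m1 mN1 two0 three0 kk lam_n n_gt n_nmod).
- exact: (Yhom_inj l_gt1 m_bound m0 m1 mN1 two0 three0 kk lam_n n_gt n_nmod).
- exact: (Yhom_surj l_gt1 m_bound m0 m1 mN1 two0 three0 kk lam_n n_gt n_nmod).
Qed.
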